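(* Let $X\subset\mathbb{R}^n$, with $n\geqslant2$, be a definable set of pure dimension $n-1$ at the origin $0\in\mathbb{R}^n$. Let $\mathcal{C}=C_0X$, $\mathcal{C}'=C_0((\overline{X})_{sing})$ and $$\mathcal{E}=\{v\in\mathbb{R}^n\setminus\{0\}:\ \ell:=\mathbb{R}_+v\subset\mathcal{C}\setminus\mathcal{C}',\ \#(\mathcal{N}_\ell)>1\}.$$ Then for each ray $\ell\subset\mathcal{E}$, the Nash fiber $\mathcal{N}_\ell$ is a closed, connected and definable set of positive dimension.
   Context: Fix an arbitrary o-minimal structure expanding the field of real numbers; ''definable'' means definable in it with real parameters. For a definable set $A\subset\mathbb{R}^n$: $\overline{A}$ is its closure; $A_{reg}$ is the set of points of $A$ near which $A$ is a $C^1$ submanifold of $\mathbb{R}^n$, and $A_{sing}=A\setminus A_{reg}$; for $x\in A_{reg}$, $T_xA$ is the tangent space, viewed as a linear subspace of $\mathbb{R}^n$. $\dim A$ is the maximal dimension of a $C^1$ manifold contained in $A$. For $x\in\overline{A}$, $\dim_xA=\min\{\dim(A\cap U): U \text{ an open neighborhood of } x\}$. $A$ is of pure dimension $d$ at $x\in\overline{A}$ if there is an open neighborhood $U$ of $x$ with $\dim_yA=d$ for all $y\in A\cap U$. A ray is an open half-line $\ell=\mathbb{R}_+v=\{rv: r>0\}$, $v\ne0$. The tangent cone of $A$ at $x$ is $C_xA=\{v\in\mathbb{R}^n:\ \text{there are } x^k\in A,\ t_k\in(0,+\infty) \text{ with } x^k\to x,\ t_k(x^k-x)\to v\}$. $\mathbb{G}(d,n)$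 is the Grassmannian of $d$-dimensional linear subspaces of $\mathbb{R}^n$ (here $d=n-1$). For a ray $\ell=\mathbb{R}_+v\subset C_0X$, the Nash fiber $\mathcal{N}_\ell=\mathcal{N}_\ell(X)$ of $X$ at $0$ along $\ell$ is the set of $P\in\mathbb{G}(d,n)$ for which there is a sequence $x^k\in X_{reg}\setminus\{0\}$ with $x^k\to0$, $x^k/\|x^k\|\to v/\|v\|$ and $T_{x^k}X\to P$. ''Closed, connected, definable, of positive dimension'' refers to $\mathcal{N}_\ell$ as a subset of $\mathbb{G}(n-1,n)$ (regarded as a definable, real algebraic, manifold). *)

(* Defs.v *)
From HB Require Import structures.
From mathcomp Require Import all_boot all_order all_algebra.
From mathcomp Require Import all_classical all_reals all_analysis.

Set Implicit Arguments.
Unset Strict Implicit.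
Unset Printing Implicit Defensive.

Import Order.TTheory GRing.Theory Num.Theory.
Import numFieldNormedType.Exports.

Local Open Scope classical_set_scope.
Local Open Scope ring_scope.

(* Points of R^n are row vectors.  Every singleton is definable
   ([definable_const]), so membership in the structure is definability with
   real parameters.  The order needs no axiom of its own: x <= y iff y - x is
   a square. *)
Record omin_structure (R : realType) := OminStructure {
  definable : forall n, set (set 'rV[R]_n);
  definable_setT : forall n, @definable n setT;
  definable_setC : forall n (A : set 'rV[R]_n),
    definable A -> definable (~` A);
  definable_setI : forall n (A B : set 'rV[R]_n),
    definable A -> definable B -> definable (A `&` B);
  definable_prod : forall m n (A : set 'rV[R]_m) (B : set 'rV[R]_n),
    definable A -> definable B ->
    definable [set z : 'rV[R]_(m + n) | A (lsubmx z) /\ B (rsubmx z)];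
  definable_proj : forall m n (A : set 'rV[R]_(m + n)),
    definable A -> definable [set lsubmx z | z in A];
  definable_diag : forall n (i j : 'I_n),
    definable [set x : 'rV[R]_n | x 0 i = x 0 j];
  definable_const : forall n (i : 'I_n) (r : R),
    definable [set x : 'rV[R]_n | x 0 i = r];
  definable_add : forall n (i j k : 'I_n),
    definable [set x : 'rV[R]_n | x 0 i + x 0 j = x 0 k];
  definable_mul : forall n (i j k : 'I_n),
    definable [set x : 'rV[R]_n | x 0 i * x 0 j = x 0 k];
  definable_omin : forall A : set 'rV[R]_1, definable A ->
    exists s : seq (interval R),
      A = [set x | exists2 I, I \in s & x 0 0 \in I]
}.

Section Geometry.
Variable R : realType.

Definition enorm n (x : 'rV[R]_n) : R := Num.sqrt (\sum_i x 0 i ^+ 2).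

Definition C1_on m n (U : set 'rV[R]_m) (f : 'rV[R]_m -> 'rV[R]_n) : Prop :=
  forall x, U x -> differentiable f x /\ {for x, continuous (jacobian f)}.

(* A is, near its point x, a d-dimensional C^1 submanifold of R^n: a C^1
   diffeomorphism phi : U -> V with inverse psi flattens A `&` U onto
   V `&` (R^d x {0}). *)
Definition C1_submanifold_at n (d : nat) (A : set 'rV[R]_n) (x : 'rV[R]_n) :
    Prop :=
  [/\ (d <= n)%N, A x &
    exists (U V : set 'rV[R]_n) (phi psi : 'rV[R]_n -> 'rV[R]_n),
    [/\ open U /\ open V, U x,
        C1_on U phi /\ C1_on V psi,
        [/\ phi @` U `<=` V, psi @` V `<=` U,
            forall y, U y -> psi (phi y) = y &
            forall z, V z -> phi (psi z) = z] &
        phi @` (A `&` U) =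
          V `&` [set z | forall i : 'I_n, (d <= i)%N -> z 0 i = 0]]].

Definition C1_submanifold n (d : nat) (M : set 'rV[R]_n) : Prop :=
  forall x, M x -> C1_submanifold_at d M x.

Definition reg n (A : set 'rV[R]_n) : set 'rV[R]_n :=
  [set x | exists d, C1_submanifold_at d A x].

Definition sing n (A : set 'rV[R]_n) : set 'rV[R]_n := A `\` reg A.

(* Velocities at x of the C^1 curves in A through x. *)
Definition tangent_vector n (A : set 'rV[R]_n) (x v : 'rV[R]_n) : Prop :=
  exists (g : R -> 'rV[R]_n) (e : R),
    [/\ 0 < e, g 0 = x, derive1 g 0 = v &
        forall t, - e < t < e ->
          [/\ A (g t), derivable g t 1 & {for t, continuous (derive1 g)}]].

Definition is_tangent_space n (A : set 'rV[R]_n) (x : 'rV[R]_n)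
    (P : {vspace 'rV[R]_n}) : Prop :=
  forall v, v \in P <-> tangent_vector A x v.

(* With the harmless convention that the empty set has dimension 0. *)
Definition dim n (A : set 'rV[R]_n) : nat :=
  \max_(d < n.+1 | `[< exists M : set 'rV[R]_n,
                       [/\ M !=set0, C1_submanifold d M & M `<=` A] >]) d.

(* dim_x A = d, for x in the closure of A. *)
Definition is_local_dim n (A : set 'rV[R]_n) (x : 'rV[R]_n) (d : nat) : Prop :=
  (exists U, [/\ open U, U x & dim (A `&` U) = d]) /\
  (forall U, open U -> U x -> (d <= dim (A `&` U))%N).

Definition pure_dim_at n (A : set 'rV[R]_n) (d : nat) (x : 'rV[R]_n) : Prop :=
  closure A x /\
  exists U, [/\ open U, U x & forall y, (A `&` U) y -> is_local_dim A y d].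

Definition ray n (v : 'rV[R]_n) : set 'rV[R]_n :=
  [set r *: v | r in [set r : R | 0 < r]].

Definition tangent_cone n (A : set 'rV[R]_n) (x : 'rV[R]_n) : set 'rV[R]_n :=
  [set v | exists (u : nat -> 'rV[R]_n) (t : nat -> R),
    [/\ forall k, A (u k) /\ 0 < t k,
        u k @[k --> \oo] --> x &
        t k *: (u k - x) @[k --> \oo] --> v]].

Definition grassmannian (d n : nat) : Type :=
  {P : {vspace 'rV[R]_n} | \dim P == d}.

HB.instance Definition _ d n := Choice.on (grassmannian d n).

(* The matrix (acting on rows) of the orthogonal projection onto P:
   B^T (B B^T)^-1 B, where the rows of B form a basis of P. *)
Definition orthoproj n (P : {vspace 'rV[R]_n}) : 'M[R]_n :=
  let B := \matrix_(i < \dim P) (vbasis P)`_i in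
  B^T *m invmx (B *m B^T) *m B.

(* P |-> orthoproj P identifies the Grassmannian with the compact real
   algebraic submanifold {M | M^T = M, M^2 = M, \tr M = d} of R^(n * n); its
   topology and its definable subsets are those of this model. *)
Definition grass_coord d n (P : grassmannian d n) : 'rV[R]_(n * n) :=
  mxvec (orthoproj (val P)).

HB.instance Definition _ d n :=
  Topological.copy (grassmannian d n) (initial_topology (@grass_coord d n)).

Definition grass_definable (S : omin_structure R) d n
    (N : set (grassmannian d n)) : Prop :=
  definable S (@grass_coord d n @` N).

Definition grass_dim d n (N : set (grassmannian d n)) : nat :=
  dim (@grass_coord d n @` N).

(* The Nash fiber of X at 0 along the ray spanned by v. *)
Definition nash_fiber d n (X : set 'rV[R]_n) (v : 'rV[R]_n) :
    set (grassmannian d n) :=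
  [set P | exists (u : nat -> 'rV[R]_n) (T : nat -> grassmannian d n),
    [/\ forall k, [/\ reg X (u k), u k != 0 &
                      is_tangent_space X (u k) (val (T k))],
        u k @[k --> \oo] --> (0 : 'rV[R]_n),
        (enorm (u k))^-1 *: u k @[k --> \oo] --> (enorm v)^-1 *: v &
        T k @[k --> \oo] --> P]].

Definition exceptional_rays n (X : set 'rV[R]_n) : set 'rV[R]_n :=
  [set v | [/\ v != 0,
    ray v `<=` tangent_cone X 0 `\` tangent_cone (sing (closure X)) 0 &
    exists P Q, [/\ nash_fiber (d := n.-1) X v P, nash_fiber X v Q & P <> Q]]].

End Geometry.

(* Main.v *)
Require Import Defs.
From HB Require Import structures.
From mathcomp Require Import all_boot all_order all_algebra.
From mathcomp Require Import all_classical all_reals all_analysis.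
From mathcomp Require Import perm zify ring lra.

Set Implicit Arguments.
Unset Strict Implicit.
Unset Printing Implicit Defensive.

Import Order.TTheory GRing.Theory Num.Theory.
Import numFieldNormedType.Exports.

Local Open Scope classical_set_scope.
Local Open Scope ring_scope.

(** The closure of [X] turns out to be, in a conic neighbourhood of the ray, a
    C^1 hypersurface, because its singular points stay away from the ray
    ([regular_cone]) and because o-minimality controls dimensions
    ([hypersurface_cone]). A hyperplane is determined by its unit normals, and the
    Nash fiber consists of the hyperplanes orthogonal to the vectors of a set
    [nash_normals] of unit vectors: limits of unit normals of the closure at
    points that tend to 0 along the ray ([nash_fiberP]). Normals are
    characterized by a first-order condition on secants ([secant_normalP]), so
    this set is definable; it is visibly closed, hence compact. To pass from the
    closure to [X] one needs that [X] and its closure coincide near many points of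
    the closure ([locally_closed_dense]).

    Connectedness is the heart of the matter ([nash_normals_unsplit]). If the
    limit normals fell into two disjoint closed parts, the closure of [X] would
    split near the ray into two disjoint closed hypersurfaces, each with normals
    near one part. By o-minimality both come close to the ray at every small
    scale. A shortest segment between them is normal to both of them at its ends,
    which forces the two parts to come together. A quadratic penalty keeps the
    shortest segment inside the cone, at the price of an arbitrarily small tilt of
    the normals ([penalized_min_normal]).

    For the dimension, the Nash fiber is now a compact connected definable set
    with two points, so some coordinate takes all values of an interval on it.
    Choosing least values of the other coordinates one by one gives a definable
    curve, which is C^1 over a smaller interval ([definable_curve_seq]).

    The little o-minimal geometry needed is derived from Baire's theorem rather
    than from cell decomposition. A definable set or its complement has interior
    in any given open set ([definable_tame]), by induction on the dimension: the
    axiom gives intervals in the fibres, of length at least 1/k for some k, and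
    by Baire one k serves on an open set of base points. Similarly, definable
    functions of one variable are continuous on a subinterval, have right
    derivatives in the extended reals, and are therefore C^1 on a subinterval
    ([definable_C1]). *)

(** * Euclidean geometry of row vectors *)

Section Euclidean.
Variables (R : realType) (n : nat).
Implicit Types (x y z : 'rV[R]_n) (a : R).

Definition dot x y : R := \sum_i x 0 i * y 0 i.

Lemma dotE x y : x *m y^T = (dot x y)%:M.
Proof.
apply/matrixP => i j; rewrite !mxE (ord1 i) (ord1 j) eqxx mulr1n.
by apply: eq_bigr => k _; rewrite mxE.
Qed.

Lemma dotC x y : dot x y = dot y x.
Proof. by apply: eq_bigr => i _; rewrite mulrC. Qed.

Lemma dotDl x y z : dot (x + y) z = dot x z + dot y z.
Proof. by rewrite -big_split; apply: eq_bigr => i _; rewrite mxE mulrDl. Qed.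

Lemma dotZl a x y : dot (a *: x) y = a * dot x y.
Proof. by rewrite mulr_sumr; apply: eq_bigr => i _; rewrite mxE mulrA. Qed.

Lemma dotNl x y : dot (- x) y = - dot x y.
Proof. by rewrite -scaleN1r dotZl mulN1r. Qed.

Lemma dotBl x y z : dot (x - y) z = dot x z - dot y z.
Proof. by rewrite dotDl dotNl. Qed.

Lemma dotDr x y z : dot z (x + y) = dot z x + dot z y.
Proof. by rewrite dotC dotDl !(dotC z). Qed.

Lemma dotZr a x y : dot y (a *: x) = a * dot y x.
Proof. by rewrite dotC dotZl (dotC y). Qed.

Lemma dotNr x y : dot y (- x) = - dot y x.
Proof. by rewrite dotC dotNl (dotC y). Qed.

Lemma dotBr x y z : dot z (x - y) = dot z x - dot z y.
Proof. by rewrite dotC dotBl !(dotC z). Qed.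

Lemma dot0l x : dot 0 x = 0.
Proof. by apply: big1 => i _; rewrite mxE mul0r. Qed.

Lemma dot0r x : dot x 0 = 0.
Proof. by rewrite dotC dot0l. Qed.

Lemma dot_deltar x i : dot x (delta_mx 0 i) = x 0 i.
Proof.
rewrite /dot (bigD1 i)//= big1 ?addr0 ?mxE ?eqxx ?mulr1// => j ji.
by rewrite mxE eqxx (negbTE ji) mulr0.
Qed.

Definition dotlin := (dotDl, dotDr, dotBl, dotBr, dotZl, dotZr, dotNl, dotNr).

Lemma dot_ge0 x : 0 <= dot x x.
Proof. by apply: sumr_ge0 => i _; rewrite -expr2 sqr_ge0. Qed.

Lemma dot_eq0 x : dot x x = 0 -> x = 0.
Proof.
move=> /eqP; rewrite psumr_eq0; last by move=> i _; rewrite -expr2 sqr_ge0.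
move=> /allP H; apply/rowP => i; rewrite mxE; apply/eqP.
by have := H i (mem_index_enum _); rewrite -expr2 sqrf_eq0.
Qed.

Lemma enormE x : enorm x = Num.sqrt (dot x x).
Proof. by congr Num.sqrt; apply: eq_bigr => i _; rewrite expr2. Qed.

Lemma enorm_ge0 x : 0 <= enorm x.
Proof. by rewrite enormE sqrtr_ge0. Qed.

Lemma enorm_sqr x : enorm x ^+ 2 = dot x x.
Proof. by rewrite enormE sqr_sqrtr// dot_ge0. Qed.

Lemma enorm0 : enorm (0 : 'rV[R]_n) = 0.
Proof. by rewrite enormE dot0l sqrtr0. Qed.

Lemma enorm_eq0 x : enorm x = 0 -> x = 0.
Proof. by move=> x0; apply: dot_eq0; rewrite -enorm_sqr x0 expr0n. Qed.

Lemma enorm_gt0 x : x != 0 -> 0 < enorm x.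
Proof.
move=> x0; rewrite lt_neqAle enorm_ge0 andbT eq_sym.
by apply/negP => /eqP/enorm_eq0/eqP; rewrite (negbTE x0).
Qed.

Lemma enormZ a x : enorm (a *: x) = `|a| * enorm x.
Proof.
by rewrite !enormE dotZl dotZr mulrA -expr2 sqrtrM ?sqr_ge0// sqrtr_sqr.
Qed.

Lemma enormN x : enorm (- x) = enorm x.
Proof. by rewrite !enormE dotNl dotNr opprK. Qed.

Lemma enormB x y : enorm (x - y) = enorm (y - x).
Proof. by rewrite -enormN opprB. Qed.

Lemma enorm1P x : enorm x = 1 <-> dot x x = 1.
Proof.
rewrite -enorm_sqr; split=> [->|E]; first by rewrite expr1n.
by apply/eqP; rewrite -(eqrXn2 (n := 2)) ?enorm_ge0// E expr1n.
Qed.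

Lemma dot_le_enorm x y : dot x y <= enorm x * enorm y.
Proof.
have [->|x0] := eqVneq x 0; first by rewrite dot0l enorm0 mul0r.
have [->|y0] := eqVneq y 0; first by rewrite dot0r enorm0 mulr0.
have := dot_ge0 (enorm y *: x - enorm x *: y).
rewrite !dotlin (dotC y x) -!enorm_sqr => H.
have xy : 0 < enorm x * enorm y by rewrite mulr_gt0// enorm_gt0.
have : 0 <= (enorm x * enorm y) * (2 * (enorm x * enorm y - dot x y)).
  by apply: le_trans H _; rewrite le_eqVlt; apply/orP; left; apply/eqP; ring.
rewrite pmulr_rge0//; lra.
Qed.

Lemma normr_dot_le x y : `|dot x y| <= enorm x * enorm y.
Proof.
by rewrite ler_norml dot_le_enorm andbT lerNl -dotNl -(enormN x) dot_le_enorm.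
Qed.

Lemma ler_enormD x y : enorm (x + y) <= enorm x + enorm y.
Proof.
rewrite -(ler_pXn2r (n := 2)) ?nnegrE ?addr_ge0 ?enorm_ge0//.
rewrite enorm_sqr !dotlin (dotC y x) sqrrD !enorm_sqr.
have := dot_le_enorm x y; lra.
Qed.

Lemma ler_enorm_dist x y z : enorm (x - z) <= enorm (x - y) + enorm (y - z).
Proof. by apply: le_trans (ler_enormD _ _); rewrite addrA subrK. Qed.

Lemma ler_dist_enorm x y : `|enorm x - enorm y| <= enorm (x - y).
Proof.
have := ler_enorm_dist x y 0; have := ler_enorm_dist y x 0.
rewrite !subr0 (enormB y x) ler_norml; lra.
Qed.

Lemma normr_coord_le x i : `|x 0 i| <= enorm x.
Proof.
rewrite -(ler_pXn2r (n := 2)) ?nnegrE ?enorm_ge0// enorm_sqr real_normK ?num_real//.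
rewrite /dot (bigD1 i)//= -expr2 lerDl.
by apply: sumr_ge0 => j _; rewrite -expr2 sqr_ge0.
Qed.

Lemma enorm_le_coord x d : 0 <= d -> (forall i, `|x 0 i| <= d) ->
  enorm x <= n.+1%:R * d.
Proof.
move=> d0 xd; rewrite -(ler_pXn2r (n := 2)) ?nnegrE ?enorm_ge0 ?mulr_ge0 ?ler0n//.
rewrite enorm_sqr; apply: le_trans (_ : \sum_(i < n) d ^+ 2 <= _).
  apply: ler_sum => i _; rewrite -expr2 -real_normK ?num_real//.
  by rewrite ler_pXn2r ?nnegrE// xd.
rewrite sumr_const card_ord -[_ *+ n]mulr_natl exprMn ler_wpM2r ?sqr_ge0//.
rewrite -natrX ler_nat; apply: leq_trans (leqnSn n) _.
by rewrite -{1}[n.+1]muln1 expnS leq_mul2l expn1.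
Qed.

(** The topology of row vectors comes from the sup norm, which is equivalent
    to the Euclidean one. *)
Lemma nbhs_enormP x (A : set 'rV[R]_n) :
  nbhs x A <-> exists2 e, 0 < e & forall y, enorm (y - x) < e -> A y.
Proof.
split=> [/nbhs_ballP[e /= e0 eA]|[e e0 eA]].
  exists e => // y yx; apply: eA; split=> // i j; rewrite (ord1 i) /ball /=.
  apply: le_lt_trans yx; rewrite enormB.
  by apply: le_trans (normr_coord_le _ j); rewrite !mxE.
apply/nbhs_ballP; exists (e / n.+1%:R / 2) => /=.
  by rewrite !divr_gt0// ltr0Sn.
move=> y [d0 xy]; apply: eA; rewrite enormB.
apply: le_lt_trans (enorm_le_coord (ltW d0) _) _.
  by move=> i; rewrite !mxE; apply/ltW; apply: (xy 0 i).
have -> : n.+1%:R * (e / n.+1%:R / 2) = e / 2.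
  by rewrite mulrA (mulrC _ (e / _)) divfK// pnatr_eq0.
lra.
Qed.

Lemma cvg_enormP (u : nat -> 'rV[R]_n) x : u k @[k --> \oo] --> x <->
  forall e, 0 < e -> exists N, forall k, (N <= k)%N -> enorm (u k - x) < e.
Proof.
split=> [ux e e0|H].
  have /ux[N _ HN] : nbhs x [set y | enorm (y - x) < e].
    by apply/nbhs_enormP; exists e.
  by exists N => k Nk; apply: HN.
move=> A /nbhs_enormP[e /H[N HN] eA].
by exists N => // k Nk; apply/eA/HN.
Qed.

Lemma closure_enormP (A : set 'rV[R]_n) x :
  closure A x <-> forall e, 0 < e -> exists2 y, A y & enorm (y - x) < e.
Proof.
split=> [Ax e e0|H B /nbhs_enormP[e /H[y Ay yx] eB]]; last by exists y; split=> //; apply: eB.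
have [|y [Ay yx]] := Ax [set y | enorm (y - x) < e]; last by exists y.
by apply/nbhs_enormP; exists e.
Qed.

Lemma continuous_enorm : continuous (@enorm R n).
Proof.
move=> x A /nbhs_ballP[e /= e0 eA].
apply: (nbhs_enormP x (@enorm R n @^-1` A)).2; exists e => // y yx; apply: eA.
by rewrite /ball /=; apply: le_lt_trans (ler_dist_enorm _ _) _; rewrite enormB.
Qed.

Lemma open_eball x d : open [set y | enorm (y - x) < d].
Proof.
rewrite openE => y /= yx; apply/nbhs_enormP.
exists (d - enorm (y - x)); first by rewrite subr_gt0.
move=> z zy /=; apply: le_lt_trans (ler_enorm_dist z y x) _; lra.
Qed.

Lemma compact_eball x d (A : set 'rV[R]_n) :
  closed A -> (forall y, A y -> enorm (y - x) <= d) -> compact A.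
Proof.
move=> cA Ad; apply: bounded_closed_compact => //.
exists (d + enorm x); split; first exact: num_real.
move=> M dM y /Ad yd; have {}yd : enorm y <= d + enorm x.
  have := ler_enorm_dist y x 0; rewrite !subr0; lra.
change (mx_norm y <= M); rewrite mx_normrE; apply/bigmax_leP; split.
  have := enorm_ge0 y; lra.
move=> i _; rewrite (ord1 i.1); apply: le_trans (normr_coord_le _ _) _; lra.
Qed.

Lemma normalize_dist x u : enorm u = 1 -> enorm x != 0 ->
  enorm ((enorm x)^-1 *: x - u) <= 2 * enorm (x - u).
Proof.
move=> u1 x0; apply: le_trans (ler_enorm_dist _ x _) _.
suff : enorm ((enorm x)^-1 *: x - x) <= enorm (x - u) by lra.
rewrite -[X in _ - X]scale1r -scalerBl enormZ -{2}(gtr0_norm (x := enorm x)).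
  rewrite -normrM mulrBl mulVf// mul1r -normrN opprB -u1.
  exact: ler_dist_enorm.
by rewrite lt_neqAle eq_sym x0 enorm_ge0.
Qed.

Lemma normalize_unit x : enorm x != 0 -> enorm ((enorm x)^-1 *: x) = 1.
Proof. by move=> x0; rewrite enormZ normfV ger0_norm ?enorm_ge0// mulVf. Qed.

End Euclidean.

(** * First-order definability *)

Section Definability.
Variables (R : realType) (S : omin_structure R).

(** Names [definable] for the sake of syntactic matching: the tactic
    [definability] below reads a first-order formula off its argument. *)
Definition dset n (P : 'rV[R]_n -> Prop) : Prop := definable S P.

Definition dfun n (f : 'rV[R]_n -> R) : Prop :=
  dset (fun z : 'rV[R]_(n + 1) => f (lsubmx z) = rsubmx z 0 0).

Definition dmap n m (F : 'rV[R]_n -> 'rV[R]_m) : Prop :=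
  forall i, dfun (fun x => F x 0 i).

Lemma dset_ext n (P Q : 'rV[R]_n -> Prop) :
  (forall x, P x <-> Q x) -> dset P -> dset Q.
Proof. by move=> PQ; suff -> : P = Q by []; apply/funext => x; apply/propext. Qed.

Lemma dfun_ext n (f g : 'rV[R]_n -> R) :
  (forall x, f x = g x) -> dfun f -> dfun g.
Proof. by move=> fg; suff -> : f = g by []; apply/funext. Qed.

Lemma dset_and n (P Q : 'rV[R]_n -> Prop) :
  dset P -> dset Q -> dset (fun x => P x /\ Q x).
Proof. exact: definable_setI. Qed.

Lemma dset_not n (P : 'rV[R]_n -> Prop) : dset P -> dset (fun x => ~ P x).
Proof. exact: definable_setC. Qed.

Lemma dset_or n (P Q : 'rV[R]_n -> Prop) :
  dset P -> dset Q -> dset (fun x => P x \/ Q x).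
Proof.
move=> dP dQ; apply: dset_ext (dset_not (dset_and (dset_not dP) (dset_not dQ))).
move=> x; split=> [/not_andP[/contrapT Px|/contrapT Qx]|[Px|Qx] []//].
  by left.
by right.
Qed.

Lemma dset_imp n (P Q : 'rV[R]_n -> Prop) :
  dset P -> dset Q -> dset (fun x => P x -> Q x).
Proof.
move=> dP dQ; apply: dset_ext (dset_or (dset_not dP) dQ) => x.
split=> [[nP /nP|]//|PQ].
by have [/PQ|] := pselect (P x); [right | left].
Qed.

Lemma dset_const n (P : Prop) : dset (fun _ : 'rV[R]_n => P).
Proof.
have [p|np] := pselect P; first by apply: dset_ext (definable_setT S n).
by apply: dset_ext (dset_not (definable_setT S n)) => x; split => // H; case: H.
Qed.

Lemma dset_ex n m (P : 'rV[R]_n -> 'rV[R]_m -> Prop) :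
  dset (fun z : 'rV[R]_(n + m) => P (lsubmx z) (rsubmx z)) ->
  dset (fun x => exists y, P x y).
Proof.
move=> /definable_proj; apply: dset_ext => x; split=> [[z Pz <-]|[y Pxy]].
  by exists (rsubmx z).
by exists (row_mx x y); rewrite /= ?row_mxKl ?row_mxKr.
Qed.

Lemma dset_exR n (P : 'rV[R]_n -> R -> Prop) :
  dset (fun z : 'rV[R]_(n + 1) => P (lsubmx z) (rsubmx z 0 0)) ->
  dset (fun x => exists r, P x r).
Proof.
move=> dP; apply: dset_ext (dset_ex (P := fun x y => P x (y 0 0)) dP) => x.
split=> [[y]|[r]]; first by exists (y 0 0).
by exists (const_mx r); rewrite mxE.
Qed.

Lemma dset_all n m (P : 'rV[R]_n -> 'rV[R]_m -> Prop) :
  dset (fun z : 'rV[R]_(n + m) => P (lsubmx z) (rsubmx z)) ->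
  dset (fun x => forall y, P x y).
Proof.
move=> dP; have := dset_not (dset_ex (P := fun x y => ~ P x y) (dset_not dP)).
apply: dset_ext => x; split=> [/forallNP H y|H [y]]; first exact: (contrapT (H y)).
by apply; apply: H.
Qed.

Lemma dset_allR n (P : 'rV[R]_n -> R -> Prop) :
  dset (fun z : 'rV[R]_(n + 1) => P (lsubmx z) (rsubmx z 0 0)) ->
  dset (fun x => forall r, P x r).
Proof.
move=> dP; have := dset_not (dset_exR (P := fun x y => ~ P x y) (dset_not dP)).
apply: dset_ext => x; split=> [/forallNP H y|H [y]]; first exact: (contrapT (H y)).
by apply; apply: H.
Qed.

Lemma dset_all_seq n (I : eqType) (s : seq I) (P : I -> 'rV[R]_n -> Prop) :
  (forall i, i \in s -> dset (P i)) ->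
  dset (fun x => forall i, i \in s -> P i x).
Proof.
elim: s => [|a s IH] dP.
  by apply: dset_ext (dset_const n True) => x; split.
have dPs : dset (fun x => forall i, i \in s -> P i x).
  by apply: IH => i si; apply: dP; rewrite in_cons si orbT.
have dPa : dset (P a) by apply: dP; rewrite in_cons eqxx.
apply: dset_ext (dset_and dPa dPs) => x; split=> [[Pa Ps] i|H].
  by rewrite in_cons => /orP[/eqP->//|/Ps].
by split=> [|i si]; apply: H; rewrite in_cons ?eqxx ?si ?orbT.
Qed.

Lemma dset_ex_seq n (I : eqType) (s : seq I) (P : I -> 'rV[R]_n -> Prop) :
  (forall i, i \in s -> dset (P i)) ->
  dset (fun x => exists2 i, i \in s & P i x).
Proof.
move=> dP; have := dset_not (@dset_all_seq n I s (fun i x => ~ P i x) _).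
move=> /(_ (fun i si => dset_not (dP i si))); apply: dset_ext => x.
split=> [H|[i si Pi] /(_ i si)//].
by apply: contrapT => H'; apply: H => i si Pi; apply: H'; exists i.
Qed.

Lemma dset_all_fin n (I : finType) (P : I -> 'rV[R]_n -> Prop) :
  (forall i, dset (P i)) -> dset (fun x => forall i, P i x).
Proof.
move=> dP; have := @dset_all_seq n I (enum I) P (fun i _ => dP i).
apply: dset_ext => x; split=> [H i|H i _]; last exact: H.
by apply: H; rewrite mem_enum.
Qed.

(** Quantifies over the selected coordinates, tied to the given ones by
    diagonals. *)
Lemma dset_reindex n m (s : 'I_m -> 'I_n) (P : 'rV[R]_m -> Prop) :
  dset P -> dset (fun x : 'rV[R]_n => P (\row_i x 0 (s i))).
Proof.
move=> dP; apply: dset_ext (dset_ex (P := fun x y =>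
    P y /\ forall i, x 0 (s i) = y 0 i) _) => [x|].
  split=> [[y [Py xy]]|Px]; last by exists (\row_i x 0 (s i)); split=> // i; rewrite mxE.
  by have -> : \row_i x 0 (s i) = y by apply/rowP => i; rewrite mxE xy.
apply: dset_and.
  apply: dset_ext (definable_prod (definable_setT S n) dP) => z.
  by split=> [[]|].
apply: dset_all_fin => i.
apply: dset_ext (definable_diag S (lshift m (s i)) (rshift n i)) => z.
by rewrite /= !mxE.
Qed.

Lemma dfun_coord n (i : 'I_n) : dfun (fun x => x 0 i).
Proof.
apply: dset_ext (definable_diag S (lshift 1 i) (rshift n ord0)) => z.
by rewrite /= !mxE.
Qed.

Lemma dfun_const n (r : R) : dfun (fun _ : 'rV[R]_n => r).
Proof.
apply: dset_ext (definable_const S (rshift n ord0) r) => z.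
by rewrite /= !mxE; split=> ->.
Qed.

Lemma dfun_reindex n m (s : 'I_m -> 'I_n) (f : 'rV[R]_m -> R) :
  dfun f -> dfun (fun x : 'rV[R]_n => f (\row_i x 0 (s i))).
Proof.
move=> df; pose s' (j : 'I_(m + 1)) : 'I_(n + 1) :=
  match fintype.split j with inl i => lshift 1 (s i) | inr k => rshift n k end.
apply: dset_ext (dset_reindex s' df) => z.
have -> : lsubmx (\row_i z 0 (s' i)) = \row_i (lsubmx z) 0 (s i).
  apply/rowP => i; rewrite !mxE /s'.
  by rewrite -[lshift 1 i]/(unsplit (inl i)) unsplitK.
have -> // : rsubmx (\row_i z 0 (s' i)) = rsubmx z.
apply/rowP => i; rewrite !mxE /s'.
by rewrite -[rshift m i]/(unsplit (inr i)) unsplitK.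
Qed.

(** Substitution into a definable relation is the common source of the closure
    properties below. *)
Lemma dset_comp n m (F : 'rV[R]_n -> 'rV[R]_m) (P : 'rV[R]_m -> Prop) :
  dmap F -> dset P -> dset (fun x => P (F x)).
Proof.
move=> dF dP; apply: dset_ext (dset_ex (P := fun x y =>
    P y /\ forall i, F x 0 i = y 0 i) _) => [x|].
  split=> [[y [Py xy]]|Px]; last by exists (F x).
  by have -> : F x = y by apply/rowP => i; rewrite xy.
apply: dset_and.
  apply: dset_ext (definable_prod (definable_setT S n) dP) => z.
  by split=> [[]|].
apply: dset_all_fin => i.
pose s (j : 'I_(n + 1)) : 'I_(n + m) :=
  match fintype.split j with inl i => lshift m i | inr _ => rshift n i end.
apply: dset_ext (dset_reindex s (dF i)) => z.
have -> : lsubmx (\row_i z 0 (s i)) = lsubmx z.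
  apply/rowP => j; rewrite !mxE /s.
  by rewrite -[lshift 1 j]/(unsplit (inl j)) unsplitK.
by rewrite !mxE /s -[rshift n ord0]/(unsplit (inr ord0)) unsplitK.
Qed.

Lemma row_lsubmx n m (z : 'rV[R]_(n + m)) :
  lsubmx z = \row_i z 0 (lshift m i).
Proof. by apply/rowP => i; rewrite !mxE. Qed.

Lemma dfun_comp n m (F : 'rV[R]_n -> 'rV[R]_m) (f : 'rV[R]_m -> R) :
  dmap F -> dfun f -> dfun (fun x => f (F x)).
Proof.
move=> dF df; pose G (z : 'rV[R]_(n + 1)) := row_mx (F (lsubmx z)) (rsubmx z).
apply: dset_ext (dset_comp (F := G) _ df) => [z|].
  by rewrite /G row_mxKl row_mxKr.
move=> i; apply: dfun_ext (fun z => esym (mxE _ _ _ _)) _.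
case: (fintype.split i) => j.
  apply: (@dset_ext _ (fun z => F (\row_i (lsubmx z) 0 (lshift 1 i)) 0 j = rsubmx z 0 0)).
    by move=> z; rewrite -row_lsubmx.
  exact: (dfun_reindex (fun i => lshift 1 i) (dF j)).
apply: (@dset_ext _ (fun z => lsubmx z 0 (rshift n j) = rsubmx z 0 0)).
  by move=> z; rewrite !mxE.
exact: dfun_coord.
Qed.

Lemma dmap_id n : dmap (fun x : 'rV[R]_n => x).
Proof. by move=> i; apply: dfun_coord. Qed.

Lemma dmap_const n m (y : 'rV[R]_m) : dmap (fun _ : 'rV[R]_n => y).
Proof. by move=> i; apply: dfun_const. Qed.

Lemma dmap_row n m (F : 'I_m -> 'rV[R]_n -> R) :
  (forall i, dfun (F i)) -> dmap (fun x => \row_i F i x).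
Proof.
move=> dF i; rewrite (_ : (fun x => _) = F i) //.
by apply/funext => x; rewrite mxE.
Qed.

Lemma dmap_lsubmx n m k (F : 'rV[R]_n -> 'rV[R]_(m + k)) :
  dmap F -> dmap (fun x => lsubmx (F x)).
Proof.
move=> dF i; rewrite (_ : (fun x => _) = fun x => F x 0 (lshift k i)) //.
by apply/funext => x; rewrite mxE.
Qed.

Lemma dmap_rsubmx n m k (F : 'rV[R]_n -> 'rV[R]_(m + k)) :
  dmap F -> dmap (fun x => rsubmx (F x)).
Proof.
move=> dF i; rewrite (_ : (fun x => _) = fun x => F x 0 (rshift m i)) //.
by apply/funext => x; rewrite mxE.
Qed.

Lemma dmap_row_mx n m k (F : 'rV[R]_n -> 'rV[R]_m) (G : 'rV[R]_n -> 'rV[R]_k) :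
  dmap F -> dmap G -> dmap (fun x => row_mx (F x) (G x)).
Proof.
move=> dF dG i; apply: dfun_ext (fun z => esym (mxE _ _ _ _)) _.
by case: (fintype.split i) => j; [apply: dF | apply: dG].
Qed.

Lemma dset_eq n (f g : 'rV[R]_n -> R) :
  dfun f -> dfun g -> dset (fun x => f x = g x).
Proof.
move=> df dg.
pose F (i : 'I_2) := if i == 0 then f else g.
have dF : dmap (fun x => \row_i F i x) by apply: dmap_row => i; rewrite /F; case: (i == 0).
apply: dset_ext (dset_comp dF (definable_diag S (0 : 'I_2) 1)) => x.
by rewrite /= !mxE.
Qed.

(** Addition and multiplication are given as ternary relations; this
    substitutes definable functions into them. *)
Let dfun_op (op : R -> R -> R) n (f g : 'rV[R]_n -> R) :
  (forall n (i j k : 'I_n), definable S [set x : 'rV[R]_n | op (x 0 i) (x 0 j) = x 0 k]) ->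
  dfun f -> dfun g -> dfun (fun x => op (f x) (g x)).
Proof.
move=> dop df dg.
pose F (i : 'I_3) (z : 'rV[R]_(n + 1)) :=
  if i == 0 then f (lsubmx z) else if i == 1 then g (lsubmx z) else rsubmx z 0 0.
have dF : dmap (fun x => \row_i F i x).
  apply: dmap_row => i; rewrite /F; case: (i == 0); last case: (i == 1).
  - exact/dfun_comp/df/dmap_lsubmx/dmap_id.
  - exact/dfun_comp/dg/dmap_lsubmx/dmap_id.
  - exact: (dmap_rsubmx (@dmap_id (n + 1)) 0).
apply: dset_ext (dset_comp dF (dop 3%N 0 1 (Ordinal (isT : (2 < 3)%N)))) => x.
by rewrite /mkset 3!mxE /F /=.
Qed.

Lemma dfun_add n (f g : 'rV[R]_n -> R) :
  dfun f -> dfun g -> dfun (fun x => f x + g x).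
Proof. by apply: dfun_op => k i j l; apply: definable_add. Qed.

Lemma dfun_mul n (f g : 'rV[R]_n -> R) :
  dfun f -> dfun g -> dfun (fun x => f x * g x).
Proof. by apply: dfun_op => k i j l; apply: definable_mul. Qed.

Lemma dfun_opp n (f : 'rV[R]_n -> R) : dfun f -> dfun (fun x => - f x).
Proof.
move=> df; rewrite (_ : (fun x => _) = fun x => (-1) * f x).
  by apply: dfun_mul => //; apply: dfun_const.
by apply/funext => x; rewrite mulN1r.
Qed.

Lemma dfun_exp n (f : 'rV[R]_n -> R) k : dfun f -> dfun (fun x => f x ^+ k).
Proof.
move=> df; elim: k => [|k IH].
  by rewrite (_ : (fun x => _) = fun=> 1); [apply: dfun_const|apply/funext].
rewrite (_ : (fun x => _) = fun x => f x * f x ^+ k); first exact: dfun_mul.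
by apply/funext => x; rewrite exprS.
Qed.

Lemma dfun_sum n (I : Type) (s : seq I) (Q : pred I) (F : I -> 'rV[R]_n -> R) :
  (forall i, dfun (F i)) -> dfun (fun x => \sum_(i <- s | Q i) F i x).
Proof.
move=> dF; elim: s => [|a s IH].
  apply: dfun_ext (fun x => esym (big_nil _ _ _ _)) _.
  exact: dfun_const.
apply: dfun_ext (fun x => esym (big_cons _ _ _ _ _ _)) _.
by case: (Q a) => //; apply: dfun_add.
Qed.

Lemma dset_le n (f g : 'rV[R]_n -> R) :
  dfun f -> dfun g -> dset (fun x => f x <= g x).
Proof.
move=> df dg; apply: dset_ext (dset_exR (P := fun x r => f x + r * r = g x) _).
  move=> x; split=> [[r <-]|fg]; first by rewrite lerDl -expr2 sqr_ge0.
  by exists (Num.sqrt (g x - f x)); rewrite -expr2 sqr_sqrtr ?subr_ge0// addrC subrK.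
have dr : dfun (fun z : 'rV[R]_(n + 1) => rsubmx z 0 0).
  exact: (dmap_rsubmx (@dmap_id (n + 1)) 0).
have dl := dmap_lsubmx (@dmap_id (n + 1)).
apply: (dset_eq (dfun_add (dfun_comp dl df) (dfun_mul dr dr)) (dfun_comp dl dg)).
Qed.

Lemma dset_lt n (f g : 'rV[R]_n -> R) :
  dfun f -> dfun g -> dset (fun x => f x < g x).
Proof.
move=> df dg; apply: dset_ext (dset_not (dset_le dg df)) => x.
by rewrite ltNge; split=> /negP.
Qed.

Lemma dmap_add n m (F G : 'rV[R]_n -> 'rV[R]_m) :
  dmap F -> dmap G -> dmap (fun x => F x + G x).
Proof.
move=> dF dG i; apply: dfun_ext (fun x => esym (mxE _ _ _ _)) _.
exact: dfun_add.
Qed.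

Lemma dmap_opp n m (F : 'rV[R]_n -> 'rV[R]_m) :
  dmap F -> dmap (fun x => - F x).
Proof.
move=> dF i; apply: dfun_ext (fun x => esym (mxE _ _ _ _)) _.
exact: dfun_opp.
Qed.

Lemma dmap_scale n m (f : 'rV[R]_n -> R) (F : 'rV[R]_n -> 'rV[R]_m) :
  dfun f -> dmap F -> dmap (fun x => f x *: F x).
Proof.
move=> df dF i; apply: dfun_ext (fun x => esym (mxE _ _ _ _)) _.
exact: dfun_mul.
Qed.

Lemma dfun_norm n (f : 'rV[R]_n -> R) : dfun f -> dfun (fun x => `|f x|).
Proof.
move=> df; have dl := dmap_lsubmx (@dmap_id (n + 1)).
have dr : dfun (fun z : 'rV[R]_(n + 1) => rsubmx z 0 0).
  exact: (dmap_rsubmx (@dmap_id (n + 1)) 0).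
apply: dset_ext (dset_and (dset_le (dfun_const (n + 1) 0) dr)
   (dset_or (dset_eq (dfun_comp dl df) dr)
            (dset_eq (dfun_opp (dfun_comp dl df)) dr))) => z.
split=> [[z0 [->|]]|<-]; first by rewrite ger0_norm.
  by move=> E; rewrite -normrN E ger0_norm.
split=> //; have [h|h] := leP 0 (f (lsubmx z)).
  by left; rewrite ger0_norm.
by right; rewrite ltr0_norm.
Qed.

Lemma dmap_coord n m (F : 'rV[R]_n -> 'rV[R]_m) (i : 'I_1) j :
  dmap F -> dfun (fun x => F x i j).
Proof. by rewrite (ord1 i). Qed.

(** A function of one real variable counts as definable when it is so on the
    one-dimensional row vectors. *)
Lemma dfun_comp1 n (f : R -> R) (g : 'rV[R]_n -> R) :
  dfun (fun z : 'rV[R]_1 => f (z 0 0)) -> dfun g -> dfun (fun x => f (g x)).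
Proof.
move=> df dg.
apply: dfun_ext (dfun_comp (F := fun x => \row__ g x) (dmap_row (fun=> dg)) df) => x.
by rewrite mxE.
Qed.

Lemma dfun_dot n m (F G : 'rV[R]_n -> 'rV[R]_m) :
  dmap F -> dmap G -> dfun (fun x => dot (F x) (G x)).
Proof. by move=> dF dG; apply: dfun_sum => i; apply: dfun_mul. Qed.

Lemma dfun_enorm n m (F : 'rV[R]_n -> 'rV[R]_m) :
  dmap F -> dfun (fun x => enorm (F x)).
Proof.
move=> dF; apply: (@dset_ext _ (fun z => 0 <= rsubmx z 0 0 /\
    rsubmx z 0 0 ^+ 2 = dot (F (lsubmx z)) (F (lsubmx z)))).
  move=> z; split=> [[z0 E]|<-]; last by rewrite enorm_ge0 enorm_sqr.
  by rewrite enormE -E sqrtr_sqr ger0_norm.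
have dr : dfun (fun z : 'rV[R]_(n + 1) => rsubmx z 0 0).
  exact: (dmap_rsubmx (@dmap_id (n + 1)) 0).
have dF' : dmap (fun z : 'rV[R]_(n + 1) => F (lsubmx z)).
  by move=> i; apply: (dfun_comp (dmap_lsubmx (@dmap_id (n + 1))) (dF i)).
apply: dset_and; first exact: dset_le (dfun_const _ 0) dr.
exact: dset_eq (dfun_exp 2 dr) (dfun_dot dF' dF').
Qed.

End Definability.

(** Bound variables of a formula become the last coordinates of a longer row
    vector, reached by [lsubmx] and [rsubmx]. *)
Ltac definability_step :=
  cbv beta;
  first [exact: dfun_const | exact: dmap_const | exact: dset_const |
  lazymatch goal with
  | |- forall i, _ => intro
  | |- dset _ (fun x => @?P x /\ @?Q x) => apply: dset_and
  | |- dset _ (fun x => @?P x \/ @?Q x) => apply: dset_or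
  | |- dset _ (fun x => ~ @?P x) => apply: dset_not
  | |- dset _ (fun x => @?P x -> @?Q x) => apply: dset_imp
  | |- dset _ (fun x => exists y : 'rV__, @?P x y) => apply: dset_ex
  | |- dset _ (fun x => exists y, @?P x y) => apply: dset_exR || apply: dset_ex
  | |- dset _ (fun x => forall y : 'rV__, @?P x y) => apply: dset_all
  | |- dset _ (fun x => forall y : 'I__, @?P x y) => apply: dset_all_fin
  | |- dset _ (fun x => forall y, @?P x y) => apply: dset_allR || apply: dset_all
  | |- dset _ (fun x => exists2 i, is_true (i \in ?s) & @?P i x) =>
       apply: dset_ex_seq
  | |- dset _ (fun x => @?f x = @?g x) => apply: dset_eq
  | |- dset _ (fun x => is_true (@?f x <= @?g x)) => apply: dset_le
  | |- dset _ (fun x => is_true (@?f x < @?g x)) => apply: dset_lt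
  | |- dfun _ (fun x => @?f x + @?g x) => apply: dfun_add
  | |- dfun _ (fun x => @?f x * @?g x) => apply: dfun_mul
  | |- dfun _ (fun x => - @?f x) => apply: dfun_opp
  | |- dfun _ (fun x => `| @?f x |) => apply: dfun_norm
  | |- dfun _ (fun x => @?f x ^+ _) => apply: dfun_exp
  | |- dfun _ (fun x => fun_of_matrix (@?F x) _ _) => apply: dmap_coord
  | |- dfun _ (fun x => bigop _ _ _) => apply: dfun_sum
  | |- dfun _ (fun x => enorm (@?F x)) => apply: dfun_enorm
  | |- dfun _ (@enorm _ _) => apply: (dfun_enorm (@dmap_id _ _ _))
  | |- dfun _ (fun x => dot (@?F x) (@?G x)) => apply: dfun_dot
  | |- dmap _ (fun x => x) => apply: dmap_id
  | |- dmap _ (@lsubmx _ _ _ _) => apply: (dmap_lsubmx (@dmap_id _ _ _))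
  | |- dmap _ (@rsubmx _ _ _ _) => apply: (dmap_rsubmx (@dmap_id _ _ _))
  | |- dmap _ (fun x => lsubmx (@?F x)) => apply: dmap_lsubmx
  | |- dmap _ (fun x => rsubmx (@?F x)) => apply: dmap_rsubmx
  | |- dmap _ (fun x => row_mx (@?F x) (@?G x)) => apply: dmap_row_mx
  | |- dmap _ (fun x => @?F x + @?G x) => apply: dmap_add
  | |- dmap _ (fun x => - @?F x) => apply: dmap_opp
  | |- dmap _ (fun x => @?f x *: @?F x) => apply: dmap_scale
  | |- dmap _ (fun x => matrix_of_fun _ _) => apply: dmap_row
  | |- dset _ (fun x => ?A (@?F x)) =>
       apply: (@dset_comp _ _ _ _ F A); last assumption
  | |- dfun _ (fun x => ?f (@?F x)) =>
       (apply: (@dfun_comp _ _ _ _ F f); last assumption)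
       || (apply: (@dfun_comp1 _ _ _ f F); first assumption)
  end].

Ltac definability := repeat definability_step.

(** * Tameness of definable sets *)

HB.instance Definition _ (R : realType) n :=
  Uniform_isComplete.Build 'rV[R]_n (@cauchy_cvg 'rV[R]_n).

Lemma inv_succ_lt (R : realType) (d : R) : 0 < d ->
  exists N, forall k, (N <= k)%N -> k.+1%:R^-1 < d.
Proof.
move=> d0; exists (Num.bound d^-1) => k Nk; rewrite invf_plt ?posrE ?ltr0Sn//.
apply: lt_le_trans (archi_boundP _) _; first by rewrite invr_ge0 ltW.
by rewrite ler_nat (leq_trans Nk).
Qed.

Section Tameness.
Variables (R : realType) (S : omin_structure R).

(** The axiom of o-minimality is used only through germs on the right of a
    point: every definable property of a real number holds, or fails, on some
    interval starting there. *)
Definition right_decided (a : R) (P : R -> Prop) : Prop :=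
  exists2 d, 0 < d & (forall t, a < t < a + d -> P t) \/
                     (forall t, a < t < a + d -> ~ P t).

Lemma right_decided_and a P Q : right_decided a P -> right_decided a Q ->
  right_decided a (fun t => P t /\ Q t).
Proof.
move=> [d d0 hP] [e e0 hQ]; exists (Num.min d e); first by rewrite lt_min d0.
have sub t : a < t < a + Num.min d e -> a < t < a + d /\ a < t < a + e.
  by rewrite -!ltrBlDl lt_min => /andP[-> /andP[-> ->]].
case: hP => hP; last by right=> t /sub[/hP nP _] [].
case: hQ => hQ; last by right=> t /sub[_ /hQ nQ] [].
by left=> t /sub[/hP ? /hQ ?].
Qed.

Lemma right_decided_not a P : right_decided a P -> right_decided a (fun t => ~ P t).
Proof. by move=> [d d0 [H|H]]; exists d => //; [right=> t /H ? | left]. Qed.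

Lemma right_decided_ext a P Q : (forall t, P t <-> Q t) ->
  right_decided a P -> right_decided a Q.
Proof.
by move=> PQ; suff -> : P = Q by []; apply/funext => x; apply/propext.
Qed.

Lemma right_decided_true a : right_decided a (fun=> True).
Proof. by exists 1; [exact: ltr01|left]. Qed.

Lemma right_decided_ge a c : right_decided a (fun t => c <= t).
Proof.
have [ca|ac] := leP c a.
  by exists 1; [exact: ltr01|left=> t /andP[/ltW/(le_trans ca)]].
exists (c - a); first by rewrite subr_gt0.
by right=> t; rewrite addrC subrK => /andP[_ tc]; apply/negP; rewrite -ltNge.
Qed.

Lemma right_decided_gt a c : right_decided a (fun t => c < t).
Proof.
have [ca|ac] := leP c a.
  by exists 1; [exact: ltr01|left=> t /andP[/(le_lt_trans ca)]].
exists (c - a); first by rewrite subr_gt0.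
by right=> t; rewrite addrC subrK => /andP[_ tc]; apply/negP; rewrite -leNgt ltW.
Qed.

Lemma right_decided_itv a (I : interval R) : right_decided a (fun t => t \in I).
Proof.
case: I => l r.
have dl : right_decided a (fun t => (l <= BLeft t)%O).
  case: l => [[] l|[]].
  - by apply: right_decided_ext (right_decided_ge a l) => t; rewrite bnd_simp.
  - by apply: right_decided_ext (right_decided_gt a l) => t; rewrite bnd_simp.
  - by apply: right_decided_ext (right_decided_true a) => t; split.
  - by apply: right_decided_ext (right_decided_not (right_decided_true a)) => t; split.
have dr : right_decided a (fun t => (BRight t <= r)%O).
  case: r => [[] r|[]].
  - apply: right_decided_ext (right_decided_not (right_decided_ge a r)) => t.
    by rewrite bnd_simp ltNge; split=> /negP.
  - apply: right_decided_ext (right_decided_not (right_decided_gt a r)) => t.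
    by rewrite bnd_simp leNgt; split=> /negP.
  - by apply: right_decided_ext (right_decided_not (right_decided_true a)) => t; split.
  - by apply: right_decided_ext (right_decided_true a) => t; split.
apply: right_decided_ext (right_decided_and dl dr) => t.
by rewrite itv_boundlr; split=> [[-> ->]|/andP[-> ->]].
Qed.

Lemma definable_right_decided (P : R -> Prop) (a : R) :
  dset S (fun z : 'rV[R]_1 => P (z 0 0)) -> right_decided a P.
Proof.
move=> /definable_omin[s sP].
have {}sP t : P t <-> exists2 I, I \in s & t \in I.
  have := congr1 (fun A : set 'rV_1 => A (\row__ t)) sP.
  by rewrite /= /mkset !mxE => ->.
apply: right_decided_ext (fun t => iff_sym (sP t)) _ => {P sP}.
elim: s => [|I s IH].
  by apply: right_decided_ext (right_decided_not (right_decided_true a)) => t; split=> // -[].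
apply: right_decided_ext (right_decided_not (right_decided_and
  (right_decided_not (right_decided_itv a I)) (right_decided_not IH))) => t; split.
  move=> /not_andP[/contrapT tI|/contrapT[J Js tJ]].
    by exists I => //; rewrite mem_head.
  by exists J => //; rewrite in_cons Js orbT.
move=> [J]; rewrite in_cons => /orP[/eqP -> tI [] //|Js tJ [_]]; apply.
by exists J.
Qed.

(** Stands in for cell decomposition: up to shrinking open sets, a definable
    set is full or empty. *)
Definition tame n : Prop := forall A : 'rV[R]_n -> Prop, dset S A ->
  forall U : set 'rV[R]_n, open U -> U !=set0 ->
  exists V, [/\ open V, V !=set0, V `<=` U & V `<=` A \/ V `<=` ~` A].

Lemma Baire_cover n (U : set 'rV[R]_n) (A : nat -> set 'rV[R]_n) :
  open U -> U !=set0 -> U `<=` \bigcup_k A k ->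
  exists k V, [/\ open V, V !=set0, V `<=` U & V `<=` closure (A k)].
Proof.
move=> oU [u Uu] UA; apply: contrapT => H.
pose F k := ~` closure (A k) `|` ~` closure U.
have oF k : open (F k).
  by apply: openU; apply: closed_openC; apply: closed_closure.
have dF k : dense (F k).
  move=> O O0 oO; have [[x [Ox Ux]]|OU] := pselect ((O `&` U) !=set0).
    apply: contrapT => OF; apply: H; exists k, (O `&` U); split.
    - exact: openI.
    - by exists x.
    - by move=> y [].
    - by move=> y [Oy Uy]; apply: contrapT => Ay; apply: OF; exists y; split=> //; left.
  case: O0 => x Ox; exists x; split=> //; right=> /(_ O).
  by case=> [|y [Uy Oy]]; [exact: open_nbhs_nbhs|apply: OU; exists y].
have [x [Ux Fx]] := @Baire R 'rV[R]_n F (fun k => conj (oF k) (dF k)) U (ex_intro _ u Uu) oU.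
have [k _ Akx] := UA _ Ux.
case: (Fx k I); apply; exact: subset_closure.
Qed.

(** Baire's theorem makes one of the sets dense in an open set; tameness
    upgrades density to containment. *)
Lemma definable_Baire n (tn : tame n) (U : set 'rV[R]_n)
    (A : nat -> set 'rV[R]_n) :
  (forall k, dset S (A k)) -> open U -> U !=set0 -> U `<=` \bigcup_k A k ->
  exists k V, [/\ open V, V !=set0, V `<=` U & V `<=` A k].
Proof.
move=> dA oU U0 UA; have [k [V [oV V0 VU VA]]] := Baire_cover oU U0 UA.
have [W [oW W0 WV [WA|WA]]] := tn _ (dA k) _ oV V0.
  by exists k, W; split=> //; apply: subset_trans VU.
case: W0 => w Ww; have [] := VA _ (WV _ Ww) W (open_nbhs_nbhs (conj oW Ww)).
by move=> z [Az /WA].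
Qed.

(** Fibrewise over the first coordinates, a definable set or its complement
    contains a right neighbourhood of a given height; by Baire, the size of that
    neighbourhood can be taken constant on an open set. *)
Lemma definable_tame n : tame n.
Proof.
elim: n => [|n IH].
  move=> A dA U oU [x Ux]; exists U; split=> //; first by exists x.
  have E y : y = x by rewrite [y]thinmx0 [x]thinmx0.
  by have [Ax|Ax] := pselect (A x); [left|right] => y _; rewrite (E y).
rewrite -addn1 => A dA U oU [z Uz].
have /nbhs_ballP[e /= e0 eU] : nbhs z U by apply: open_nbhs_nbhs.
pose x0 := lsubmx z; pose t0 := rsubmx z 0 0.
pose B (b : bool) t x := if b then A (row_mx x (\row__ t)) else ~ A (row_mx x (\row__ t)).
pose E b k x := forall t, t0 < t -> t < t0 + k.+1%:R^-1 -> B b t x.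
have dE b k : dset S (E b k) by case: b; rewrite /E /B; definability.
pose V : set 'rV[R]_n := ball x0 e.
have oV : open V by apply: ball_open.
have V0 : V !=set0 by exists x0; apply: ballxx.
have VE : V `<=` \bigcup_k (E true k `|` E false k).
  move=> x _.
  have [|d d0 H] := @definable_right_decided (fun t => A (row_mx x (\row__ t))) t0.
    by definability.
  have [k /(_ k (leqnn k)) kd] := inv_succ_lt d0.
  exists k => //; case: H => H; [left|right] => t t0t td; apply: H; rewrite t0t.
    by rewrite (lt_trans td)// ltrD2l.
  by rewrite (lt_trans td)// ltrD2l.
have [k [V1 [oV1 V10 V1V V1E]]] : exists k V1, [/\ open V1, V1 !=set0, V1 `<=` V &
   V1 `<=` E true k `|` E false k].
  by apply: (definable_Baire IH) VE => // k; apply: dset_or.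
have [V2 [oV2 V20 V21 V2E]] := IH _ (dE true k) _ oV1 V10.
have [b bE] : exists b, V2 `<=` E b k.
  case: V2E => V2E; [by exists true|exists false => y V2y].
  by case: (V1E y (V21 _ V2y)) => // /(V2E _ V2y).
pose d := Num.min k.+1%:R^-1 e.
have d0 : 0 < d by rewrite lt_min e0 invr_gt0 ltr0Sn.
pose W := [set w : 'rV[R]_(n + 1) | V2 (lsubmx w)] `&`
          [set w | w 0 (rshift n ord0) \in `]t0, (t0 + d)[].
exists W; split.
- apply: openI.
    apply: open_comp oV2 => w _; apply: differentiable_continuous.
    exact: differentiable_lsubmx.
  apply: (@open_comp _ _ (fun w : 'rV[R]_(n + 1) => w 0 (rshift n ord0))
            [set` `]t0, (t0 + d)[]); last exact: interval_open.
  by move=> w _; apply: coord_continuous.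
- case: V20 => x V2x; exists (row_mx x (\row__ (t0 + d / 2))); split => /=.
    by rewrite row_mxKl.
  rewrite mxE (unsplitK (inr _)) mxE in_itv /=; lra.
- move=> w [/= V2w]; rewrite in_itv /= => /andP[w1 w2]; apply: eU; split=> // i j.
  have [_ bw] := V1V _ (V21 _ V2w); rewrite (ord1 i).
  case: (split_ordP j) => j' ->; first by have := bw 0 j'; rewrite !mxE.
  rewrite (ord1 j') /ball /= ltr_norml.
  move: w1 w2; rewrite /t0 /d !mxE => w1 w2.
  have : w 0 (rshift n ord0) - z 0 (rshift n 0) < e.
    by rewrite ltrBlDl; apply: lt_le_trans w2 _; rewrite lerD2l ge_min lexx orbT.
  lra.
- have {bE} WB w : W w -> B b (w 0 (rshift n ord0)) (lsubmx w).
    move=> [/= /bE Ew]; rewrite in_itv /= => /andP[w1 w2]; apply: Ew => //.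
    by apply: lt_le_trans w2 _; rewrite lerD2l ge_min lexx.
  have wE (w : 'rV[R]_(n + 1)) : row_mx (lsubmx w) (\row__ w 0 (rshift n ord0)) = w.
    by rewrite -[RHS]hsubmxK; congr row_mx; apply/rowP => i; rewrite !mxE (ord1 i).
  by case: b WB; [left|right] => w /WB; rewrite /B wE.
Qed.

(** Density excludes the second alternative of tameness. *)
Lemma definable_dense n (A : set 'rV[R]_n) (U : set 'rV[R]_n) :
  dset S A -> open U -> U !=set0 -> U `<=` closure A ->
  exists V, [/\ open V, V !=set0, V `<=` U & V `<=` A].
Proof.
move=> dA oU U0 UA; have [V [oV [v Vv] VU [VA|VA]]] := definable_tame dA oU U0.
  by exists V; split=> //; exists v.
have [w [Aw Vw]] := UA _ (VU _ Vv) V (open_nbhs_nbhs (conj oV Vv)).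
by have := VA _ Vw Aw.
Qed.

End Tameness.

(** * Definable functions of one variable *)

Section OneVariable.
Variables (R : realType) (S : omin_structure R).

Definition dset1 (P : R -> Prop) := dset S (fun z : 'rV[R]_1 => P (z 0 0)).
Definition dfun1 (f : R -> R) := dfun S (fun z : 'rV[R]_1 => f (z 0 0)).

Definition continuous_eps (f : R -> R) (x : R) : Prop :=
  forall e, 0 < e -> exists d, 0 < d /\ forall y, `|y - x| < d -> `|f y - f x| < e.

Lemma continuous_epsP f x : continuous_eps f x <-> {for x, continuous f}.
Proof.
split=> [H|H e e0].
  apply/cvgrPdist_lt => e /H[d [d0 hd]]; apply/nbhs_ballP; exists d => //= y.
  by rewrite /ball/= distrC => /hd; rewrite distrC.
have /cvgrPdist_lt/(_ e e0)/nbhs_ballP[d /= d0 hd] := H.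
exists d; split=> // y yx; rewrite distrC; apply: hd.
by rewrite /ball/= distrC.
Qed.

Lemma definable_Baire1 (A : nat -> R -> Prop) a b :
  (forall k, dset1 (A k)) -> a < b ->
  (forall t, a < t < b -> exists k, A k t) ->
  exists k c d, [/\ a <= c, c < d, d <= b & forall t, c < t < d -> A k t].
Proof.
move=> dA ab abA; pose U := [set z : 'rV[R]_1 | z 0 0 \in `]a, b[].
have oU : open U.
  apply: (@open_comp _ _ (fun w : 'rV[R]_1 => w 0 0) [set` `]a, b[]).
    by move=> w _; apply: coord_continuous.
  exact: interval_open.
have U0 : U !=set0.
  by exists (\row__ ((a + b) / 2)); rewrite /U /= mxE in_itv /=; lra.
have [|k [V [oV [z Vz] VU VA]]] :=
    @definable_Baire R S 1 (@definable_tame _ _ _) U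
      (fun k z => A k (z 0 0)) dA oU U0.
  by move=> z; rewrite /U /= in_itv /= => /abA[k Ak]; exists k.
have /nbhs_ballP[e /= e0 eV] : nbhs z V by apply: open_nbhs_nbhs.
have H t : z 0 0 - e < t < z 0 0 + e -> V (\row__ t).
  move=> ht; apply: eV; split=> // i j; rewrite (ord1 i) (ord1 j) mxE /ball /=.
  rewrite ltr_norml; lra.
have : U z by apply: VU.
rewrite /U /= in_itv /= => /andP[az zb].
exists k, (z 0 0), (Num.min (z 0 0 + e) b); split.
- exact: ltW.
- by rewrite lt_min zb ltrDl e0.
- by rewrite ge_min lexx orbT.
- move=> t; rewrite lt_min => /and3P[zt te tb].
  by have := VA _ (H t _); rewrite /= mxE; apply; lra.
Qed.

(** The discontinuities of [f] are covered by the countably many sets of points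
    of [f @^-1` ]p, q[] that are not interior to it, for rational p and q; none
    of these contains an interval. *)
Lemma definable_continuous f a b : dfun1 f -> a < b ->
  exists c d, [/\ a <= c, c < d, d <= b & forall t, c < t < d -> continuous_eps f t].
Proof.
move=> df ab; have dC : dset1 (continuous_eps f).
  by rewrite /dset1 /continuous_eps; definability.
have [d d0 [H|H]] := definable_right_decided a dC.
  exists a, (Num.min (a + d) b); split; rewrite ?lexx ?lt_min ?ltrDl ?d0 ?ge_min ?lexx ?orbT//.
  by move=> t; rewrite lt_min => /and3P[? ? ?]; apply: H; lra.
pose A k t := match unpickle k : option (rat * rat) with
  | Some (p, q) => (ratr p < f t /\ f t < ratr q) /\
      forall e, 0 < e -> exists y, `|y - t| < e /\ ~ (ratr p < f y /\ f y < ratr q)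
  | None => False end.
have dA k : dset1 (A k).
  by rewrite /dset1 /A; case: unpickle => [[p q]|]; definability.
have [||k [c [d' [_ cd _ cdA]]]] := definable_Baire1 (a := a) (b := Num.min (a + d) b) dA.
- by rewrite lt_min ab ltrDl d0.
- move=> t; rewrite lt_min => /and3P[at1 td tb].
  have : ~ continuous_eps f t by apply: H; lra.
  rewrite /continuous_eps => /existsNP[e] /not_implyP[e0] /forallNP He.
  have [p /andP[p1 p2]] : exists p : rat, f t - e < ratr p < f t.
    by have [|p] := @rat_in_itvoo R (f t - e) (f t); [lra|rewrite in_itv; exists p].
  have [q /andP[q1 q2]] : exists q : rat, f t < ratr q < f t + e.
    by have [|q] := @rat_in_itvoo R (f t) (f t + e); [lra|rewrite in_itv; exists q].
  exists (pickle (p, q)); rewrite /A pickleK; split=> // d' d'0.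
  have /not_andP[//|/existsNP[y /not_implyP[yt yf]]] := He d'.
  exists y; split=> // -[y1 y2]; apply: yf; rewrite ltr_norml; lra.
- pose t := (c + d') / 2.
  have ctd : c < t < d' by rewrite /t; lra.
  move: (cdA) (cdA _ ctd); rewrite /A; case: unpickle => [[p q]|//] H1 [_ H2].
  have [|y [yt]] := H2 (d' - t); first by lra.
  have [|[? ?] _ []//] := H1 y.
  by move: yt; rewrite ltr_norml /t; lra.
Qed.

Definition right_deriv (f : R -> R) x r := forall e, 0 < e -> exists d, 0 < d /\
  forall h, 0 < h -> h < d -> (r - e) * h <= f (x + h) - f x /\
                              f (x + h) - f x <= (r + e) * h.

Definition right_slope_ge (f : R -> R) x c := exists d, 0 < d /\
  forall h, 0 < h -> h < d -> c * h <= f (x + h) - f x.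

Definition right_slope_le (f : R -> R) x c := exists d, 0 < d /\
  forall h, 0 < h -> h < d -> f (x + h) - f x <= c * h.

Lemma right_slope_dich f x c : dfun1 f ->
  right_slope_ge f x c \/ right_slope_le f x c.
Proof.
move=> df.
have [|d d0 [H|H]] := @definable_right_decided _ S (fun h => c * h <= f (x + h) - f x) 0.
- by definability.
- by left; exists d; split=> // h h0 hd; apply: H; lra.
- right; exists d; split=> // h h0 hd; have hh : 0 < h < 0 + d by lra.
  by have /negP := H h hh; rewrite -ltNge => /ltW.
Qed.

(** Right difference quotients are eventually on one side of each constant, so
    they converge in the extended reals. *)
Lemma right_deriv_trichotomy f x : dfun1 f ->
  [\/ forall c, right_slope_ge f x c, forall c, right_slope_le f x c |
      exists r, right_deriv f x r].
Proof.
move=> df.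
have [allge|/existsNP[c1 nge1]] := pselect (forall c, right_slope_ge f x c); first by constructor 1.
have [allle|/existsNP[c0 nle0]] := pselect (forall c, right_slope_le f x c); first by constructor 2.
constructor 3.
pose E := [set c | right_slope_ge f x c].
have E0 : E c0 by case: (right_slope_dich x c0 df).
have ubE : has_sup E.
  split; first by exists c0.
  exists c1 => c [d [d0 H]]; rewrite leNgt; apply/negP => c1c; apply: nge1.
  by exists d; split=> // h h0 hd; apply: le_trans (H h h0 hd); rewrite ler_pM2r// ltW.
exists (sup E) => e e0.
have [c [d1 [d10 H1]] ce] := sup_adherent e0 ubE.
have [d2 [d20 H2]] : right_slope_le f x (sup E + e).
  case: (right_slope_dich x (sup E + e) df) => // /(ub_le_sup ubE.2).
  by rewrite gerDl leNgt e0.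
exists (Num.min d1 d2); split; first by rewrite lt_min d10.
move=> h h0; rewrite lt_min => /andP[h1 h2]; split; last exact: H2.
by apply: le_trans (H1 h h0 h1); rewrite ler_pM2r// ltW.
Qed.

(** The supremum of the points up to which the slope from [x] is at least [c]
    cannot stop short of [y]. *)
Lemma slope_ge f x y c : x <= y ->
  (forall z, x <= z <= y -> continuous_eps f z) ->
  (forall z, x <= z < y -> right_slope_ge f z c) ->
  c * (y - x) <= f y - f x.
Proof.
move=> xy cf rf; pose E := [set z | (x <= z <= y) /\ c * (z - x) <= f z - f x].
have Ex : E x by split; [rewrite lexx|rewrite !subrr mulr0].
have ubE : has_sup E.
  by split; [exists x|exists y => z [/andP[]]].
set s := sup E.
have xs : x <= s by apply: (ub_le_sup ubE.2).
have sy : s <= y by apply: ge_sup; [exists x|move=> z [/andP[]]].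
have Es : c * (s - x) <= f s - f x.
  apply/ler_addgt0Pr => e e0.
  have e2 : 0 < e / 2 by lra.
  have xsy : x <= s <= y by rewrite xs.
  have [d [d0 H]] := cf s xsy _ e2.
  pose d' := Num.min d (e / 2 / (`|c| + 1)).
  have c1 : 0 < `|c| + 1 by rewrite ltr_wpDl.
  have d'0 : 0 < d' by rewrite lt_min d0 divr_gt0//; lra.
  have [z [/andP[xz zy] Ez] zs] := sup_adherent d'0 ubE.
  have zs' : z <= s by apply: (ub_le_sup ubE.2); split=> //; rewrite xz.
  have szd : s - z < d' by rewrite -/s in zs; lra.
  have szd1 : s - z < d by apply: lt_le_trans szd _; rewrite ge_min lexx.
  have : `|f z - f s| < e / 2 by apply: H; rewrite ltr_norml; lra.
  rewrite ltr_norml => /andP[fz1 fz2].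
  have : c * (s - z) <= e / 2.
    apply: le_trans (_ : (`|c| + 1) * (s - z) <= _).
      rewrite ler_wpM2r ?subr_ge0//; have := ler_norm c; lra.
    rewrite mulrC -ler_pdivlMr//; apply: ltW; apply: lt_le_trans szd _.
    by rewrite ge_min lexx orbT.
  have -> : c * (s - x) = c * (s - z) + c * (z - x) by ring.
  lra.
have [s_lt_y|ys] := ltP s y; last by have -> : y = s by apply/eqP; rewrite eq_le sy ys.
have [|d [d0 H]] := rf s; first by rewrite xs.
pose h := Num.min (d / 2) (y - s).
have h0 : 0 < h by rewrite lt_min subr_gt0 s_lt_y andbT; lra.
have hd : h < d by rewrite gt_min; apply/orP; left; lra.
have hy : h <= y - s by rewrite ge_min lexx orbT.
have : s + h <= s.
  apply: (ub_le_sup ubE.2); split; first by lra.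
  have := H h h0 hd; have -> : c * (s + h - x) = c * (s - x) + c * h by ring.
  lra.
lra.
Qed.

Lemma slope_le f x y c : x <= y ->
  (forall z, x <= z <= y -> continuous_eps f z) ->
  (forall z, x <= z < y -> right_slope_le f z c) ->
  f y - f x <= c * (y - x).
Proof.
move=> xy cf rf.
suff : (- c) * (y - x) <= (- f y) - (- f x) by lra.
apply: (@slope_ge (fun z => - f z)) => // z hz.
  move=> e e0; have [d [d0 H]] := cf z hz e e0; exists d; split=> // t /H.
  by rewrite -opprD normrN.
have [d [d0 H]] := rf z hz; exists d; split=> // h h0 hd.
have := H h h0 hd; lra.
Qed.

Lemma right_deriv_unique f x r r' : right_deriv f x r -> right_deriv f x r' -> r = r'.
Proof.
suff le r1 r2 : right_deriv f x r1 -> right_deriv f x r2 -> r1 <= r2.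
  by move=> h h'; apply/eqP; rewrite eq_le !le.
move=> h1 h2; apply/ler_addgt0Pr => e e0.
have e2 : 0 < e / 2 by lra.
have [d1 [d10 H1]] := h1 _ e2.
have [d2 [d20 H2]] := h2 _ e2.
pose h := Num.min d1 d2 / 2.
have m0 : 0 < Num.min d1 d2 by rewrite lt_min d10.
have h0 : 0 < h by rewrite divr_gt0.
have hm : h < Num.min d1 d2 by rewrite /h; lra.
move: (hm); rewrite lt_min => /andP[hd1 hd2].
have [L _] := H1 h h0 hd1; have [_ U] := H2 h h0 hd2.
have := le_trans L U; rewrite ler_pM2r//; lra.
Qed.

Definition C1_between (f : R -> R) (c d : R) : Prop :=
  forall t, c < t < d -> derivable f t 1 /\ {for t, continuous (derive1 f)}.

(** On a subinterval the right derivative is finite, since an infinite one would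
    force infinite slopes, and continuous; difference quotients on both sides are
    then squeezed between nearby values of the right derivative. *)
Lemma definable_C1 f a b : dfun1 f -> a < b ->
  exists c d, [/\ a <= c, c < d, d <= b & C1_between f c d].
Proof.
move=> df ab; have [a1 [b1 [aa1 ab1 bb1 cf]]] := definable_continuous df ab.
(* A definable property failing somewhere in each subinterval fails throughout
   some subinterval with the same left endpoint. *)
have shrink P (dP : dset1 P) c d : c < d ->
    (forall c' d', c <= c' -> d' <= d -> c' < d' -> ~ (forall t, c' < t < d' -> P t)) ->
    exists2 d', c < d' <= d & forall t, c < t < d' -> ~ P t.
  move=> cd nP'; have [e e0 He] := definable_right_decided c dP.
  have cm : c < Num.min (c + e) d by rewrite lt_min cd ltrDl e0.
  have md : Num.min (c + e) d <= d by rewrite ge_min lexx orbT.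
  exists (Num.min (c + e) d); first by rewrite cm.
  case: He => He.
    case: (nP' c (Num.min (c + e) d)) => // t.
    by rewrite lt_min => /and3P[? ? ?]; apply: He; lra.
  by move=> t; rewrite lt_min => /and3P[? ? ?]; apply: He; lra.
have mid (c d : R) : c < d -> exists x y, [/\ c < x, x < y & y < d].
  by move=> cd; exists (c + (d - c) / 3), (c + 2 * (d - c) / 3); split; lra.
have nge (c d : R) : a1 <= c -> d <= b1 -> c < d ->
    ~ (forall t, c < t < d -> forall k, right_slope_ge f t k).
  move=> ac db cd H; have [x [y [cx xy yd]]] := mid _ _ cd.
  pose k := (f y - f x) / (y - x) + 1.
  have Ek : k * (y - x) = f y - f x + (y - x) by rewrite /k; field; lra.
  suff : k * (y - x) <= f y - f x by rewrite Ek; lra.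
  by apply: slope_ge => [|z hz|z hz]; [exact: ltW|apply: cf|apply: H]; lra.
have nle (c d : R) : a1 <= c -> d <= b1 -> c < d ->
    ~ (forall t, c < t < d -> forall k, right_slope_le f t k).
  move=> ac db cd H; have [x [y [cx xy yd]]] := mid _ _ cd.
  pose k := (f y - f x) / (y - x) - 1.
  have Ek : k * (y - x) = f y - f x - (y - x) by rewrite /k; field; lra.
  suff : f y - f x <= k * (y - x) by rewrite Ek; lra.
  by apply: slope_le => [|z hz|z hz]; [exact: ltW|apply: cf|apply: H]; lra.
have dge : dset1 (fun t => forall k, right_slope_ge f t k).
  by rewrite /dset1 /right_slope_ge; definability.
have dle : dset1 (fun t => forall k, right_slope_le f t k).
  by rewrite /dset1 /right_slope_le; definability.
have [b2 /andP[ab2 bb2] H2] : exists2 b2, a1 < b2 <= b1 &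
    forall t, a1 < t < b2 -> ~ forall k, right_slope_ge f t k.
  by apply: shrink => // c' d' ? ?; apply: nge.
have [b3 /andP[ab3 bb3] H3] : exists2 b3, a1 < b3 <= b2 &
    forall t, a1 < t < b3 -> ~ forall k, right_slope_le f t k.
  by apply: shrink => // c' d' ? ?; apply: nle => //; lra.
have exD t : a1 < t < b3 -> exists r, right_deriv f t r.
  move=> ht; case: (right_deriv_trichotomy t df) => // H.
    by case: (H2 t) => //; lra.
  by case: (H3 t).
pose g t := if pselect (a1 < t < b3) then xget 0 (right_deriv f t) else 0.
have gD t : a1 < t < b3 -> right_deriv f t (g t).
  move=> ht; rewrite /g; case: pselect => [a1t|/(_ ht)//].
  by have [r Hr] := exD t ht; apply: (xgetPex 0 (ex_intro _ r Hr)).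
have dg : dfun1 g.
  have d' : dset S (fun z : 'rV[R]_(1 + 1) =>
      (((a1 < lsubmx z 0 0 /\ lsubmx z 0 0 < b3) /\
           right_deriv f (lsubmx z 0 0) (rsubmx z 0 0)) \/
      (~ (a1 < lsubmx z 0 0 /\ lsubmx z 0 0 < b3) /\ rsubmx z 0 0 = 0))).
    by rewrite /right_deriv; definability.
  apply: (dset_ext _ d') => z; move: (lsubmx z 0 0) (rsubmx z 0 0) => t r'.
  have [ht|ht] := pselect (a1 < t < b3); split.
  - case=> [[_ Hr]|[nt]]; last by case: nt; move/andP: ht.
    by apply: right_deriv_unique Hr; apply: gD.
  - by move=> E; left; split; [move/andP: ht|rewrite -E; apply: gD].
  - case=> [[[? ?] _]|[_ ->]]; first by case: ht; apply/andP.
    by rewrite /g; case: pselect.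
  - move=> E; right; split; last by rewrite -E /g; case: pselect.
    by case=> ? ?; apply: ht; apply/andP.
have [c [d [ac cd db cg]]] := definable_continuous dg ab3.
exists c, d; split=> //; [exact: le_trans ac|exact: le_trans (le_trans bb3 (le_trans bb2 bb1))|].
have der t : c < t < d -> is_derive t 1 f (g t).
  move=> ht.
  suff : (fun h => h^-1 *: (f (h *: 1 + t) - f t)) @ 0^' --> g t.
    by move=> H; split; [apply/cvg_ex; exists (g t)|apply/cvg_lim].
  apply/cvgrPdist_le => e e0.
  have e2 : 0 < e / 2 by lra.
  have [r [r0 Hr]] := cg t ht _ e2.
  pose m := Num.min r (Num.min (t - c) (d - t)).
  have m0 : 0 < m by rewrite !lt_min r0 !subr_gt0.
  (* Near [t], all slopes differ from [g t] by at most [e]. *)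
  have sl x y : t - m < x -> x < y -> y < t + m ->
      (g t - e) * (y - x) <= f y - f x /\ f y - f x <= (g t + e) * (y - x).
    have mr : m <= r by rewrite ge_min lexx.
    have mc : m <= t - c by rewrite !ge_min lexx !orbT.
    have md : m <= d - t by rewrite !ge_min lexx !orbT.
    move=> x1 xy y1; have gz z : x <= z < y ->
        exists dl, 0 < dl /\ forall h, 0 < h -> h < dl ->
         (g t - e) * h <= f (z + h) - f z /\ f (z + h) - f z <= (g t + e) * h.
      move=> hz; have zin : a1 < z < b3 by lra.
      have [dl [dl0 Hdl]] := gD z zin _ e2.
      exists dl; split=> // h h0 hdl; have [A B] := Hdl h h0 hdl.
      have : `|g z - g t| < e / 2 by apply: Hr; rewrite ltr_norml; lra.
      rewrite ltr_norml => /andP[g1 g2].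
      split; [apply: le_trans A|apply: le_trans B _]; rewrite ler_pM2r//; lra.
    split.
      apply: slope_ge; [exact: ltW|by move=> z hz; apply: cf; lra|].
      move=> z /gz[dl [dl0 Hdl]]; exists dl; split=> // h h0 hd.
      by case: (Hdl h h0 hd).
    apply: slope_le; [exact: ltW|by move=> z hz; apply: cf; lra|].
    move=> z /gz[dl [dl0 Hdl]]; exists dl; split=> // h h0 hd.
    by case: (Hdl h h0 hd).
  apply/nbhs_ballP; exists m => //= h; rewrite /ball /= sub0r normrN => hm hn0.
  have -> : h *: 1 = h :> R by rewrite /GRing.scale /= mulr1.
  have -> : h^-1 *: (f (h + t) - f t) = (f (h + t) - f t) / h by rewrite mulrC.
  move: hm; rewrite ltr_norml => /andP[hm1 hm2].
  case: (ltgtP h 0) hn0 => // h0 _.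
    have [|||A B] := sl (h + t) t; [lra..|].
    have -> : (f (h + t) - f t) / h = (f t - f (h + t)) / (- h).
      by rewrite invrN mulrN -mulNr opprB.
    have nh0 : 0 < - h by lra.
    rewrite ler_norml; apply/andP; split.
      have : (f t - f (h + t)) / (- h) <= g t + e.
        by rewrite ler_pdivrMr//; move: B; have -> : t - (h + t) = - h by ring.
      lra.
    have : g t - e <= (f t - f (h + t)) / (- h).
      by rewrite ler_pdivlMr//; move: A; have -> : t - (h + t) = - h by ring.
    lra.
  have [|||A B] := sl t (h + t); [lra..|].
  rewrite ler_norml; apply/andP; split.
    have : (f (h + t) - f t) / h <= g t + e.
      by rewrite ler_pdivrMr//; move: B; have -> : (h + t) - t = h by ring.
    lra.
  have : g t - e <= (f (h + t) - f t) / h.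
    by rewrite ler_pdivlMr//; move: A; have -> : (h + t) - t = h by ring.
  lra.
have dv (t : R) : c < t < d -> derive1 f t = g t by move=> /der[_]; rewrite derive1E.
move=> t ht; split; first by case: (der t ht).
have /continuous_epsP ct := cg t ht.
rewrite /prop_for /continuous_at dv//.
apply: cvg_trans ct; apply: near_eq_cvg.
have : t \in `]c, d[ by rewrite in_itv.
by move=> /near_in_itvoo; apply: filterS => s; rewrite in_itv /= => /dv.
Qed.

End OneVariable.

(** * Coordinatewise calculus and definable curves *)

Section CoordinateCalculus.
Variable R : realType.

Lemma mx_coord_cvg (T : Type) (F : set_system T) {FF : Filter F} m n
    (f : T -> 'M[R]_(m, n)) (a : 'M[R]_(m, n)) :
  (forall i j, (fun t => f t i j) @ F --> a i j) -> f @ F --> a.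
Proof.
move=> H; apply/cvg_ballP => e e0.
have H' (ij : 'I_m * 'I_n) : \forall t \near F, ball (a ij.1 ij.2) e (f t ij.1 ij.2).
  by move/cvg_ballP : (H ij.1 ij.2); apply.
have := filter_forall FF H'.
by apply: filterS => t Ht; split=> // i j; apply: (Ht (i, j)).
Qed.

Lemma near_eq_continuous (T U : topologicalType) (f g : T -> U) (x : T)
    (A : set T) :
  open A -> A x -> (forall y, A y -> f y = g y) ->
  {for x, continuous f} -> {for x, continuous g}.
Proof.
move=> oA Ax fg cf; have E := fg x Ax.
rewrite /prop_for /continuous_at -E; apply: cvg_trans cf; apply: near_eq_cvg.
have : nbhs x A by apply: open_nbhs_nbhs.
by apply: filterS => y Ay; rewrite fg.
Qed.

Lemma coord_differentiable m n (f : 'rV[R]_m -> 'rV[R]_n) x j :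
  differentiable f x -> differentiable (fun y => f y 0 j : R) x.
Proof.
move=> df; apply: (differentiable_comp df (g := fun y : 'rV[R]_n => y 0 j : R)).
exact: differentiable_coord.
Qed.

Lemma diff_coordE m n (i : 'I_m) (j : 'I_n) (x v : 'M[R]_(m, n)) :
  'd (fun y : 'M[R]_(m, n) => y i j : R) x v = v i j.
Proof.
have @f : {linear 'M[R]_(m, n) -> R}.
  by exists (fun N : 'M[R]_(_, _) => N i j); do 2![eexists]; do ?[constructor];
     rewrite ?mxE// => ? *; rewrite ?mxE//; move=> ?; rewrite !mxE.
by rewrite (_ : (fun _ => _) = f) // diff_lin//; apply: coord_continuous.
Qed.

Lemma coord_diff m n (f : 'rV[R]_m -> 'rV[R]_n) x v j :
  differentiable f x -> 'd (fun y => f y 0 j : R) x v = 'd f x v 0 j.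
Proof.
move=> df; rewrite (@diff_comp _ _ _ _ f (fun y : 'rV[R]_n => y 0 j : R))//.
  by rewrite /= diff_coordE.
exact: differentiable_coord.
Qed.

Lemma differentiable_coords m n (f : 'rV[R]_m -> 'rV[R]_n) x :
  (forall j, differentiable (fun y => f y 0 j : R) x) -> differentiable f x.
Proof.
move=> df; rewrite (_ : f = \sum_j (fun y => f y 0 j *: delta_mx 0 j)).
  by apply: differentiable_sum => j; apply: differentiableZl.
by apply/funext => y; rewrite fct_sumE [LHS]row_sum_delta.
Qed.

Lemma jacobian_coordE m n (f : 'rV[R]_m -> 'rV[R]_n) x i j :
  differentiable f x ->
  jacobian f x i j = 'd (fun y => f y 0 j : R) x (delta_mx 0 i).
Proof. by move=> df; rewrite coord_diff// mxE. Qed.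

Lemma mul_jacobian m n (f : 'rV[R]_m -> 'rV[R]_n) x v :
  differentiable f x -> v *m jacobian f x = 'd f x v.
Proof. by move=> df; rewrite /jacobian mul_rV_lin1. Qed.

Lemma C1_on_coords m n (U : set 'rV[R]_m) (f : 'rV[R]_m -> 'rV[R]_n) :
  open U ->
  (forall j x, U x -> differentiable (fun y => f y 0 j : R) x) ->
  (forall j i x, U x ->
     {for x, continuous (fun y => 'd (fun z => f z 0 j : R) y (delta_mx 0 i) : R)}) ->
  C1_on U f.
Proof.
move=> oU df cf x Ux.
have dU y : U y -> differentiable f y.
  by move=> Uy; apply: differentiable_coords => j; apply: df.
split; first exact: dU.
have E i j y : U y ->
    'd (fun z => f z 0 j : R) y (delta_mx 0 i) = jacobian f y i j.
  by move=> Uy; exact/esym/(jacobian_coordE i j (dU y Uy)).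
have H i j : {for x, continuous (fun y => jacobian f y i j : R)}.
  exact: (near_eq_continuous oU Ux (E i j) (cf j i x Ux)).
exact: (mx_coord_cvg H).
Qed.

End CoordinateCalculus.

Section Curves.
Variable R : realType.

Lemma open_slab n (b : 'I_n) (c d : R) : open [set x : 'rV[R]_n | c < x 0 b < d].
Proof.
rewrite (_ : mkset _ = (fun x : 'rV[R]_n => x 0 b) @^-1` [set` `]c, d[]).
  by apply: open_comp; [move=> w _; apply: coord_continuous|apply: interval_open].
by apply/seteqP; split=> x /=; rewrite in_itv.
Qed.

Lemma closed_coord_le n (j : 'I_n) (r : R) : closed [set x : 'rV[R]_n | x 0 j <= r].
Proof.
apply: (@closed_comp _ _ (fun x : 'rV[R]_n => x 0 j) [set t | t <= r]).
  by move=> w _; apply: coord_continuous.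
exact: closed_le.
Qed.

Lemma closed_coord_eq n (j : 'I_n) (r : R) : closed [set x : 'rV[R]_n | x 0 j = r].
Proof.
apply: (@closed_comp _ _ (fun x : 'rV[R]_n => x 0 j) [set t | t = r]).
  by move=> w _; apply: coord_continuous.
exact: closed_eq.
Qed.

(** Both directions of a chart that straightens a curve have this form. *)
Lemma C1_on_shear m n (a : 'I_n -> 'I_m) (b : 'I_m) (g : 'I_n -> R -> R) c d :
  (forall j, C1_between (g j) c d) ->
  C1_on [set x : 'rV[R]_m | c < x 0 b < d]
        (fun x => \row_j (x 0 (a j) + g j (x 0 b))).
Proof.
move=> Cg.
have E j : (fun y : 'rV[R]_m => (\row_j (y 0 (a j) + g j (y 0 b))) 0 j) =
    (fun y : 'rV[R]_m => y 0 (a j)) + (g j \o (fun y : 'rV[R]_m => y 0 b)).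
  by apply/funext => y; rewrite mxE.
have db (x : 'rV[R]_m) k : differentiable (fun y : 'rV[R]_m => y 0 k : R) x.
  exact: differentiable_coord.
have dgb j (x : 'rV[R]_m) : c < x 0 b < d ->
    differentiable (g j \o (fun y : 'rV[R]_m => y 0 b : R)) x.
  move=> hx; apply: differentiable_comp => //.
  exact: (derivable1_diffP _ _).1 (Cg j _ hx).1.
apply: C1_on_coords => [|j x hx|j i x hx]; first exact: open_slab.
  by rewrite E; apply: differentiableD => //; apply: dgb.
have dE (y : 'rV[R]_m) v : c < y 0 b < d ->
    'd (fun z : 'rV[R]_m => (\row_j (z 0 (a j) + g j (z 0 b))) 0 j) y v =
    v 0 (a j) + v 0 b * derive1 (g j) (y 0 b).
  move=> hy; rewrite E diffD//=; last exact: dgb.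
  rewrite diff_coordE; congr (_ + _); rewrite diff_comp//=; last first.
    exact: (derivable1_diffP _ _).1 (Cg j _ hy).1.
  rewrite diff_coordE deriv1E//.
  exact: (Cg j _ hy).1.
pose G (y : 'rV[R]_m) : R := (delta_mx 0 i : 'rV[R]_m) 0 (a j) +
    (delta_mx 0 i : 'rV[R]_m) 0 b * derive1 (g j) (y 0 b).
have cG : {for x, continuous G}.
  have cb : {for x, continuous (derive1 (g j) \o (fun y : 'rV[R]_m => y 0 b))}.
    apply: continuous_comp; first exact: coord_continuous.
    exact: (Cg j _ hx).2.
  exact: (cvgD (cvg_cst _) (cvgMr cb)).
exact: (near_eq_continuous (@open_slab _ b c d) hx (fun y hy => esym (dE y _ hy)) cG).
Qed.

Lemma open_between (c d : R) : open [set t | c < t < d].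
Proof.
rewrite (_ : mkset _ = [set` `]c, d[]); first exact: interval_open.
by apply/seteqP; split=> x /=; rewrite in_itv.
Qed.

Lemma C1_between_opp (f : R -> R) c d :
  C1_between f c d -> C1_between (fun t => - f t) c d.
Proof.
move=> Cf t ht; have [dft cft] := Cf t ht; split; first exact: derivableN.
have dN s : c < s < d -> derive1 (fun t => - f t) s = - derive1 f s.
  by move=> /Cf[dfs _]; rewrite !derive1E deriveN.
apply: (near_eq_continuous (@open_between c d) ht (fun s hs => esym (dN s hs))).
exact: (continuousN cft).
Qed.

(** Subtracting the curve, as a function of its [i]-th coordinate, straightens
    it; the transposition puts that coordinate first, where the model
    [R x {0}] has its free coordinate. *)
Lemma dim_gt0_curve n (K : set 'rV[R]_n) (i : 'I_n) (g : 'I_n -> R -> R) c d :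
  c < d -> (forall j, C1_between (g j) c d) ->
  (forall t, c < t < d -> g i t = t) ->
  (forall t, c < t < d -> K (\row_j g j t)) -> (0 < Defs.dim K)%N.
Proof.
move=> cd Cg git gK.
have n0 : (0 < n)%N by apply: leq_ltn_trans (leq0n _) (ltn_ord i).
pose i0 : 'I_n := Ordinal n0.
pose s := tperm i i0.
pose M := [set \row_j g j t | t in [set t | c < t < d]].
suff CM : C1_submanifold 1 M.
  apply: (@leq_trans (nat_of_ord (Ordinal (n0 : (1 < n.+1)%N)))) => //.
  apply: (@leq_bigmax_cond _ _ (fun d => nat_of_ord d)); apply/asboolP; exists M; split=> //.
    by exists (\row_j g j ((c + d) / 2)), ((c + d) / 2) => //=; lra.
  by move=> _ [t ht <-]; apply: gK.
move=> _ [t0 ht0 <-]; split=> //; first by exists t0.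
pose b j t := g j t - (if j == i then t else 0).
have Cb j : C1_between (b j) c d.
  rewrite /b; case: eqP => [->|_]; last first.
    by rewrite (_ : (fun t => _) = g j)//; apply/funext => t; rewrite subr0.
  have G0 t : c < t < d -> g i t - t = 0 by move=> /git ->; rewrite subrr.
  have nG0 t : c < t < d -> {near t, cst 0 =1 (fun t => g i t - t)}.
    move=> ht; have : nbhs t [set t | c < t < d].
      by apply: open_nbhs_nbhs; split=> //; apply: open_between.
    by apply: filterS => u /G0.
  have D u : c < u < d -> cst 0 u = derive1 (fun t => g i t - t) u.
    move=> hu; rewrite derive1E -[LHS](@derive_cst _ R R 0 u 1).
    by apply: near_eq_derive => //; apply: nG0.
  move=> t ht; split.
    apply: (near_eq_derivable (f := cst 0)); rewrite ?oner_eq0//; first exact: nG0.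
  apply: (near_eq_continuous (@open_between c d) ht D); exact: cvg_cst.
have bi t : c < t < d -> b i t = 0 by move=> ht; rewrite /b eqxx git// subrr.
pose phi (x : 'rV[R]_n) := \row_j (x 0 (s j) + - b (s j) (x 0 i)).
pose psi (z : 'rV[R]_n) := \row_j (z 0 (s j) + b j (z 0 i0)).
pose U := [set x : 'rV[R]_n | c < x 0 i < d].
pose V := [set x : 'rV[R]_n | c < x 0 i0 < d].
have phi0 x : U x -> phi x 0 i0 = x 0 i.
  by move=> Ux; rewrite mxE tpermR bi// oppr0 addr0.
have psi0 z : V z -> psi z 0 i = z 0 i0.
  by move=> Vz; rewrite mxE tpermL bi// addr0.
exists U, V, phi, psi; split.
- by split; apply: open_slab.
- by rewrite /U /= mxE git.
- split; last exact: (@C1_on_shear n n s i0 b).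
  by apply: (@C1_on_shear n n s i (fun j t => - b (s j) t)) => j; apply: C1_between_opp.
- split.
  + by move=> _ [x Ux <-]; rewrite /V /= phi0.
  + by move=> _ [x Ux <-]; rewrite /U /= psi0.
  + move=> y Uy; apply/rowP => j; rewrite mxE phi0// mxE tpermK; ring.
  + move=> z Vz; apply/rowP => j; rewrite mxE psi0// mxE tpermK; ring.
- apply/seteqP; split=> [_ [_ [[t ht <-] _] <-]|z [Vz z0]].
    have git' : (\row_j g j t) 0 i = t by rewrite mxE git.
    split; first by rewrite /V /= phi0 /U /= git'.
    move=> j j1; rewrite mxE git' mxE /b.
    have -> : (s j == i) = false.
      apply/negP => /eqP E; have : j = i0 by apply: (@perm_inj _ s); rewrite E tpermR.
      by move=> ji; move: j1; rewrite ji.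
    by rewrite subr0 subrr.
  exists (psi z); last first.
    by apply/rowP => j; rewrite mxE psi0// mxE tpermK; ring.
  split; last by rewrite /U /= psi0.
  exists (z 0 i0) => //; apply/rowP => j; rewrite !mxE /b.
  case: eqP => [->|ji]; first by rewrite tpermL; ring.
  suff -> : z 0 (s j) = 0 by rewrite add0r subr0.
  apply: z0; rewrite lt0n; apply/negP => /eqP E; apply: ji.
  have sj : s j = i0 by apply: val_inj.
  by apply: (@perm_inj _ s); rewrite sj tpermL.
Qed.

End Curves.

Section DefinableCurves.
Variables (R : realType) (S : omin_structure R).

Let fiber n (K : set 'rV[R]_n) (i : 'I_n) t := [set x | K x /\ x 0 i = t].

Lemma C1_between_sub (f : R -> R) c d c' d' :
  c <= c' -> d' <= d -> C1_between f c d -> C1_between f c' d'.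
Proof. by move=> cc dd Cf t ht; apply: Cf; lra. Qed.

(** One coordinate at a time, the set is cut down to the points whose coordinate
    is least in its fibre, and the interval to one where that least value is
    continuously differentiable. *)
Lemma definable_curve_seq n (i : 'I_n) (s : seq 'I_n) (K : set 'rV[R]_n) a b :
  dset S K -> a < b ->
  (forall t, a < t < b -> compact (fiber K i t) /\ fiber K i t !=set0) ->
  exists K' c d g, [/\ K' `<=` K, a <= c, c < d, d <= b &
    [/\ dset S K',
      forall t, c < t < d -> compact (fiber K' i t) /\ fiber K' i t !=set0 &
      forall j, j \in s -> C1_between (g j) c d /\
        forall x, K' x -> c < x 0 i < d -> x 0 j = g j (x 0 i)]].
Proof.
move=> dK ab; elim: s => [|j s IH] fK.
  by exists K, a, b, (fun=> id); split.
have [K1 [c [d [g [K1K ac cd db [dK1 fK1 Kg]]]]]] := IH fK.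
pose K2 x := K1 x /\ forall y, K1 y -> y 0 i = x 0 i -> x 0 j <= y 0 j.
have dK2 : dset S K2 by rewrite /K2; definability.
have minK t : c < t < d -> exists x, fiber K1 i t x /\
    forall y, fiber K1 i t y -> x 0 j <= y 0 j.
  move=> /fK1[cK nK].
  have [|x xK xmin] := @EVT_min_rV R n (fun x => x 0 j) _ nK cK.
    by apply: continuous_subspaceT => x; apply: coord_continuous.
  by exists x; split; [rewrite inE in xK|move=> y Ky; apply: xmin; rewrite inE].
pose h t := if pselect (c < t < d) then
   xget 0 [set r | exists x, K2 x /\ (x 0 i = t /\ x 0 j = r)] else 0.
have hE x : K2 x -> c < x 0 i < d -> x 0 j = h (x 0 i).
  move=> K2x hx; rewrite /h; case: pselect => [?|//].
  have [|x' [[K1x' x'min] [x'i <-]]] := @xgetPex _ 0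
      [set r | exists y, K2 y /\ (y 0 i = x 0 i /\ y 0 j = r)].
    by exists (x 0 j), x.
  apply/eqP; rewrite eq_le; case: K2x => K1x xmin.
  by rewrite xmin// x'min.
have K2fib t : c < t < d -> exists x, K2 x /\ x 0 i = t.
  move=> /minK[x [[K1x xt] xmin]]; exists x; split=> //; split=> // y K1y yx.
  by apply: xmin; split=> //; rewrite yx.
have dh : dfun1 S h.
  have d' : dset S (fun z : 'rV[R]_(1 + 1) =>
      (((c < lsubmx z 0 0 /\ lsubmx z 0 0 < d) /\
          exists x, K2 x /\ (x 0 i = lsubmx z 0 0 /\ x 0 j = rsubmx z 0 0)) \/
      (~ (c < lsubmx z 0 0 /\ lsubmx z 0 0 < d) /\ rsubmx z 0 0 = 0))).
    by definability.
  apply: (dset_ext _ d') => z; move: (lsubmx z 0 0) (rsubmx z 0 0) => t r.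
  split.
    case=> [[/andP ht [x [K2x [xt <-]]]]|[nt ->]].
      by rewrite (hE x)// ?xt.
    by rewrite /h; case: pselect => [ht|//]; case: nt; apply/andP.
  have [ht|nt] := pselect (c < t < d).
    move=> <-; left; split; first exact/andP.
    by have [x [K2x xt]] := K2fib t ht; exists x; split=> //; split=> //; rewrite (hE x)// ?xt.
  move=> <-; right; split; first by move/andP.
  by rewrite /h; case: pselect.
have [c' [d' [cc' cd' dd' Ch]]] := definable_C1 dh cd.
exists K2, c', d', (fun k => if k == j then h else g k); split=> //.
- by move=> x [/K1K].
- exact: le_trans ac cc'.
- exact: le_trans dd' db.
split=> //.
  move=> t ht; have ht' : c < t < d by lra.
  have [x [K2x xt]] := K2fib t ht'; split; last by exists x.
  have [cK _] := fK1 t ht'.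
  rewrite (_ : fiber K2 i t = fiber K1 i t `&` [set y | y 0 j <= h t]).
    by apply: compact_closedI => //; apply: closed_coord_le.
  apply/seteqP; split=> y.
    move=> [[K1y ymin] yt]; split; first by split.
    by rewrite /= -xt -(hE x)// ?xt//; apply: ymin; [case: K2x|rewrite xt].
  move=> [[K1y yt]] /=; rewrite -xt -(hE x) ?xt// => yx; split=> //; split=> // w K1w wy.
  by apply: le_trans yx _; case: K2x => _; apply=> //; rewrite xt -yt.
move=> k; rewrite in_cons => /orP[/eqP ->|ks].
  by rewrite eqxx; split=> // x K2x hx; apply: hE => //; lra.
case: eqP => [->|_]; first by split=> // x K2x hx; apply: hE => //; lra.
have [Cg xg] := Kg k ks; split; first exact: C1_between_sub Cg.
by move=> x [K1x _] hx; apply: xg => //; lra.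
Qed.

(** Treating all coordinates leaves the graph of a C^1 curve inside [K]. *)
Lemma definable_dim_gt0 n (K : set 'rV[R]_n) (i : 'I_n) a b :
  dset S K -> compact K -> a < b ->
  (forall t, a < t < b -> exists2 x, K x & x 0 i = t) -> (0 < Defs.dim K)%N.
Proof.
move=> dK cK ab Kt.
have [|K' [c [d [g [K'K ac cd db [dK' fK' Kg]]]]]] :=
    @definable_curve_seq n i (enum 'I_n) K a b dK ab.
  move=> t /Kt[x Kx xt]; split; last by exists x.
  by apply: (@compact_closedI _ K [set x | x 0 i = t]) => //; apply: closed_coord_eq.
have gK t : c < t < d -> exists2 x, K' x & x 0 i = t /\ x = \row_j g j t.
  move=> ht; have [_ [x [K'x xt]]] := fK' t ht; exists x => //; split=> //.
  apply/rowP => j; rewrite mxE -xt; have [_ ->//] := Kg j (mem_enum _ j).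
  by rewrite xt.
apply: (@dim_gt0_curve _ _ K i g c d) => //.
- by move=> j; have [] := Kg j (mem_enum _ j).
- by move=> t /gK[x _ [xt xg]]; move: xt; rewrite xg mxE.
- by move=> t /gK[x K'x [_ <-]]; apply: K'K.
Qed.

End DefinableCurves.

(** * Hyperplanes and their unit normals *)

Section Hyperplanes.
Variables (R : realType) (n : nat).
Implicit Types (P : {vspace 'rV[R]_n}) (w nu : 'rV[R]_n).

Definition is_normal P nu : Prop :=
  enorm nu = 1 /\ forall w, w \in P <-> dot w nu = 0.

Lemma is_normalN P nu : is_normal P nu -> is_normal P (- nu).
Proof.
move=> [nu1 H]; split=> [|w]; first by rewrite enormN.
rewrite H dotNr; split=> [->|/eqP]; first by rewrite oppr0.
by rewrite oppr_eq0 => /eqP.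
Qed.

Lemma is_normal_inj P Q nu : is_normal P nu -> is_normal Q nu -> P = Q.
Proof.
move=> [_ HP] [_ HQ]; apply/vspaceP => w.
by apply/idP/idP => [/HP/HQ|/HQ/HP].
Qed.

Lemma dim_rV : \dim {: 'rV[R]_n} = n.
Proof. by rewrite dimvf /dim /= mul1n. Qed.

Let hyper nu := lker (linfun (mulmxr nu^T : 'rV[R]_n -> 'rV[R]_1)).

Let mem_hyper nu w : w \in hyper nu <-> dot w nu = 0.
Proof.
rewrite memv_ker lfunE /= dotE; split=> [/eqP/matrixP/(_ 0 0)|->].
  by rewrite !mxE eqxx mulr1n.
by apply/eqP/matrixP => i j; rewrite !mxE mul0rn.
Qed.

Let dim_hyper nu : nu != 0 -> \dim (hyper nu) = n.-1.
Proof.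
move=> nu0; have := limg_ker_dim (linfun (mulmxr nu^T : 'rV[R]_n -> 'rV[R]_1)) fullv.
rewrite capfv dim_rV -/(hyper nu).
set d := \dim (limg _); suff -> : d = 1%N by rewrite addn1 => E; rewrite -[in RHS]E.
apply/eqP; rewrite eqn_leq; apply/andP; split.
  by apply: leq_trans (dimvS (subvf _)) _; rewrite dimvf /dim /= mul1n.
rewrite lt0n dimv_eq0; apply/negP => /eqP E.
have : linfun (mulmxr nu^T : 'rV[R]_n -> 'rV[R]_1) nu \in limg (linfun (mulmxr nu^T : 'rV[R]_n -> 'rV[R]_1)).
  by apply: memv_img; apply: memvf.
rewrite E memv0 lfunE /= dotE => /eqP/matrixP/(_ 0 0).
rewrite !mxE eqxx mulr1n => /dot_eq0 E'; by rewrite E' eqxx in nu0.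
Qed.

Lemma hyperplane_exists nu : enorm nu = 1 ->
  exists P : grassmannian R n.-1 n, is_normal (val P) nu.
Proof.
move=> nu1; have nu0 : nu != 0.
  by apply/negP => /eqP E; move: nu1; rewrite E enorm0 => /eqP; rewrite eq_sym oner_eq0.
have dP : \dim (hyper nu) == n.-1 by rewrite dim_hyper.
by exists (exist _ (hyper nu) dP); split=> // w; apply: mem_hyper.
Qed.

Let basis_mx P := \matrix_(i < \dim P) (vbasis P)`_i.

Let mem_basis_mx P w : w \in P -> exists c, w = c *m basis_mx P.
Proof.
move=> /coord_vbasis ->; exists (\row_i coord (vbasis P) i w).
by rewrite mulmx_sum_row; apply: eq_bigr => i _; rewrite mxE rowK.
Qed.

Lemma normal_exists P : (0 < n)%N -> \dim P = n.-1 -> exists nu, is_normal P nu.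
Proof.
move=> n0 dP.
pose f := linfun (mulmxr (basis_mx P)^T : 'rV[R]_n -> 'rV[R]_(\dim P)).
have [u uK u0] : exists2 u, u \in lker f & u != 0.
  exists (vpick (lker f)); first exact: memv_pick.
  rewrite vpick0 -dimv_eq0 -lt0n.
  have := limg_ker_dim f fullv; rewrite capfv dim_rV => E.
  have le : (\dim (limg f) <= n.-1)%N.
    by rewrite -dP; apply: leq_trans (dimvS (subvf _)) _; rewrite dimvf /dim /= mul1n.
  by move: (\dim (lker f)) (\dim (limg f)) E le => a b; lia.
have Pu w : w \in P -> dot w u = 0.
  move=> /mem_basis_mx[c ->]; move: uK; rewrite memv_ker lfunE /= => /eqP uB.
  have : (c *m basis_mx P) *m u^T = 0.
    by rewrite -mulmxA -[_ *m u^T]trmxK trmx_mul trmxK uB trmx0 mulmx0.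
  by rewrite dotE => /matrixP/(_ 0 0); rewrite !mxE eqxx mulr1n.
have PE : P = hyper u.
  apply/eqP; rewrite eqEdim dim_hyper// dP leqnn andbT.
  by apply/subvP => w /Pu/mem_hyper.
have e0 : enorm u != 0 by rewrite gt_eqF // enorm_gt0.
exists ((enorm u)^-1 *: u); split=> [|w]; first exact: normalize_unit.
rewrite PE; apply: (iff_trans (mem_hyper _ _)); rewrite dotZr.
split=> [->|/eqP]; first by rewrite mulr0.
by rewrite mulf_eq0 invr_eq0 (negbTE e0) => /eqP.
Qed.

Let mul_tr_eq0 m (A : 'M[R]_(m, n)) : A *m A^T = 0 -> A = 0.
Proof.
move=> AA; apply/row_matrixP => i; rewrite row0; apply: dot_eq0.
have /matrixP/(_ i i) := AA; rewrite !mxE => E; rewrite -[RHS]E.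
by apply: eq_bigr => j _; rewrite !mxE.
Qed.

(** Both sides fix the hyperplane pointwise and vanish on its normal. *)
Lemma orthoproj_normal P nu : is_normal P nu ->
  orthoproj P = 1%:M - nu^T *m nu.
Proof.
move=> [nu1 HP]; rewrite /orthoproj -/(basis_mx P); set B := basis_mx P.
have BP i : row i B \in P.
  by rewrite rowK; apply: vbasis_mem; rewrite mem_nth// size_tuple.
have Bnu : B *m nu^T = 0.
  apply/row_matrixP => i; rewrite row_mul row0.
  by apply/matrixP => j k; rewrite dotE (HP _).1// !mxE mul0rn.
have freeB m (K : 'M[R]_(m, (\dim P)%VS)) : K *m B = 0 -> K = 0.
  move=> KB; apply/matrixP => i j; rewrite mxE.
  have /freeP fB := basis_free (vbasisP P).
  apply: (fB (fun j => K i j)); have /(congr1 (row i)) := KB.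
  rewrite row_mul row0 mulmx_sum_row => E; rewrite -[RHS]E; apply: eq_bigr => k _.
  by rewrite mxE rowK.
have uBB : B *m B^T \in unitmx.
  rewrite -row_free_unit -kermx_eq0; apply/eqP/freeB/mul_tr_eq0.
  by rewrite trmx_mul !mulmxA -(mulmxA _ B) mulmx_ker mul0mx.
apply/row_matrixP => i; rewrite !rowE; set w : 'rV_n := delta_mx 0 i.
have /mem_basis_mx[c cE] : w - dot w nu *: nu \in P.
  by apply/HP; rewrite !dotlin ((enorm1P nu).1 nu1) mulr1 subrr.
have E : w *m (1%:M - nu^T *m nu) = w - dot w nu *: nu.
  by rewrite mulmxBr mulmx1 mulmxA dotE mul_scalar_mx.
have nuB : nu *m B^T = 0 by rewrite -[nu in LHS]trmxK -trmx_mul Bnu trmx0.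
have wB : w *m B^T = c *m (B *m B^T).
  rewrite mulmxA -cE mulmxBl -scalemxAl nuB scaler0 subr0//.
by rewrite E cE !mulmxA wB mulmxK.
Qed.

End Hyperplanes.

(** * Topology of the Grassmannian of hyperplanes *)

Section GrassmannianTopology.
Variables (R : realType) (n : nat).
Hypothesis n0 : (0 < n)%N.
Notation grass := (grassmannian R n.-1 n).
Implicit Types (P Q : grass) (nu mu : 'rV[R]_n).

(** Coordinates of the orthogonal projection along the unit vector [nu]. *)
Definition perp_coord nu : 'rV[R]_(n * n) := mxvec (1%:M - nu^T *m nu).

Lemma perp_coordE nu i j :
  perp_coord nu 0 (mxvec_index i j) = (i == j)%:R - nu 0 i * nu 0 j.
Proof. by rewrite mxvecE !mxE big_ord1 mxE. Qed.

Lemma grass_coord_normal P nu : is_normal (val P) nu -> grass_coord P = perp_coord nu.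
Proof. by move=> /orthoproj_normal E; rewrite /grass_coord E. Qed.

Lemma grass_normal_exists P : exists nu, is_normal (val P) nu.
Proof. by case: P => P /= /eqP dP; apply: normal_exists. Qed.

Lemma grass_normal_inj P Q nu : is_normal (val P) nu -> is_normal (val Q) nu -> P = Q.
Proof. by move=> HP HQ; apply/val_inj/(is_normal_inj HP HQ). Qed.

Lemma perp_coord_dist nu mu e : enorm nu = 1 -> enorm mu = 1 ->
  enorm (mu - nu) < e ->
  forall k, `|perp_coord mu 0 k - perp_coord nu 0 k| < 2 * e.
Proof.
move=> nu1 mu1 d k; case/mxvec_indexP: k => i j; rewrite !perp_coordE.
have ni := normr_coord_le nu i; have mj := normr_coord_le mu j.
have di := normr_coord_le (mu - nu) i; have dj := normr_coord_le (mu - nu) j.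
rewrite nu1 in ni; rewrite mu1 in mj.
move: di dj; rewrite ![(mu - nu) _ _]mxE ![(- nu) _ _]mxE => di dj.
have -> : (i == j)%:R - mu 0 i * mu 0 j - ((i == j)%:R - nu 0 i * nu 0 j) =
   - ((mu 0 i - nu 0 i) * mu 0 j + nu 0 i * (mu 0 j - nu 0 j)) by ring.
rewrite normrN; apply: le_lt_trans (ler_normD _ _) _; rewrite !normrM.
have A1 : `|mu 0 i - nu 0 i| * `|mu 0 j| <= enorm (mu - nu).
  by rewrite -[leRHS]mulr1; apply: ler_pM.
have A2 : `|nu 0 i| * `|mu 0 j - nu 0 j| <= enorm (mu - nu).
  by rewrite -[leRHS]mul1r; apply: ler_pM.
lra.
Qed.

(** Nearby projections have nearby normals once the sign is chosen: with
    [c = dot mu nu >= 0], the distance squared is [2 (1 - c) <= 2 (1 - c^2)], and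
    [1 - c^2] is the value at [nu] of the difference of the quadratic forms. *)
Lemma perp_coord_close nu mu d : enorm nu = 1 -> enorm mu = 1 ->
  0 <= dot mu nu ->
  (forall k, `|perp_coord mu 0 k - perp_coord nu 0 k| <= d) ->
  enorm (mu - nu) ^+ 2 <= 2 * (n ^ 2)%:R * d.
Proof.
move=> nu1 mu1 c0 H.
have dnn := (enorm1P nu).1 nu1; have dmm := (enorm1P mu).1 mu1.
have E : 1 - dot mu nu ^+ 2 =
    \sum_i \sum_j nu 0 i * nu 0 j * (perp_coord mu 0 (mxvec_index i j) -
                                    perp_coord nu 0 (mxvec_index i j)).
  transitivity (dot nu nu * dot nu nu - dot mu nu * dot mu nu).
    by rewrite dnn mulr1 expr2.
  rewrite /dot !mulr_suml -sumrB; apply: eq_bigr => i _.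
  rewrite !mulr_sumr -sumrB; apply: eq_bigr => j _.
  rewrite !perp_coordE; ring.
have c1 : dot mu nu <= 1 by have := dot_le_enorm mu nu; rewrite nu1 mu1 mulr1.
have le1 : 1 - dot mu nu ^+ 2 <= (n ^ 2)%:R * d.
  rewrite E; apply: le_trans (_ : \sum_(i < n) \sum_(j < n) d <= _).
    apply: ler_sum => i _; apply: ler_sum => j _.
    apply: le_trans (ler_norm _) _; rewrite normrM.
    have ni := normr_coord_le nu i; have nj := normr_coord_le nu j.
    rewrite nu1 in ni nj.
    rewrite -[leRHS]mul1r; apply: ler_pM => //.
    by rewrite normrM -[leRHS]mul1r; apply: ler_pM.
  by rewrite !sumr_const !card_ord -mulrnA mulr_natl mulnn.
rewrite enorm_sqr !dotlin dnn dmm (dotC nu mu).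
have : dot mu nu ^+ 2 <= dot mu nu by rewrite expr2 ler_piMl.
lra.
Qed.

Lemma normal_same_side Q nu : exists2 mu, is_normal (val Q) mu & 0 <= dot mu nu.
Proof.
have [mu HQ] := grass_normal_exists Q.
have [c0|c0] := leP 0 (dot mu nu); first by exists mu.
by exists (- mu); [apply: is_normalN|rewrite dotNl oppr_ge0 ltW].
Qed.

(** Turns the topology of the Grassmannian into that of the unit sphere up to
    sign; all later topological arguments on hyperplanes take place there. *)
Lemma grass_nbhs P nu (A : set grass) : is_normal (val P) nu ->
  (nbhs P A <-> exists2 e, 0 < e &
     forall Q mu, is_normal (val Q) mu -> enorm (mu - nu) < e -> A Q).
Proof.
move=> HP; have nu1 := HP.1; split.
  rewrite nbhsE => -[B [[W oW OB] BP] BA].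
  have WP : W (grass_coord P) by move: BP; rewrite -OB.
  have /nbhs_ballP[e /= e0 eO] : nbhs (grass_coord P) W by apply: open_nbhs_nbhs.
  exists (e / 2); first by lra.
  move=> Q mu HQ d; apply: BA; rewrite -OB; apply: eO.
  rewrite (grass_coord_normal HP) (grass_coord_normal HQ); split=> // i k.
  rewrite (ord1 i) /ball /= distrC.
  by have := perp_coord_dist nu1 HQ.1 d k; lra.
move=> [e e0 eA].
pose d := e ^+ 2 / (4 * (n ^ 2)%:R).
have n2 : 0 < (n ^ 2)%:R :> R by rewrite ltr0n expn_gt0 n0.
have d0 : 0 < d by rewrite divr_gt0 ?exprn_gt0 ?mulr_gt0.
rewrite nbhsE; exists (@grass_coord R n.-1 n @^-1` ball (grass_coord P) d).
  split; last exact: ballxx.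
  by exists (ball (grass_coord P) d) => //; apply: ball_open.
move=> Q [_ Qd].
have [mu HQ c0] := normal_same_side Q nu.
apply: (eA Q mu HQ).
rewrite -(ltr_pXn2r (n := 2)) ?nnegrE ?enorm_ge0 ?ltW//.
apply: le_lt_trans (perp_coord_close nu1 HQ.1 c0 (d := d) _) _.
  move=> k; have := Qd 0 k.
  by rewrite (grass_coord_normal HP) (grass_coord_normal HQ) /ball /= distrC => /ltW.
have -> : 2 * (n ^ 2)%:R * d = e ^+ 2 / 2.
  by rewrite /d; move: (n ^ 2)%:R n2 => N N0; field; rewrite gt_eqF.
by have := exprn_gt0 2 e0; lra.
Qed.

Lemma grass_cvgP (T : nat -> grass) P nu : is_normal (val P) nu ->
  (T k @[k --> \oo] --> P <->
   forall e, 0 < e -> exists N, forall k, (N <= k)%N ->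
     exists mu, is_normal (val (T k)) mu /\ enorm (mu - nu) < e).
Proof.
move=> HP; split=> [TP e e0|H A /(grass_nbhs _ HP)[e e0 eA]].
  have /TP[N _ HN] : nbhs P [set Q | exists mu, is_normal (val Q) mu /\ enorm (mu - nu) < e].
    by apply/(grass_nbhs _ HP); exists e => // Q mu ? ?; exists mu.
  by exists N => k /HN.
have [N HN] := H e e0; exists N => // k /= /HN[mu [Hmu d]].
exact: eA Hmu d.
Qed.

Lemma grass_coord_inj P Q : grass_coord P = grass_coord Q -> P = Q.
Proof.
have [nu HP] := grass_normal_exists P.
have [mu HQ c0] := normal_same_side Q nu.
rewrite (grass_coord_normal HP) (grass_coord_normal HQ) => E.
have : enorm (mu - nu) ^+ 2 <= 2 * (n ^ 2)%:R * 0.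
  apply: perp_coord_close (HP.1) (HQ.1) c0 _ => k.
  by rewrite E subrr normr0.
rewrite mulr0 => d0; have {}d0 : mu - nu = 0.
  by apply/enorm_eq0/eqP; rewrite -sqrf_eq0 eq_le d0 sqr_ge0.
have -> : P = Q; last by [].
by apply: grass_normal_inj HP _; rewrite -(subrK nu mu) d0 add0r in HQ.
Qed.

Lemma continuous_perp_coord : continuous perp_coord.
Proof.
move=> nu A /nbhs_ballP[e /= e0 eA]; apply: (nbhs_enormP nu (perp_coord @^-1` A)).2.
pose M := 1 + enorm nu.
have M0 : 0 < M by rewrite ltr_pwDl// enorm_ge0.
exists (Num.min 1 (e / (2 * M))); first by rewrite lt_min ltr01 divr_gt0// mulr_gt0.
move=> mu; rewrite lt_min => /andP[d1 d2]; apply: eA; split=> // i k.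
rewrite (ord1 i) /ball /=; case/mxvec_indexP: k => a b; rewrite !perp_coordE.
have na := normr_coord_le nu a; have mb := normr_coord_le mu b.
have da := normr_coord_le (mu - nu) a; have db := normr_coord_le (mu - nu) b.
move: da db; rewrite ![(mu - nu) _ _]mxE ![(- nu) _ _]mxE => da db.
have muM : enorm mu <= M.
  have := ler_enormD (mu - nu) nu; rewrite subrK /M; lra.
have -> : (a == b)%:R - nu 0 a * nu 0 b - ((a == b)%:R - mu 0 a * mu 0 b) =
   (mu 0 a - nu 0 a) * mu 0 b + nu 0 a * (mu 0 b - nu 0 b) by ring.
apply: le_lt_trans (ler_normD _ _) _; rewrite !normrM.
have A1 : `|mu 0 a - nu 0 a| * `|mu 0 b| <= enorm (mu - nu) * M.
  by apply: ler_pM => //; apply: le_trans mb muM.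
have A2 : `|nu 0 a| * `|mu 0 b - nu 0 b| <= M * enorm (mu - nu).
  apply: ler_pM => //; apply: le_trans na _; rewrite /M; lra.
have : enorm (mu - nu) * (2 * M) < e by rewrite -ltr_pdivlMr ?mulr_gt0.
lra.
Qed.

End GrassmannianTopology.

(** * Charts and tangent spaces *)

Section Charts.
Variable R : realType.

Lemma diff_locally_id n (U : set 'rV[R]_n) (f : 'rV[R]_n -> 'rV[R]_n) x v :
  open U -> U x -> (forall y, U y -> f y = y) -> differentiable f x ->
  'd f x v = v.
Proof.
move=> oU Ux fid df; rewrite -deriveE// -[RHS](@derive_id _ _ x v).
apply: near_eq_derive.
have : nbhs x U by apply: open_nbhs_nbhs.
by apply: filterS => y /fid.
Qed.

Lemma derive1_comp_mx m n (f : 'rV[R]_m -> 'rV[R]_n) (g : R -> 'rV[R]_m) t :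
  differentiable g t -> differentiable f (g t) ->
  derive1 (f \o g) t = derive1 g t *m jacobian f (g t).
Proof.
move=> dg df; rewrite mul_jacobian// !derive1E'//; last exact: differentiable_comp.
by rewrite diff_comp.
Qed.

Lemma affine_differentiable n (a u : 'rV[R]_n) (t : R) :
  differentiable (fun s : R => a + s *: u) t.
Proof.
have ds : differentiable ( *:%R ^~ u : R -> 'rV[R]_n) t by [].
exact: (differentiableD (differentiable_cst a t) ds).
Qed.

Lemma affine_derive1 n (a u : 'rV[R]_n) (t : R) :
  derive1 (fun s : R => a + s *: u) t = u.
Proof.
apply: cvg_lim => //; apply: cvg_near_cst.
apply: filterS (nbhs_dnbhs_neq _) => h h0.
rewrite opprD addrACA subrr add0r -scalerBl addrK scalerA mulVf ?scale1r //.
Qed.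

Lemma derive1_coord n (g : R -> 'rV[R]_n) t i : differentiable g t ->
  derive1 (fun s => g s 0 i : R) t = derive1 g t 0 i.
Proof.
move=> dg; have dc := differentiable_coord (g t) 0 i.
rewrite derive1E'; last exact: (differentiable_comp dg dc).
rewrite derive1E'//.
have := diff_comp dg dc => /(congr1 (fun f => f 1)) /= E.
by rewrite -(diff_coordE 0 i (g t)) -E.
Qed.

Lemma continuous_row_mul m n (T : topologicalType) (u : 'rV[R]_m)
    (J : T -> 'M[R]_(m, n)) t :
  {for t, continuous J} -> {for t, continuous (fun s => u *m J s)}.
Proof.
move=> cJ.
have H i j : {for t, continuous (fun s => (u *m J s) i j : R)}.
  rewrite (_ : (fun s => _) = (fun s => \sum_k u i k * J s k j)); last first.
    by apply/funext => s; rewrite mxE.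
  have Jk k : {for t, continuous (fun s => J s k j : R)}.
    apply: (@continuous_comp _ _ _ J (fun M : 'M[R]_(m, n) => M k j)) => //.
    exact: coord_continuous.
  apply: (cvg_big (@add_continuous R)) => k _.
  exact: (@cvgMl_tmp R T (nbhs t) (nbhs_filter t) _ (u i k) _ (Jk k)).
exact: (mx_coord_cvg H).
Qed.

(** What a flattening chart gives on its whole domain: the coordinates of index
    at least [d] are equations, and a vector is tangent when they vanish on its
    image, since the chart carries straight segments to curves in [A]. *)
Lemma submanifold_chart n d (A : set 'rV[R]_n) x : C1_submanifold_at d A x ->
  exists (U : set 'rV[R]_n) (phi : 'rV[R]_n -> 'rV[R]_n),
  [/\ open U, U x,
      forall y, U y -> [/\ differentiable phi y, jacobian phi y \in unitmx &
        {for y, continuous (jacobian phi)}],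
      forall y, U y -> (A y <-> forall i : 'I_n, (d <= i)%N -> phi y 0 i = 0) &
      forall y, U y -> A y -> C1_submanifold_at d A y /\
        forall w, tangent_vector A y w <->
          forall i : 'I_n, (d <= i)%N -> (w *m jacobian phi y) 0 i = 0].
Proof.
move=> [dn Ax [U [V [phi [psi [[oU oV] Ux [C1phi C1psi] [phiV psiU psiK phiK] AE]]]]]].
have VE y : U y -> V (phi y) by move=> Uy; apply: phiV; exists y.
have UE z : V z -> U (psi z) by move=> Vz; apply: psiU; exists z.
have JK y : U y -> jacobian phi y *m jacobian psi (phi y) = 1%:M.
  move=> Uy; have [dphi _] := C1phi _ Uy; have [dpsi _] := C1psi _ (VE _ Uy).
  apply/row_matrixP => i; rewrite !rowE mulmxA mulmx1 !mul_jacobian//.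
  have := diff_comp dphi dpsi => /(congr1 (fun f => f (delta_mx 0 i))) /= <-.
  apply: (diff_locally_id _ oU Uy); first exact: psiK.
  exact: differentiable_comp.
have AP y : U y -> (A y <-> forall i : 'I_n, (d <= i)%N -> phi y 0 i = 0).
  move=> Uy; split=> [Ay|H].
    have : (phi @` (A `&` U)) (phi y) by exists y.
    by rewrite AE => -[].
  have : (V `&` [set z | forall i : 'I_n, (d <= i)%N -> z 0 i = 0]) (phi y).
    by split=> //; apply: VE.
  rewrite -AE => -[y' [Ay' Uy'] E].
  by have -> : y = y' by rewrite -(psiK y Uy) -E psiK.
exists U, phi; split=> //.
  move=> y Uy; have [dphi cphi] := C1phi _ Uy.
  by split; [exact: dphi|exact: (mulmx1_unit (JK y Uy)).1|exact: cphi].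
move=> y Uy Ay; split.
  split=> //; exists U, V, phi, psi; split=> //.
move=> w; have [dphi cphi] := C1phi _ Uy; split.
  move=> [g [e [e0 g0 gw gA]]] i di.
  have e0' : - e < 0 < e by lra.
  have [_ /derivable1_diffP dg0 _] := gA 0 e0'.
  have cg0 := differentiable_continuous dg0.
  have dphi0 : differentiable phi (g 0) by rewrite g0.
  have := derive1_comp_mx dg0 dphi0; rewrite gw g0 => <-.
  rewrite -derive1_coord; last exact: differentiable_comp.
  rewrite derive1E -[RHS](@derive_cst _ R R 0 0 1); apply: near_eq_derive.
  have nU : nbhs 0 (g @^-1` U).
    by apply: cg0; rewrite g0; apply: open_nbhs_nbhs.
  have ne : nbhs (0 : R) [set t | - e < t < e].
    by apply: open_nbhs_nbhs; split=> //; apply: open_between.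
  apply: filterS (filterI nU ne) => t [Ugt te] /=.
  by have [Agt _ _] := gA t te; have /(_ Agt) := (AP _ Ugt).1; apply.
move=> wJ; pose u := w *m jacobian phi y.
pose c (t : R) := phi y + t *: u.
have cc t : {for t, continuous c} by apply/differentiable_continuous/affine_differentiable.
have [e /= e0 eV] : exists2 e, 0 < e & forall t, `|t| < e -> V (c t).
  have /nbhs_ballP[e /= e0 eV] : nbhs 0 (c @^-1` V).
    by apply: cc; rewrite /c scale0r addr0; apply: open_nbhs_nbhs; split=> //; apply: VE.
  by exists e => // t te; apply: eV; rewrite /ball /= sub0r normrN.
have {}eV t : - e < t < e -> V (c t) by move=> te; apply: eV; rewrite ltr_norml.
have dpsi t : - e < t < e -> differentiable psi (c t).
  by move=> /eV Vc; exact: (C1psi _ Vc).1.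
have dg t : - e < t < e -> differentiable (psi \o c) t.
  move=> te; apply: differentiable_comp; last exact: dpsi.
  exact: (affine_differentiable (phi y) u t).
have D t : - e < t < e -> u *m jacobian psi (c t) = derive1 (psi \o c) t.
  move=> te; have dc : differentiable c t := affine_differentiable (phi y) u t.
  apply: etrans (esym (derive1_comp_mx dc (dpsi t te))).
  by congr (_ *m _); exact/esym/affine_derive1.
have e0' : - e < 0 < e by lra.
exists (psi \o c), e; split=> //=.
- by rewrite /c scale0r addr0 psiK.
- by rewrite -D// /c scale0r addr0 /u -mulmxA JK// mulmx1.
move=> t te; split.
- apply/(AP _ (UE _ (eV t te))) => i di; rewrite phiK; last exact: eV.
  rewrite /c mxE [X in _ + X]mxE /u (wJ i di) mulr0 addr0.
  exact: (AP _ Uy).1 Ay i di.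
- by apply/derivable1_diffP; apply: dg.
apply: (near_eq_continuous (@open_between _ (- e) e) te D).
apply: (@continuous_row_mul _ _ _ u (jacobian psi \o c)).
apply: continuous_comp; first exact: cc.
exact: (C1psi _ (eV t te)).2.
Qed.

Lemma tangent_rank n d (A : set 'rV[R]_n) x : C1_submanifold_at d A x ->
  exists T : 'M[R]_n, \rank T = d /\ forall w, tangent_vector A x w <-> (w <= T)%MS.
Proof.
move=> CA; have [dn Ax _] := CA; have [U [phi [oU Ux dphi _ AT]]] := submanifold_chart CA.
have [_ uJ _] := dphi x Ux; have [_ tg] := AT x Ux Ax.
exists (pid_mx d *m invmx (jacobian phi x)); split.
  by rewrite mxrankMfree ?row_free_unit ?unitmx_inv// rank_pid_mx.
move=> w; apply: (iff_trans (tg w)).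
have E : (w *m jacobian phi x <= (pid_mx d : 'M[R]_n))%MS <->
    (w <= (pid_mx d : 'M[R]_n) *m invmx (jacobian phi x))%MS.
  split=> [H|].
    by have := submxMr (invmx (jacobian phi x)) H; rewrite mulmxK.
  by move=> /(submxMr (jacobian phi x)); rewrite mulmxKV//.
apply: iff_trans E; set z := w *m _; split=> [H|/submxP[c ->] i di].
  apply/submxP; exists z; apply/rowP => i; rewrite [RHS]mxE (bigD1 i)//= big1 => [|j ji].
    rewrite addr0 [X in _ * X]mxE eqxx /=; case: ltnP => [_|di]; first by rewrite mulr1.
    by rewrite mulr0 H.
  by rewrite [X in _ * X]mxE (_ : (_ == _ :> nat) = false) ?mulr0//; apply/negbTE.
by rewrite mxE big1// => j _; rewrite [X in _ * X]mxE; case: eqP => [E|_];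
   rewrite ?mulr0// E ltnNge di mulr0.
Qed.

(** The last coordinate of the chart is a local equation [h], with gradient [G]. *)
Lemma hypersurface_chart n (A : set 'rV[R]_n.+1) x : C1_submanifold_at n A x ->
  exists (U : set 'rV[R]_n.+1) (h : 'rV[R]_n.+1 -> R) (G : 'rV[R]_n.+1 -> 'rV[R]_n.+1),
  [/\ open U, U x,
      forall y, U y -> [/\ differentiable h y, forall w, 'd h y w = dot w (G y),
        G y != 0 & {for y, continuous G}],
      forall y, U y -> (A y <-> h y = 0) &
      forall y, U y -> A y -> C1_submanifold_at n A y /\
        forall w, tangent_vector A y w <-> dot w (G y) = 0].
Proof.
move=> /submanifold_chart[U [phi [oU Ux dphi AP AT]]].
have last (P : 'I_n.+1 -> Prop) :
    (forall i : 'I_n.+1, (n <= i)%N -> P i) <-> P ord_max.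
  split=> [H|H i ni]; first exact: H.
  by have -> : i = ord_max by apply/val_inj/eqP; rewrite /= eqn_leq ni -ltnS ltn_ord.
pose G y : 'rV[R]_n.+1 := \row_k jacobian phi y k ord_max.
have GE y w : (w *m jacobian phi y) 0 ord_max = dot w (G y).
  by rewrite mxE; apply: eq_bigr => k _; rewrite [X in _ = _ * X]mxE.
exists U, (fun y => phi y 0 ord_max), G; split=> //.
- move=> y Uy; have [dy uJ cJ] := dphi y Uy; split.
  + exact: coord_differentiable.
  + by move=> w; rewrite coord_diff// -mul_jacobian// GE.
  + apply/negP => /eqP G0; have := GE y (delta_mx 0 ord_max *m invmx (jacobian phi y)).
    rewrite mulmxKV// G0 dot0r mxE !eqxx => /eqP; by rewrite oner_eq0.
  have cG i j : {for y, continuous (fun z => G z i j : R)}.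
    rewrite (_ : (fun z => _) = (fun z => jacobian phi z j ord_max)); last first.
      by apply/funext => z; rewrite [LHS]mxE.
    apply: (@continuous_comp _ _ _ (jacobian phi) (fun M : 'M[R]_(n.+1, n.+1) => M j ord_max)) => //.
    exact: coord_continuous.
  exact: (mx_coord_cvg cG).
- by move=> y Uy; apply: (iff_trans (AP y Uy)); apply: (last (fun i => phi y 0 i = 0)).
- move=> y Uy Ay; have [CA tg] := AT y Uy Ay; split=> // w.
  apply: (iff_trans (tg w)); rewrite -GE.
  exact: (last (fun i => (w *m jacobian phi y) 0 i = 0)).
Qed.

End Charts.

(** * Submanifolds and unit normals *)

Section Submanifolds.
Variables (R : realType) (n : nat).
Implicit Types (A B U W : set 'rV[R]_n) (x y w : 'rV[R]_n).

Lemma open_submanifold U : open U -> C1_submanifold n U.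
Proof.
move=> oU x Ux; split=> //.
have did z : differentiable (@id 'rV[R]_n) z by [].
have J1 z : jacobian (@id 'rV[R]_n) z = 1%:M.
  apply/row_matrixP => i; rewrite !rowE mulmx1 mul_jacobian; last exact: did.
  exact: (diff_locally_id _ openT I).
have C1id : C1_on U (@id 'rV[R]_n).
  move=> y Uy; split; first exact: did.
  have -> : jacobian (@id 'rV[R]_n) = cst 1%:M by apply/funext.
  exact: cst_continuous.
exists U, U, id, id; split=> //.
- by split=> //; [move=> _ [y Uy <-]|move=> _ [y Uy <-]].
- rewrite image_id setIid; apply/seteqP; split=> [y Uy|y []//]; split=> // i ni.
  by move: (ltn_ord i); rewrite ltnNge ni.
Qed.

Lemma leq_dim d A M : M !=set0 -> C1_submanifold d M -> M `<=` A -> (d <= Defs.dim A)%N.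
Proof.
move=> M0 CM MA; have [x Mx] := M0; have [dn _ _] := CM x Mx.
have dn1 : (d < n.+1)%N by [].
apply: (@leq_trans (nat_of_ord (Ordinal dn1))) => //.
apply: (@leq_bigmax_cond _ _ (fun d => nat_of_ord d)).
by apply/asboolP; exists M.
Qed.

Lemma dim_witness d A : (0 < d)%N -> (d <= Defs.dim A)%N ->
  exists d' M, [/\ (d <= d')%N, M !=set0, C1_submanifold d' M & M `<=` A].
Proof.
move=> d0 dA; apply: contrapT => H.
suff : (Defs.dim A <= d.-1)%N by lia.
apply/bigmax_leqP => i /asboolP[M [M0 CM MA]].
case: (leqP i d.-1) => // di; case: H; exists i, M; split=> //.
by move: di; rewrite -ltnS prednK.
Qed.

Lemma tangent_vector_sub A B x w : A `<=` B -> tangent_vector A x w -> tangent_vector B x w.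
Proof.
move=> AB [g [e [e0 g0 gw H]]]; exists g, e; split=> // t te.
by have [gA dg cg] := H t te; split=> //; apply: AB.
Qed.

Lemma tangent_vector_local A B W x w : open W -> W x ->
  (forall y, W y -> A y -> B y) -> tangent_vector A x w -> tangent_vector B x w.
Proof.
move=> oW Wx AB [g [e [e0 g0 gw H]]].
have e00 : - e < 0 < e by lra.
have [_ /derivable1_diffP dg0 _] := H 0 e00.
have cg0 := differentiable_continuous dg0.
have /nbhs_ballP[r /= r0 rW] : nbhs 0 (g @^-1` W).
  by apply: cg0; rewrite g0; apply: open_nbhs_nbhs.
exists g, (Num.min e r); split=> //; first by rewrite lt_min e0.
move=> t; rewrite lt_min ltrNl lt_min => /andP[/andP[t1 t2] /andP[t3 t4]].
have te : - e < t < e by lra.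
have [gA dg cg] := H t te; split=> //; apply: AB => //.
by apply: rW; rewrite /ball /= sub0r normrN ltr_norml; lra.
Qed.

Lemma C1_submanifold_at_local d A B W x : open W -> W x ->
  (forall y, W y -> (A y <-> B y)) -> C1_submanifold_at d A x -> C1_submanifold_at d B x.
Proof.
move=> oW Wx AB [dn Ax [U [V [phi [psi [[oU oV] Ux [C1phi C1psi] [phiV psiU psiK phiK] AE]]]]]].
split=> //; first exact/AB.
exists (U `&` W), (V `&` psi @^-1` W), phi, psi; split.
- split; first exact: openI.
  have VpsiE : V `&` psi @^-1` W = V `&` (psi @^-1` W)^°.
    apply/seteqP; split=> z [Vz Wz]; split=> //; last exact: interior_subset.
    apply: (differentiable_continuous (C1psi _ Vz).1).
    exact: open_nbhs_nbhs.
  by rewrite VpsiE; apply: openI => //; apply: open_interior.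
- by split.
- by split=> y [? ?]; [apply: C1phi|apply: C1psi].
- split.
  + by move=> _ [y [Uy Wy] <-]; split; [apply: phiV; exists y|rewrite /= psiK].
  + by move=> _ [z [Vz Wz] <-]; split=> //; apply: psiU; exists z.
  + by move=> y [Uy _]; apply: psiK.
  + by move=> z [Vz _]; apply: phiK.
- apply/seteqP; split=> [_ [y [By [Uy Wy]] <-]|z [[Vz Wz] z0]].
    have : (phi @` (A `&` U)) (phi y) by exists y => //; split=> //; apply/AB.
    by rewrite AE => -[Vy ?]; split=> //; split=> //; rewrite /= psiK.
  have : (V `&` [set z | forall i : 'I_n, (d <= i)%N -> z 0 i = 0]) z by [].
  rewrite -AE => -[y [Ay Uy] yz].
  have Wy : W y by move: Wz; rewrite /= -yz psiK.
  by exists y => //; split=> //; apply/AB.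
Qed.

(** Tangency enters later arguments only through secants. Their scaling is
    positive, so that one-sided inequalities pass to the limit. *)
Lemma tangent_approx A x w e : tangent_vector A x w -> 0 < e ->
  exists q c, [/\ A q, 0 < c, enorm (q - x) < e & enorm (c *: (q - x) - w) < e].
Proof.
move=> [g [r [r0 g0 gw H]]] e0.
have r00 : - r < 0 < r by lra.
have [_ dg0 _] := H 0 r00.
have cg0 := differentiable_continuous ((derivable1_diffP _ _).1 dg0).
have [a /= a0 Ha] : exists2 a, 0 < a & forall t, `|t| < a -> enorm (g t - x) < e.
  have /nbhs_ballP[a /= a0 Ha] : nbhs 0 (g @^-1` [set y | enorm (y - x) < e]).
    by apply: cg0; rewrite g0; apply/nbhs_enormP; exists e.
  by exists a => // t ta; apply: Ha; rewrite /ball /= sub0r normrN.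
have [b /= b0 Hb] : exists2 b, 0 < b & forall h, `|h| < b -> h != 0 ->
    enorm (h^-1 *: (g h - x) - w) < e.
  have /(_ [set y | enorm (y - w) < e]) : (fun h => h^-1 *: (g (h *: 1 + 0) - g 0)) @ 0^' --> w.
    by rewrite -gw derive1E; exact: dg0.
  have nw : nbhs w [set y | enorm (y - w) < e] by apply/nbhs_enormP; exists e.
  move=> /(_ nw) /nbhs_ballP[b /= b0 Hb]; exists b => // h hb h0.
  have := Hb h; rewrite /ball /= sub0r normrN => /(_ hb h0).
  by rewrite addr0 g0 /GRing.scale /= mulr1.
pose m := Num.min r (Num.min a b).
have m0 : 0 < m by rewrite !lt_min r0 a0.
pose h := m / 2; have h0 : 0 < h by rewrite /h; lra.
have hm : h < m by rewrite /h; lra.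
move: (hm); rewrite !lt_min => /and3P[hr ha hb].
have hin : - r < h < r by lra.
have [gA _ _] := H h hin.
exists (g h), h^-1; split=> //.
- by rewrite invr_gt0.
- by apply: Ha; rewrite gtr0_norm.
- by apply: Hb; rewrite ?gtr0_norm// gt_eqF.
Qed.

End Submanifolds.

Lemma sup_le_enorm (R : realType) n (x : 'rV[R]_n) : `|x| <= enorm x.
Proof.
change (mx_norm x <= enorm x); rewrite mx_normrE; apply/bigmax_leP; split.
  exact: enorm_ge0.
by move=> i _; rewrite (ord1 i.1); exact: normr_coord_le.
Qed.

Section HypersurfaceNormals.
Variables (R : realType) (n : nat) (A : set 'rV[R]_n.+1).
Implicit Types (x y w nu mu : 'rV[R]_n.+1).

(** First-order, hence definable, orthogonality to the secants of [A] at [x]. *)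
Definition secant_normal x mu : Prop := forall e, 0 < e -> exists d, 0 < d /\
  forall q, A q -> enorm (q - x) < d -> `|dot (q - x) mu| <= e * enorm (q - x).

Definition unit_normal x mu : Prop :=
  enorm mu = 1 /\ forall w, tangent_vector A x w <-> dot w mu = 0.

Lemma secant_normal_tangent x mu w : enorm mu = 1 -> secant_normal x mu ->
  tangent_vector A x w -> dot w mu = 0.
Proof.
move=> mu1 sn tw; apply/eqP; rewrite -normr_le0; apply/ler_addgt0Pr => k k0; rewrite add0r.
pose e := Num.min 1 (k / (enorm w + 2)).
have w2 : 0 < enorm w + 2 by have := enorm_ge0 w; lra.
have e0 : 0 < e by rewrite lt_min ltr01 divr_gt0.
have [d [d0 Hd]] := sn e e0.
have m0 : 0 < Num.min d e by rewrite lt_min d0.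
have [q [c [Aq c0 qdm qem]]] := tangent_approx tw m0.
have qd : enorm (q - x) < d by apply: lt_le_trans qdm _; rewrite ge_min lexx.
have qe : enorm (c *: (q - x) - w) < e by apply: lt_le_trans qem _; rewrite ge_min lexx orbT.
have H1 := Hd q Aq qd.
have -> : dot w mu = c * dot (q - x) mu - dot (c *: (q - x) - w) mu.
  by rewrite (dotBl (c *: (q - x)) w mu) dotZl; ring.
apply: le_trans (ler_normB _ _) _.
have H2 : `|dot (c *: (q - x) - w) mu| <= e.
  apply: (le_trans (normr_dot_le _ _)); rewrite mu1 mulr1.
  exact: ltW qe.
have H3 : c * enorm (q - x) <= enorm w + e.
  rewrite -[c]gtr0_norm// -enormZ.
  have := ler_enorm_dist (c *: (q - x)) w 0; rewrite !subr0; lra.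
have H4 : `|c * dot (q - x) mu| <= e * (enorm w + e).
  rewrite normrM (gtr0_norm c0).
  apply: (@le_trans _ _ (c * (e * enorm (q - x)))); first by rewrite ler_pM2l.
  by rewrite mulrCA ler_pM2l.
have e1 : e <= 1 by rewrite ge_min lexx.
have : e * (enorm w + 2) <= k.
  by rewrite -ler_pdivlMr// ge_min lexx orbT.
have : e * e <= e * 1 by rewrite ler_pM2l.
lra.
Qed.

Lemma unit_normalN x mu : unit_normal x mu -> unit_normal x (- mu).
Proof.
move=> [mu1 H]; split=> [|w]; first by rewrite enormN.
rewrite H dotNr; split=> [->|/eqP]; first by rewrite oppr0.
by rewrite oppr_eq0 => /eqP.
Qed.

Lemma parallel_unit nu mu : enorm nu = 1 -> enorm mu = 1 ->
  (forall w, dot w nu = 0 -> dot w mu = 0) -> mu = nu \/ mu = - nu.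
Proof.
move=> nu1 mu1 H; have dn := (enorm1P nu).1 nu1; have dm := (enorm1P mu).1 mu1.
have E : mu = dot mu nu *: nu.
  have H0 : dot (mu - dot mu nu *: nu) mu = 0.
    by apply: H; rewrite !dotlin dn mulr1 subrr.
  apply/eqP; rewrite -subr_eq0; apply/eqP/dot_eq0.
  move: H0; rewrite !dotlin dn dm (dotC nu mu); lra.
have : dot mu nu ^+ 2 = 1.
  by move: dm; rewrite {1 2}E dotZl dotZr dn mulr1 expr2.
move=> /eqP; rewrite sqrf_eq1 => /orP[] /eqP c; [left|right]; rewrite E c.
  by rewrite scale1r.
by rewrite scaleN1r.
Qed.

Lemma unit_normal_unique x nu mu : unit_normal x nu -> unit_normal x mu ->
  mu = nu \/ mu = - nu.
Proof. by move=> [n1 H] [m1 K]; apply: parallel_unit => // w /H/K. Qed.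

Lemma chart_normal x G : G != 0 -> (forall w, tangent_vector A x w <-> dot w G = 0) ->
  unit_normal x ((enorm G)^-1 *: G).
Proof.
move=> G0 H; have e0 : enorm G != 0 by rewrite gt_eqF// enorm_gt0.
split=> [|w]; first exact: normalize_unit.
apply: (iff_trans (H w)); rewrite dotZr; split=> [->|/eqP]; first by rewrite mulr0.
by rewrite mulf_eq0 invr_eq0 (negbTE e0) => /eqP.
Qed.

Lemma diff_secant (h : 'rV[R]_n.+1 -> R) x G : differentiable h x ->
  (forall w, 'd h x w = dot w G) -> h x = 0 ->
  forall e, 0 < e -> exists d, 0 < d /\ forall q, h q = 0 -> enorm (q - x) < d ->
    `|dot (q - x) G| <= e * enorm (q - x).
Proof.
move=> dh hG hx e e0.
have /eqaddoP /(_ _ e0) := diff_locally dh.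
move=> /nbhs_enormP[d d0 Hd]; exists d; split=> // q hq qd.
have qd' : enorm (q - x - 0) < d by rewrite subr0.
have := Hd _ qd'.
have -> : (h \o shift x - (cst (h x) + 'd h x)) (q - x) = - dot (q - x) G.
  have -> : (h \o shift x - (cst (h x) + 'd h x)) (q - x) =
            h (q - x + x) - (h x + 'd h x (q - x)) by [].
  by rewrite subrK hq hx hG !add0r.
rewrite normrN => H; apply: le_trans H _; rewrite ler_pM2l//.
exact: sup_le_enorm.
Qed.

Lemma unit_normal_exists x : C1_submanifold_at n A x -> exists mu, unit_normal x mu.
Proof.
move=> CA; have [_ Ax _] := CA.
have [U [h [G [oU Ux HU hA /(_ x Ux Ax)[_ tg]]]]] := hypersurface_chart CA.
have [_ _ G0 _] := HU x Ux.
by exists ((enorm (G x))^-1 *: G x); apply: chart_normal.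
Qed.

(** Tangent vectors are velocities of arbitrary curves; this makes the normals
    definable all the same. The normalized gradient of a local equation is
    orthogonal to secants by differentiability. *)
Lemma secant_normalP x mu : C1_submanifold_at n A x -> enorm mu = 1 ->
  (secant_normal x mu <-> unit_normal x mu).
Proof.
move=> CA mu1; have [_ Ax _] := CA.
have [U [h [G [oU Ux HU hA /(_ x Ux Ax)[_ tg]]]]] := hypersurface_chart CA.
have [dh hG G0 _] := HU x Ux.
pose nu := (enorm (G x))^-1 *: G x.
have g0 : 0 < enorm (G x) by apply: enorm_gt0.
have Hnu : unit_normal x nu by apply: chart_normal.
have snu : secant_normal x nu.
  move=> e e0; have e1 : 0 < e * enorm (G x) by apply: mulr_gt0.
  have [d [d0 Hd]] := diff_secant dh hG ((hA x Ux).1 Ax) e1.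
  have /nbhs_enormP[r r0 rU] : nbhs x U by apply: open_nbhs_nbhs.
  exists (Num.min d r); split; first by rewrite lt_min d0.
  move=> q Aq; rewrite lt_min => /andP[qd qr].
  rewrite /nu dotZr normrM normfV (gtr0_norm g0) mulrC ler_pdivrMr//.
  by rewrite mulrAC; apply: Hd => //; apply/(hA q (rU q qr)).
have secN k : secant_normal x k -> secant_normal x (- k).
  move=> sk e e0; have [d [d0 Hd]] := sk e e0; exists d; split=> // q Aq qd.
  by rewrite dotNr normrN; apply: Hd.
split=> [sn|Hmu].
  have [|->|->] := @parallel_unit nu mu Hnu.1 mu1 => //; last exact: unit_normalN.
  by move=> w /(Hnu.2 w); apply: secant_normal_tangent.
by have [->|->] := unit_normal_unique Hnu Hmu; [|apply: secN].
Qed.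

(** The unit normals are the normalized gradients of a C^1 local equation, up to
    sign. *)
Lemma unit_normal_continuous x nu e : C1_submanifold_at n A x -> unit_normal x nu -> 0 < e ->
  exists2 d, 0 < d & forall y, A y -> enorm (y - x) < d ->
    C1_submanifold_at n A y /\ exists mu, unit_normal y mu /\ enorm (mu - nu) < e.
Proof.
move=> CA Hnu e0; have [_ Ax _] := CA.
have [U [h [G [oU Ux HU hA AT]]]] := hypersurface_chart CA.
have [dh hG G0 cG] := HU x Ux; have [_ tgx] := AT x Ux Ax.
have g0 : 0 < enorm (G x) by apply: enorm_gt0.
have /nbhs_enormP[r r0 rU] : nbhs x U by apply: open_nbhs_nbhs.
have e1 : 0 < e / 2 * enorm (G x) by rewrite mulr_gt0// divr_gt0.
have /cG/nbhs_enormP[d d0 Hd] : nbhs (G x) [set z | enorm (z - G x) < e / 2 * enorm (G x)].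
  by apply/nbhs_enormP; exists (e / 2 * enorm (G x)).
exists (Num.min d r); first by rewrite lt_min d0.
move=> y Ay; rewrite lt_min => /andP[yd yr]; have Uy := rU y yr.
have [CAy tgy] := AT y Uy Ay; split=> //.
have [_ _ Gy0 _] := HU y Uy.
have gy0 : 0 < enorm (G y) by apply: enorm_gt0.
pose mu := (enorm (G y))^-1 *: G y; pose nu' := (enorm (G x))^-1 *: G x.
have Hmu : unit_normal y mu by apply: chart_normal.
have Hnu' : unit_normal x nu' by apply: chart_normal.
have close : enorm (mu - nu') < e.
  pose z := (enorm (G x))^-1 *: G y.
  have zE : enorm z = (enorm (G x))^-1 * enorm (G y).
    by rewrite enormZ normfV gtr0_norm.
  have muE : mu = (enorm z)^-1 *: z.
    rewrite zE /z scalerA invfM invrK mulrAC mulfV ?mul1r// gt_eqF//.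
  rewrite muE; apply: le_lt_trans (normalize_dist _ _) _.
  - exact: Hnu'.1.
  - by rewrite zE mulf_neq0// ?invr_eq0 gt_eqF.
  rewrite -scalerBr enormZ normfV (gtr0_norm g0).
  have : (enorm (G x))^-1 * enorm (G y - G x) < e / 2.
    by rewrite mulrC ltr_pdivrMr//; apply: Hd.
  lra.
have [E|E] := unit_normal_unique Hnu' Hnu; first by exists mu; rewrite E.
exists (- mu); split; first exact: unit_normalN.
have -> : - mu - nu = - (mu - nu') by rewrite E opprB addrC opprK.
by rewrite enormN.
Qed.

End HypersurfaceNormals.

(** * Points where a set and its closure agree *)

Section LocallyClosed.
Variables (R : realType) (S : omin_structure R) (n : nat).
Notation V := 'rV[R]_n.+1.
Implicit Types (x y w G : V) (X : set V).

Let e_ (i : 'I_n.+1) : V := delta_mx 0 i.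

Let enorm_e i : enorm (e_ i) = 1.
Proof. by apply/enorm1P; rewrite dot_deltar mxE !eqxx. Qed.

Let is_derive_line (h : V -> R) (G : V -> V) y i s :
  differentiable h (y + s *: e_ i) ->
  (forall w, 'd h (y + s *: e_ i) w = dot w (G (y + s *: e_ i))) ->
  is_derive s 1 (fun t => h (y + t *: e_ i)) (G (y + s *: e_ i) 0 i).
Proof.
move=> dh hG; have dc := affine_differentiable y (e_ i) s.
have dhc := differentiable_comp dc dh.
split; first by apply/derivable1_diffP.
rewrite -derive1E derive1E'//.
have := diff_comp dc dh => /(congr1 (fun f => f 1)) /= E.
apply: (etrans E); rewrite hG.
have <- : derive1 (fun t : R => y + t *: e_ i) s = 'd (fun t : R => y + t *: e_ i) s 1.
  exact: derive1E'.
by rewrite affine_derive1 dotC dot_deltar.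
Qed.

Let segment_eball x y i s c r : 0 <= c <= s ->
  enorm (y - x) < r -> enorm (y + s *: e_ i - x) < r -> enorm (y + c *: e_ i - x) < r.
Proof.
move=> /andP[c0 cs] yr sr; have [s0|s0] := ltP 0 s; last first.
  have -> : c = 0 by lra.
  by rewrite scale0r addr0.
pose l := c / s; have l0 : 0 <= l by rewrite divr_ge0// ltW.
have l1 : l <= 1 by rewrite ler_pdivrMr// mul1r.
have -> : y + c *: e_ i - x = (1 - l) *: (y - x) + l *: (y + s *: e_ i - x).
  have -> : c = l * s by rewrite /l divfK// gt_eqF.
  apply/rowP => j; rewrite !mxE; ring.
apply: le_lt_trans (ler_enormD _ _) _; rewrite !enormZ !ger0_norm ?subr_ge0//.
have [l00|l00] := eqVneq l 0; first by rewrite l00; lra.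
have {}l00 : 0 < l by rewrite lt_neqAle eq_sym l00.
have A1 : (1 - l) * enorm (y - x) <= (1 - l) * r by apply: ler_wpM2l; [rewrite subr_ge0|apply: ltW].
have A2 : l * enorm (y + s *: e_ i - x) < l * r by rewrite ltr_pM2l.
lra.
Qed.

(** Let [h = 0] be a local equation of the closure of [X], with nonzero partial
    derivative in direction [i]. The lines in that direction each meet the
    closure exactly once near [x], so the set of base points of lines meeting [X]
    itself is definable and dense; it contains a ball, over which [X] and its
    closure agree. *)
Lemma locally_closed_dense X x d : dset S X -> C1_submanifold_at n (closure X) x -> 0 < d ->
  exists q W, [/\ X q, enorm (q - x) < d, open W, W q &
    forall p, W p -> closure X p -> X p].
Proof.
move=> dX CX d0; have [_ Xx _] := CX.
have [U [h [G [oU Ux HU hA _]]]] := hypersurface_chart CX.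
have hx : h x = 0 by apply/(hA x Ux).
have [_ _ G0 cG] := HU x Ux.
have [i Gi0] : exists i, G x 0 i != 0.
  apply: contrapT => /forallNP H; move/negP: G0; apply; apply/eqP/rowP => i.
  by rewrite mxE; apply/eqP; have /negP := H i; rewrite negbK.
set s := G x 0 i in Gi0.
have [r [r0 rd rU rs]] : exists r, [/\ 0 < r, r <= d, forall y, enorm (y - x) < r -> U y &
    forall y, enorm (y - x) < r -> 0 < G y 0 i * s].
  have /nbhs_enormP[a a0 aU] : nbhs x U by apply: open_nbhs_nbhs.
  have s1 : 0 < `|s| by rewrite normr_gt0.
  have /cG/nbhs_enormP[b b0 bG] : nbhs (G x) [set z | enorm (z - G x) < `|s|].
    by apply/nbhs_enormP; exists `|s|.
  exists (Num.min d (Num.min a b)); split.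
  - by rewrite !lt_min d0 a0.
  - by rewrite ge_min lexx.
  - by move=> y; rewrite !lt_min => /and3P[_ ya _]; apply: aU.
  move=> y; rewrite !lt_min => /and3P[_ _ /bG /= yb].
  have E : (G y - G x) 0 i = G y 0 i - s by rewrite !mxE.
  have := le_lt_trans (normr_coord_le _ i) yb; rewrite E.
  have [sp|sn|s0] := ltgtP 0 s; last by rewrite -s0 eqxx in Gi0.
    by rewrite (gtr0_norm sp) ltr_norml => /andP[? _]; apply: mulr_gt0; lra.
  rewrite (ltr0_norm sn) ltr_norml => /andP[_ ?].
  have yn : G y 0 i < 0 by lra.
  by rewrite -mulrNN mulr_gt0; lra.
have mono y t : 0 < t -> enorm (y - x) < r -> enorm (y + t *: e_ i - x) < r ->
    0 < (h (y + t *: e_ i) - h y) * s.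
  move=> t0 y1 y2.
  have der c : 0 <= c <= t ->
      is_derive c 1 (fun t => h (y + t *: e_ i)) (G (y + c *: e_ i) 0 i).
    move=> ct; have [dh hG _ _] := HU _ (rU _ (segment_eball ct y1 y2)).
    exact: is_derive_line.
  have [||c] := @MVT R (fun t => h (y + t *: e_ i)) (fun c => G (y + c *: e_ i) 0 i) 0 t t0.
  - by move=> c; rewrite in_itv /= => ct; apply: der; lra.
  - apply: derivable_within_continuous => c; rewrite in_itv /= => /der[].
    by [].
  rewrite in_itv /= => ct; rewrite scale0r addr0 subr0 => ->.
  rewrite mulrAC; apply: mulr_gt0 => //; apply: rs.
  by apply: (segment_eball _ y1 y2); lra.
pose t0 := r / 4; have t00 : 0 < t0 by rewrite /t0; lra.
have xe c : `|c| < r -> enorm (x + c *: e_ i - x) < r.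
  by rewrite addrAC subrr add0r enormZ enorm_e mulr1.
have hp : 0 < h (x + t0 *: e_ i) * s.
  have := mono x t0 t00; rewrite hx subr0; apply.
    by rewrite subrr enorm0.
  by apply: xe; rewrite gtr0_norm// /t0; lra.
have hm : h (x - t0 *: e_ i) * s < 0.
  have := mono (x - t0 *: e_ i) t0 t00; rewrite subrK hx sub0r mulNr oppr_gt0; apply.
    by rewrite -scaleNr; apply: xe; rewrite normrN gtr0_norm// /t0; lra.
  by rewrite subrr enorm0.
(* Above and below [x] in direction [i], the equation has opposite signs; this
   persists for base points near [x], so their lines meet the closure. *)
have pos_near z k : U z -> 0 < h z * k ->
    exists2 a, 0 < a & forall y, enorm (y - z) < a -> 0 < h y * k.
  move=> Uz hk; have [dh _ _ _] := HU z Uz.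
  have op : open [set t : R | 0 < t * k].
    apply: (@open_comp _ _ (fun t : R => t * k) [set t | 0 < t]); last exact: open_gt.
    by move=> t _; apply: mulrr_continuous.
  have nh : nbhs (h z) [set t : R | 0 < t * k] by apply: open_nbhs_nbhs.
  by have /nbhs_enormP[a a0 Ha] := differentiable_continuous dh nh; exists a.
have Up c : `|c| < r -> U (x + c *: e_ i) by move=> /xe/rU.
have t0r : `|t0| < r by rewrite gtr0_norm// /t0; lra.
have [a a0 Ha] := pos_near _ s (Up _ t0r) hp.
have hm' : 0 < h (x + (- t0) *: e_ i) * (- s) by rewrite scaleNr mulrN oppr_gt0.
have mt0r : `|- t0| < r by rewrite normrN.
have [b b0 Hb] := pos_near _ (- s) (Up _ mt0r) hm'.
pose d' := Num.min (r / 4) (Num.min a b).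
have d'0 : 0 < d' by rewrite !lt_min a0 b0 !andbT; lra.
have d'r : d' <= r / 4 by rewrite ge_min lexx.
have d'a : d' <= a by rewrite !ge_min lexx orbT.
have d'b : d' <= b by rewrite !ge_min lexx !orbT.
have ball_line y c : enorm (y - x) < r / 4 -> `|c| <= r / 2 -> enorm (y + c *: e_ i - x) < r.
  move=> yx ct; rewrite addrAC; apply: le_lt_trans (ler_enormD _ _) _.
  rewrite enormZ enorm_e mulr1; lra.
have lineE y : enorm (y - x) < d' -> exists2 c, `|c| <= t0 & closure X (y + c *: e_ i).
  move=> yx; have yr : enorm (y - x) < r / 4 by apply: lt_le_trans yx d'r.
  pose k c := h (y + c *: e_ i) * s.
  have kp : 0 < k t0.
    apply: Ha; have -> : y + t0 *: e_ i - (x + t0 *: e_ i) = y - x.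
      by rewrite opprD addrACA subrr addr0.
    exact: lt_le_trans yx d'a.
  have km : k (- t0) < 0.
    have : 0 < h (y + (- t0) *: e_ i) * (- s).
      apply: Hb; have -> : y + (- t0) *: e_ i - (x + (- t0) *: e_ i) = y - x.
        by rewrite opprD addrACA subrr addr0.
      exact: lt_le_trans yx d'b.
    by rewrite mulrN oppr_gt0.
  have t0r4 : t0 <= r / 2 by rewrite /t0; lra.
  have kc : {within `[- t0, t0], continuous k}.
    apply: derivable_within_continuous => c; rewrite in_itv /= => hc.
    have Uc : U (y + c *: e_ i).
      by apply/rU/ball_line => //; rewrite ler_norml; lra.
    have [dh hG _ _] := HU _ Uc.
    have [D _] := is_derive_line dh hG.
    exact: (derivableM D (derivable_cst s _ _)).
  have [|||c] := @IVT R k (- t0) t0 0.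
  - by lra.
  - exact: kc.
  - by rewrite ge_min le_max (ltW kp) (ltW km) orbT.
  rewrite in_itv /= => hc kc0; have ct : `|c| <= t0 by rewrite ler_norml; lra.
  exists c => //; apply/hA; first by apply/rU/ball_line => //; lra.
  by move/eqP: kc0; rewrite mulf_eq0 (negbTE Gi0) orbF => /eqP.
pose E y := exists c, `|c| < r / 2 /\ X (y + c *: e_ i).
have dE : dset S E by rewrite /E; definability.
have [W0 [oW0 [y0 W0y0] W0d' W0E]] : exists W0, [/\ open W0, W0 !=set0,
    W0 `<=` [set y | enorm (y - x) < d'] & W0 `<=` E].
  apply: (definable_dense dE).
  - exact: open_eball.
  - by exists x; rewrite /= subrr enorm0.
  move=> y /= yd; have [c ct /closure_enormP Hc] := lineE y yd.
  apply/closure_enormP => e e0; have [p Xp pe] := Hc e e0.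
  exists (p - c *: e_ i); last by rewrite addrAC -addrA -opprD.
  by exists c; rewrite subrK; split=> //; rewrite /t0 in ct; lra.
have [c [cr Xq]] := W0E _ W0y0.
have W0r y : W0 y -> enorm (y - x) < r / 4 by move=> /W0d' /= H; apply: lt_le_trans H d'r.
pose q := y0 + c *: e_ i.
have tr : continuous (fun p : V => p - c *: e_ i).
  move=> p A /nbhs_enormP[z z0 zA].
  apply: (nbhs_enormP p ((fun p => p - c *: e_ i) @^-1` A)).2; exists z => // w wp.
  by apply: zA; rewrite opprB addrA subrK.
exists q, ((fun p => p - c *: e_ i) @^-1` W0); split=> //.
- apply: lt_le_trans rd; apply: ball_line; [exact: W0r|exact: ltW].
- by apply: open_comp => // p _; apply: tr.
- by rewrite /= /q addrK.
move=> p /= W0p Xbp; have [c' [c'r Xp']] := W0E _ W0p.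
set y := p - c *: e_ i in W0p Xp'.
have yr := W0r _ W0p.
have pE : p = y + c *: e_ i by rewrite subrK.
have B1 : enorm (y + c *: e_ i - x) < r by apply: ball_line => //; apply: ltW.
have B2 : enorm (y + c' *: e_ i - x) < r by apply: ball_line => //; apply: ltW.
have h1 : h (y + c *: e_ i) = 0 by apply/hA; [exact: rU|rewrite -pE].
have h2 : h (y + c' *: e_ i) = 0.
  by apply/hA; [exact: rU|exact: subset_closure].
(* A line meets the closure only once, by monotonicity of the equation. *)
have strict u v : u < v -> enorm (y + u *: e_ i - x) < r -> enorm (y + v *: e_ i - x) < r ->
    h (y + u *: e_ i) = 0 -> h (y + v *: e_ i) = 0 -> False.
  move=> uv Bu Bv hu hv; have vu : 0 < v - u by lra.
  have vE : y + v *: e_ i = y + u *: e_ i + (v - u) *: e_ i.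
    by apply/rowP => j; rewrite !mxE; ring.
  have := mono (y + u *: e_ i) (v - u) vu Bu; rewrite -vE hu hv subrr mul0r ltxx.
  by move=> /(_ Bv).
have [cc|cc|cc] := ltgtP c c'.
- by case: (strict c c').
- by case: (strict c' c).
by rewrite pE cc.
Qed.

End LocallyClosed.

(** * The Nash fiber in terms of normals *)

Section NearRay.
Variables (R : realType) (n : nat) (e : 'rV[R]_n).
Hypothesis e1 : enorm e = 1.

(** Conic neighbourhoods of the ray spanned by the unit vector [e], cut off at
    scale [eps]. The scale [t] is kept as a parameter, which is what the
    one-variable dichotomy is applied to later. *)
Definition near_ray eps (x : 'rV[R]_n) : Prop :=
  exists t, (0 < t /\ t < eps) /\ enorm (x - t *: e) < eps * t.

Lemma near_ray_le eps eps' x : eps <= eps' -> near_ray eps x -> near_ray eps' x.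
Proof.
move=> le [t [[t0 te] xt]]; exists t; split; first by split=> //; apply: lt_le_trans te le.
by apply: lt_le_trans xt _; rewrite ler_pM2r.
Qed.

Lemma open_near_ray eps : open [set x | near_ray eps x].
Proof.
rewrite openE => x [t [ht xt]].
have := @open_eball R n (t *: e) (eps * t); rewrite openE => /(_ x xt).
by apply: filterS => y yt; exists t.
Qed.

Lemma near_ray_norm eps x : eps <= 1 -> near_ray eps x ->
  [/\ x != 0, enorm x < 2 * eps & enorm ((enorm x)^-1 *: x - e) < 2 * eps].
Proof.
move=> eps1 [t [[t0 te] xt]].
have nt : enorm (t *: e) = t by rewrite enormZ e1 mulr1 gtr0_norm.
have et : eps * t <= 1 * t by rewrite ler_pM2r.
have x0 : x != 0.
  by apply/negP => /eqP E; move: xt; rewrite E sub0r enormN nt; lra.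
have ex0 := enorm_gt0 x0.
split=> //.
  have := ler_enorm_dist x (t *: e) 0; rewrite !subr0 nt; lra.
pose y := t^-1 *: x.
have yE : enorm y = t^-1 * enorm x by rewrite enormZ normfV gtr0_norm.
have -> : (enorm x)^-1 *: x = (enorm y)^-1 *: y.
  by rewrite yE /y scalerA invfM invrK mulrAC mulfV ?mul1r// gt_eqF.
apply: le_lt_trans (normalize_dist e1 _) _.
  by rewrite yE mulf_neq0// ?invr_eq0 gt_eqF.
rewrite ltr_pM2l//.
have -> : y - e = t^-1 *: (x - t *: e) by rewrite scalerBr scalerA mulVf ?scale1r// gt_eqF.
by rewrite enormZ normfV gtr0_norm// mulrC ltr_pdivrMr.
Qed.

Lemma near_rayI eps x : x != 0 -> enorm x < eps ->
  enorm ((enorm x)^-1 *: x - e) < eps -> near_ray eps x.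
Proof.
move=> x0 xe xd; have ex0 := enorm_gt0 x0; exists (enorm x); split=> //.
have -> : x - enorm x *: e = enorm x *: ((enorm x)^-1 *: x - e).
  by rewrite scalerBr scalerA mulfV ?scale1r// gt_eqF.
by rewrite enormZ gtr0_norm// mulrC ltr_pM2r.
Qed.

End NearRay.

Section NashFiber.
Variables (R : realType) (S : omin_structure R) (n : nat).
Variables (X : set 'rV[R]_n.+1) (v : 'rV[R]_n.+1).
Hypotheses (n_gt0 : (0 < n)%N) (dX : dset S X) (pureX : pure_dim_at X n 0).
Hypotheses (v0 : v != 0) (v_reg : ~ tangent_cone (sing (closure X)) 0 v).

Let e := (enorm v)^-1 *: v.

Let e1 : enorm e = 1.
Proof. by apply: normalize_unit; rewrite gt_eqF// enorm_gt0. Qed.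

(** Singular points of the closure in every conic neighbourhood of the ray would,
    rescaled, put [v] in their tangent cone. *)
Lemma regular_cone : exists2 eps, 0 < eps &
  forall x, closure X x -> near_ray e eps x -> reg (closure X) x.
Proof.
apply: contrapT => H; apply: v_reg.
have ex (k : nat) : exists xt : 'rV[R]_n.+1 * R,
    sing (closure X) xt.1 /\ (0 < xt.2 /\ xt.2 < k.+1%:R^-1) /\
    enorm (xt.1 - xt.2 *: e) < k.+1%:R^-1 * xt.2.
  apply: contrapT => K; apply: H; exists k.+1%:R^-1; first by rewrite invr_gt0 ltr0Sn.
  move=> x Xx [t ht]; apply: contrapT => nr; apply: K; exists (x, t).
  by split.
have [f Hf] := choice ex.
have vn := enorm_gt0 v0.
exists (fun k => (f k).1), (fun k => enorm v / (f k).2); split.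
- by move=> k; have [? [[? _] _]] := Hf k; split=> //; apply: divr_gt0.
- apply/cvg_enormP => d d0; have d2 : 0 < d / 2 by lra.
  have [N HN] := inv_succ_lt d2; exists N => k /HN kd.
  have [_ [[t0 tk] xt]] := Hf k; rewrite subr0.
  have := ler_enorm_dist (f k).1 ((f k).2 *: e) 0; rewrite !subr0.
  rewrite (enormZ (f k).2) e1 mulr1 gtr0_norm//.
  have k1 : k.+1%:R^-1 <= 1 :> R by rewrite invf_le1 ?ltr0Sn// ler1n.
  move: kd tk xt k1; move: (k.+1%:R^-1) => c kd tk xt c1.
  have : c * (f k).2 <= 1 * (f k).2 by rewrite ler_pM2r.
  lra.
- apply/cvg_enormP => d d0; have d2 : 0 < d / enorm v by rewrite divr_gt0.
  have [N HN] := inv_succ_lt d2; exists N => k /HN kd.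
  have [_ [[t0 tk] xt]] := Hf k; rewrite subr0.
  have -> : enorm v / (f k).2 *: (f k).1 - v = (enorm v / (f k).2) *: ((f k).1 - (f k).2 *: e).
    rewrite scalerBr; congr (_ - _); rewrite /e !scalerA divfK ?gt_eqF//.
    by rewrite mulfV ?scale1r// gt_eqF.
  rewrite enormZ gtr0_norm; last by rewrite divr_gt0.
  rewrite mulrAC ltr_pdivrMr//.
  apply: lt_trans (_ : enorm v * (k.+1%:R^-1 * (f k).2) < _); first by rewrite ltr_pM2l.
  rewrite mulrA ltr_pM2r// mulrC -ltr_pdivlMr//.
Qed.

(** The closure of [X] is a hypersurface along the ray: its local dimension [d]
    cannot exceed [n], for then [X] would be dense in an open set and so contain
    one, and is not below [n], for it contains [n]-dimensional submanifolds. *)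
Lemma hypersurface_cone : exists2 eps, 0 < eps <= 1 &
  forall x, closure X x -> near_ray e eps x -> C1_submanifold_at n (closure X) x.
Proof.
have [eps eps0 Heps] := regular_cone.
have [_ [U0 [oU0 U00 pureU0]]] := pureX.
have /nbhs_enormP[r r0 rU0] : nbhs (0 : 'rV[R]_n.+1) U0 by apply: open_nbhs_nbhs.
pose eps' := Num.min eps (Num.min 1 (r / 2)).
have l1 : eps' <= eps by rewrite ge_min lexx.
have l2 : eps' <= 1 by rewrite !ge_min lexx orbT.
have l3 : eps' <= r / 2 by rewrite !ge_min lexx !orbT.
exists eps'; first by rewrite l2 andbT !lt_min eps0 ltr01; lra.
move=> x Xx nx; have [d CX] := Heps x Xx (near_ray_le l1 nx).
have U0x : U0 x.
  apply: rU0; rewrite subr0; have [_ xr _] := near_ray_norm e1 l2 nx; lra.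
have dn1 : (d <= n.+1)%N by case: CX.
have [U [phi [oU Ux _ AP AT]]] := submanifold_chart CX.
have [y [Xy [Uy U0y]]] : (X `&` (U `&` U0)) !=set0.
  by apply: Xx; apply: open_nbhs_nbhs; split; [apply: openI|].
(* [d = n.+1] would make [X] dense in an open set. *)
have dle : (d <= n)%N.
  rewrite -ltnS ltn_neqAle dn1 andbT; apply/negP => /eqP E.
  have UX : U `&` U0 `<=` closure X.
    by move=> z [Uz _]; apply/(AP z Uz) => i; rewrite E leqNgt ltn_ord.
  have [W [oW [z Wz] WU WX]] : exists W, [/\ open W, W !=set0, W `<=` U `&` U0 & W `<=` X].
    by apply: (definable_dense dX) => //; [apply: openI|exists y].
  have [|[W' [oW' W'z dW']] _] := pureU0 z.
    by split; [apply: WX|case: (WU _ Wz)].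
  have : (n.+1 <= Defs.dim (X `&` W'))%N.
    apply: (@leq_dim _ _ _ _ (W `&` W')).
    - by exists z.
    - by apply: open_submanifold; apply: openI.
    - by move=> t [/WX ? ?].
  by rewrite dW' ltnn.
(* Tangent spaces of an [n]-dimensional submanifold of [X] embed in those of the
   closure. *)
suff nd : (n <= d)%N.
  have E : d = n by apply/eqP; rewrite eqn_leq nd dle.
  by rewrite E in CX.
have [_ locy] := pureU0 y (conj Xy U0y).
have [d' [M [nd' [m Mm] CM MX]]] := dim_witness n_gt0 (locy U oU Uy).
apply: leq_trans nd' _.
have [Xm Um] := MX m Mm.
have [CXm _] := AT m Um (subset_closure Xm).
have [T [rT HT]] := tangent_rank CXm; have [T' [rT' HT']] := tangent_rank (CM m Mm).
rewrite -rT -rT'; apply: mxrankS; apply/row_subP => i; apply/HT.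
apply: (@tangent_vector_sub _ _ M); first by move=> t /MX[/subset_closure].
by apply/HT'; apply: row_sub.
Qed.

(** The unit normals of the limit hyperplanes, described without sequences by a
    first-order formula about the closure of [X]. *)
Definition nash_normals : set 'rV[R]_n.+1 := [set nu | enorm nu = 1 /\
  forall eps, 0 < eps -> exists x, (closure X x /\ near_ray e eps x) /\
    exists mu, (enorm mu = 1 /\ enorm (mu - nu) < eps) /\
               secant_normal (closure X) x mu].

(** The formula speaks of the closure, the Nash fiber of regular points of [X]:
    near any point of the closure there are points where both sets agree, with
    almost the same tangent hyperplane. *)
Lemma nash_normals_approx nu eps : nash_normals nu -> 0 < eps ->
  exists (x : 'rV[R]_n.+1) (T : grassmannian R n n.+1),
    [/\ reg X x, near_ray e eps x, is_tangent_space X x (val T) &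
        exists mu, is_normal (val T) mu /\ enorm (mu - nu) < eps].
Proof.
have [eps0 /andP[eps00 _] Hc] := hypersurface_cone.
move=> [nu1 Hnu] eps_gt0.
have m0 : 0 < Num.min eps0 (eps / 2) by rewrite lt_min eps00 divr_gt0.
have [x [[Xx nx] [mu [[mu1 dmu] sn]]]] := Hnu _ m0.
have CX : C1_submanifold_at n (closure X) x.
  by apply: Hc => //; apply: near_ray_le nx; rewrite ge_min lexx.
have {}nx : near_ray e eps x.
  by apply: near_ray_le nx; rewrite ge_min; apply/orP; right; lra.
have {}dmu : enorm (mu - nu) < eps / 2.
  by apply: lt_le_trans dmu _; rewrite ge_min lexx orbT.
have Hmu : unit_normal (closure X) x mu by apply/(secant_normalP CX mu1).
have eps2 : 0 < eps / 2 by lra.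
have [d1 d10 Hd1] := unit_normal_continuous CX Hmu eps2.
have /nbhs_enormP[d2 d20 Hd2] : nbhs x [set x | near_ray e eps x].
  by apply: open_nbhs_nbhs; split=> //; apply: open_near_ray.
have d0 : 0 < Num.min d1 d2 by rewrite lt_min d10.
have [q [W [Xq qx oW Wq WX]]] := locally_closed_dense dX CX d0.
have qx1 : enorm (q - x) < d1 by apply: lt_le_trans qx _; rewrite ge_min lexx.
have qx2 : enorm (q - x) < d2 by apply: lt_le_trans qx _; rewrite ge_min lexx orbT.
have [CXq [mu' [Hmu' dmu']]] := Hd1 q (subset_closure Xq) qx1.
have [T HT] := @hyperplane_exists _ n.+1 mu' Hmu'.1.
exists q, T; split.
- exists n; apply: (C1_submanifold_at_local oW Wq _ CXq) => y Wy.
  by split; [apply: WX|apply: subset_closure].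
- exact: Hd2.
- move=> w; apply: (iff_trans (HT.2 w)); apply: (iff_trans (iff_sym (Hmu'.2 w))); split.
    by apply: (tangent_vector_local oW Wq).
  by apply: tangent_vector_sub; apply: subset_closure.
- exists mu'; split=> //.
  have := ler_enorm_dist mu' mu nu; lra.
Qed.

Lemma regular_unit_normal x (T : grassmannian R n n.+1) mu :
  C1_submanifold_at n (closure X) x -> is_tangent_space X x (val T) ->
  is_normal (val T) mu -> unit_normal (closure X) x mu.
Proof.
move=> CX HT Hmu; have [mu0 Hmu0] := unit_normal_exists CX.
have [T0 HT0] := @hyperplane_exists _ n.+1 mu0 Hmu0.1.
have E : val T = val T0.
  apply/eqP; rewrite eqEdim (eqP (valP T)) (eqP (valP T0)) leqnn andbT.
  apply/subvP => w /HT tw; apply/HT0.2/Hmu0.2.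
  by apply: tangent_vector_sub tw; apply: subset_closure.
split; first exact: Hmu.1.
move=> w; apply: (iff_trans (Hmu0.2 w)); apply: (iff_trans (iff_sym (HT0.2 w))).
by rewrite -E; apply: Hmu.2.
Qed.

Lemma nash_fiberP (P : grassmannian R n n.+1) nu : is_normal (val P) nu ->
  (nash_fiber X v P <-> nash_normals nu).
Proof.
move=> HP; split; last first.
  move=> Hnu.
  have ex (k : nat) : exists xT : 'rV[R]_n.+1 * grassmannian R n n.+1,
      [/\ reg X xT.1, near_ray e k.+1%:R^-1 xT.1, is_tangent_space X xT.1 (val xT.2) &
        exists mu, is_normal (val xT.2) mu /\ enorm (mu - nu) < k.+1%:R^-1].
    have k0 : 0 < k.+1%:R^-1 :> R by rewrite invr_gt0 ltr0Sn.
    by have [x [T H]] := nash_normals_approx Hnu k0; exists (x, T).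
  have [f Hf] := choice ex.
  have k1 (k : nat) : k.+1%:R^-1 <= 1 :> R by rewrite invf_le1 ?ltr0Sn// ler1n.
  exists (fun k => (f k).1), (fun k => (f k).2); split.
  - move=> k; have [rk nk tk _] := Hf k; split=> //.
    by have [] := near_ray_norm e1 (k1 k) nk.
  - apply/cvg_enormP => d d0; have d2 : 0 < d / 2 by lra.
    have [N HN] := inv_succ_lt d2; exists N => k /HN kd.
    have [_ nk _ _] := Hf k; have [_ xk _] := near_ray_norm e1 (k1 k) nk.
    rewrite subr0; apply: lt_trans xk _; move: kd; move: (k.+1%:R^-1) => c; lra.
  - apply/cvg_enormP => d d0; have d2 : 0 < d / 2 by lra.
    have [N HN] := inv_succ_lt d2; exists N => k /HN kd.
    have [_ nk _ _] := Hf k; have [_ _ xk] := near_ray_norm e1 (k1 k) nk.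
    apply: lt_trans xk _; move: kd; move: (k.+1%:R^-1) => c; lra.
  - apply/(grass_cvgP (ltn0Sn n) _ HP) => d d0.
    have [N HN] := inv_succ_lt d0; exists N => k /HN kd.
    have [_ _ _ [mu [Hmu dmu]]] := Hf k; exists mu; split=> //.
    exact: lt_trans dmu kd.
move=> [u [T [Hu /cvg_enormP u0 /cvg_enormP ue /(grass_cvgP (ltn0Sn n) _ HP) TP]]].
split; first exact: HP.1.
move=> eps eps_gt0; have [eps0 /andP[eps00 _] Hc] := hypersurface_cone.
pose m := Num.min eps0 eps.
have m0 : 0 < m by rewrite lt_min eps00.
have mle0 : m <= eps0 by rewrite ge_min lexx.
have mle : m <= eps by rewrite ge_min lexx orbT.
have [N1 H1] := u0 _ m0; have [N2 H2] := ue _ m0; have [N3 H3] := TP _ eps_gt0.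
pose k := maxn N1 (maxn N2 N3).
have {H1} uk1 : enorm (u k - 0) < m by apply: H1; rewrite leq_maxl.
have {H2} uk2 : enorm ((enorm (u k))^-1 *: u k - e) < m.
  by apply: H2; rewrite /k maxnCA leq_maxl.
have {H3} [mu [Hmu dmu]] : exists mu, is_normal (val (T k)) mu /\ enorm (mu - nu) < eps.
  by apply: H3; rewrite /k maxnA leq_maxr.
have [[d [_ Xu _]] un0 tT] := Hu k.
rewrite subr0 in uk1.
have nr := near_rayI un0 uk1 uk2.
have CX : C1_submanifold_at n (closure X) (u k).
  by apply: Hc; [apply: subset_closure|apply: near_ray_le nr].
exists (u k); split; first by split; [apply: subset_closure|apply: near_ray_le nr].
exists mu; split; first by split; [exact: Hmu.1|].
apply/(secant_normalP CX Hmu.1).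
exact: regular_unit_normal tT Hmu.
Qed.

Lemma closed_nash_normals : closed nash_normals.
Proof.
move=> nu /closure_enormP H; split.
  apply/eqP; rewrite eq_le; apply/andP; split; apply/ler_addgt0Pr => d /H[mu [mu1 _] dmu].
    by have := ler_dist_enorm mu nu; rewrite mu1 ler_norml; lra.
  by have := ler_dist_enorm mu nu; rewrite mu1 ler_norml; lra.
move=> eps eps0; have eps2 : 0 < eps / 2 by lra.
have [nu' [_ Hnu'] dnu'] := H _ eps2.
have [x [[Xx nx] [mu [[mu1 dmu] sn]]]] := Hnu' _ eps2.
exists x; split; first by split=> //; apply: near_ray_le nx; lra.
exists mu; split=> //; split=> //.
have := ler_enorm_dist mu nu' nu; lra.
Qed.

Lemma compact_nash_normals : compact nash_normals.
Proof.
apply: (@compact_eball _ _ 0 1); first exact: closed_nash_normals.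
by move=> nu [nu1 _]; rewrite subr0 nu1.
Qed.

End NashFiber.

(** * Distance between hypersurfaces *)

Section FiniteNets.
Variables (R : realType) (n : nat).

Lemma finite_net (K : set 'rV[R]_n) (r : 'rV[R]_n -> R) : compact K ->
  (forall k, K k -> 0 < r k) ->
  exists s : seq 'rV[R]_n, (forall k, k \in s -> K k) /\
    forall x, K x -> exists2 k, k \in s & enorm (x - k) < r k.
Proof.
move=> cK r0; move: cK; rewrite compact_cover.
move=> /(_ _ K (fun k => [set x | enorm (x - k) < r k])).
case.
- by move=> k _; apply: open_eball.
- by move=> x Kx; exists x => //=; rewrite subrr enorm0 r0.
move=> D DK KD; exists (finmap.enum_fset D); split.
  by move=> k kD; apply/set_mem/DK.
by move=> x /KD[k kD xk]; exists k.
Qed.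

Lemma seq_lower_bound (s : seq 'rV[R]_n) (r : 'rV[R]_n -> R) :
  (forall k, k \in s -> 0 < r k) -> exists2 m, 0 < m & forall k, k \in s -> m <= r k.
Proof.
elim: s => [|a s IH] H; first by exists 1.
have [|m m0 Hm] := IH; first by move=> k ks; apply: H; rewrite in_cons ks orbT.
exists (Num.min m (r a)); first by rewrite lt_min m0 H// mem_head.
move=> k; rewrite in_cons => /orP[/eqP->|/Hm mk]; first by rewrite ge_min lexx orbT.
by rewrite ge_min mk.
Qed.

Lemma closed_sphere : closed [set x : 'rV[R]_n | enorm x = 1].
Proof.
apply: (@closed_comp _ _ (@enorm R n) [set t | t = 1]); last exact: closed_eq.
by move=> x _; apply: continuous_enorm.
Qed.

Lemma compact_sphere : compact [set x : 'rV[R]_n | enorm x = 1].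
Proof.
apply: (@compact_eball _ _ 0 1); first exact: closed_sphere.
by move=> x /= x1; rewrite subr0 x1.
Qed.

Lemma compact_separation (K L : set 'rV[R]_n) : compact K -> closed L ->
  (forall x, K x -> ~ L x) ->
  exists2 m, 0 < m & forall x y, K x -> L y -> m <= enorm (x - y).
Proof.
move=> cK cL KL.
have ex x : exists d, K x -> 0 < d /\ forall y, L y -> 2 * d <= enorm (x - y).
  have [Kx|nKx] := pselect (K x); last by exists 0.
  have /closed_openC := cL; rewrite openE => /(_ x (KL x Kx)) /nbhs_enormP[d d0 Hd].
  exists (d / 2) => _; split; first by lra.
  move=> y Ly; rewrite leNgt; apply/negP => xy.
  by apply: (Hd y) => //; rewrite enormB; lra.
have [r Hr] := choice ex.
have [|s [sK sc]] := @finite_net K r cK; first by move=> k /Hr[].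
have [|m m0 Hm] := @seq_lower_bound s r; first by move=> k /sK/Hr[].
exists m => // x y /sc[k ks xk] Ly.
have [_ /(_ y Ly) ky] := Hr k (sK k ks); have mk := Hm k ks.
have := ler_enorm_dist k x y; rewrite (enormB k x); lra.
Qed.

End FiniteNets.

Lemma penalty_continuous (R : realType) n (a : 'rV[R]_n) (k : R) :
  continuous (fun p : 'rV[R]_n * 'rV[R]_n =>
    enorm (p.1 - p.2) + k * (enorm (p.1 - a) ^+ 2 + enorm (p.2 - a) ^+ 2)).
Proof.
have ca : continuous (fun x : 'rV[R]_n => enorm (x - a)).
  move=> x B /nbhs_ballP[e /= e0 eB].
  apply: (nbhs_enormP x ((fun x => enorm (x - a)) @^-1` B)).2; exists e => // y yx.
  apply: eB; rewrite /ball /=; apply: le_lt_trans (ler_dist_enorm _ _) _.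
  by rewrite opprB addrA subrK enormB.
move=> p.
have c1 : {for p, continuous (fun p : 'rV[R]_n * 'rV[R]_n => enorm (p.1 - a))}.
  by apply: (@continuous_comp _ _ _ fst (fun x : 'rV[R]_n => enorm (x - a))); [apply: cvg_fst|apply: ca].
have c2 : {for p, continuous (fun p : 'rV[R]_n * 'rV[R]_n => enorm (p.2 - a))}.
  by apply: (@continuous_comp _ _ _ snd (fun x : 'rV[R]_n => enorm (x - a))); [apply: cvg_snd|apply: ca].
have c3 : {for p, continuous (fun p : 'rV[R]_n * 'rV[R]_n => enorm (p.1 - p.2))}.
  apply: (@continuous_comp _ _ _ (fun p : 'rV[R]_n * 'rV[R]_n => p.1 - p.2) (@enorm R n)).
    exact: sub_continuous.
  exact: continuous_enorm.
exact: (cvgD c3 (cvgM (cvg_cst k) (cvgD (cvgM c1 c1) (cvgM c2 c2)))).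
Qed.

Section PenalizedDistance.
Variables (R : realType) (n : nat) (A : set 'rV[R]_n.+1).
Implicit Types (x y p z w : 'rV[R]_n.+1).

Lemma dot_sqrD z w : dot (z + w) (z + w) = dot z z + 2 * dot z w + dot w w.
Proof. by rewrite dotDl !dotDr (dotC w z); ring. Qed.

(** Tangent line estimate for the square root, in the form [2ab <= a^2 + b^2]. *)
Lemma enorm_expand x y w : 0 < enorm (x - y) ->
  enorm (x + w - y) <= enorm (x - y) + dot ((enorm (x - y))^-1 *: (x - y)) w
     + dot w w / (2 * enorm (x - y)).
Proof.
set d := enorm (x - y) => d0.
have E : enorm (x + w - y) ^+ 2 = d ^+ 2 + 2 * dot (x - y) w + dot w w.
  by rewrite /d (addrAC x w (- y)) !enorm_sqr (dot_sqrD (x - y)).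
have : 2 * d * enorm (x + w - y) <= d ^+ 2 + enorm (x + w - y) ^+ 2.
  have := sqr_ge0 (d - enorm (x + w - y)); rewrite sqrrB; lra.
rewrite E dotZl => H.
have -> : d + d^-1 * dot (x - y) w + dot w w / (2 * d) =
   (d ^+ 2 + (d ^+ 2 + 2 * dot (x - y) w + dot w w)) / (2 * d) by field; lra.
by rewrite ler_pdivlMr ?mulr_gt0// mulrC.
Qed.

(** The gradient of the penalized distance at a minimum is exactly normal, and
    the penalty contributes only a small part of it. *)
Lemma penalized_min_normal x y p k d : C1_submanifold_at n A x ->
  0 < enorm (x - y) -> 0 < k -> 0 < d -> 4 * k * enorm (x - p) < 1 ->
  (forall z, A z -> enorm (z - x) < d ->
     enorm (x - y) + k * dot (x - p) (x - p) <= enorm (z - y) + k * dot (z - p) (z - p)) ->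
  exists mu, unit_normal A x mu /\
    enorm (mu - (enorm (x - y))^-1 *: (x - y)) <= 4 * k * enorm (x - p).
Proof.
move=> CA xy0 k0 d0 small Hmin.
set u := (enorm (x - y))^-1 *: (x - y).
have u1 : enorm u = 1 by apply: normalize_unit; rewrite gt_eqF.
pose q := u + (2 * k) *: (x - p).
have qu : enorm (q - u) = 2 * k * enorm (x - p).
  by rewrite /q addrAC subrr add0r enormZ gtr0_norm// mulr_gt0.
have q0 : 0 < enorm q.
  have := ler_enorm_dist u q 0; rewrite !subr0 u1 (enormB u q) qu; lra.
pose C := (2 * enorm (x - y))^-1 + k.
have C0 : 0 < C by rewrite addr_gt0// invr_gt0 mulr_gt0.
have first_order w : enorm w < d -> A (x + w) -> 0 <= dot q w + C * dot w w.
  move=> wd Axw; have := Hmin (x + w) Axw; rewrite addrAC subrr add0r => /(_ wd) H.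
  have H2 := enorm_expand w xy0.
  have E : dot (x + w - p) (x + w - p) = dot (x - p) (x - p) + 2 * dot (x - p) w + dot w w.
    by rewrite (addrAC x w (- p)) (dot_sqrD (x - p)).
  rewrite E in H; rewrite -/u in H2; rewrite /q /C (dotDl u) (dotZl (2 * k)).
  have -> : ((2 * enorm (x - y))^-1 + k) * dot w w =
     dot w w / (2 * enorm (x - y)) + k * dot w w by ring.
  lra.
have ge0 t : tangent_vector A x t -> 0 <= dot q t.
  move=> tt; apply/ler_addgt0Pr => e e0.
  pose M := enorm q + C * (enorm t + 1) + 1.
  have M0 : 0 < M.
    have := enorm_ge0 q; have : 0 <= C * (enorm t + 1) by apply: mulr_ge0; [exact: ltW|have := enorm_ge0 t; lra].
    rewrite /M; lra.
  pose a := Num.min 1 (Num.min d (e / M)).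
  have a0 : 0 < a by rewrite !lt_min ltr01 d0 divr_gt0.
  have a1 : a <= 1 by rewrite ge_min lexx.
  have ad : a <= d by rewrite !ge_min lexx orbT.
  have ae : a * M <= e by rewrite -ler_pdivlMr// !ge_min lexx !orbT.
  have [z [c [Az c0 zx zt]]] := tangent_approx tt a0.
  pose w := z - x.
  have wd : enorm w < d by apply: lt_le_trans zx ad.
  have Axw : A (x + w) by rewrite addrC subrK.
  have cw : c * enorm w <= enorm t + 1.
    rewrite -[c]gtr0_norm// -enormZ.
    have := ler_enorm_dist (c *: w) t 0; rewrite !subr0; lra.
  have H1 : dot q (c *: w - t) <= enorm q * a.
    apply: le_trans (dot_le_enorm _ _) _; by apply: ler_wpM2l; [exact: enorm_ge0|exact: ltW].
  have H2 : c * (C * dot w w) <= C * (enorm t + 1) * a.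
    have -> : c * (C * dot w w) = C * ((c * enorm w) * enorm w) by rewrite -enorm_sqr; ring.
    rewrite -(mulrA C (enorm t + 1) a) ler_pM2l//; apply: ler_pM => //; last exact: ltW.
      by apply: mulr_ge0; [exact: ltW|exact: enorm_ge0].
    exact: enorm_ge0.
  have H3 : 0 <= c * (dot q w + C * dot w w) by apply: mulr_ge0; [exact: ltW|exact: first_order].
  move: H1; rewrite dotBr dotZr => H1.
  have : a * M = enorm q * a + C * (enorm t + 1) * a + a by rewrite /M; ring.
  lra.
have [mu Hmu] := unit_normal_exists CA.
have orth w : dot w mu = 0 -> dot w q = 0.
  move=> wm; have tw : tangent_vector A x w by apply/Hmu.2.
  have tnw : tangent_vector A x (- w) by apply/Hmu.2; rewrite dotNl wm oppr0.
  have := ge0 _ tw; have := ge0 _ tnw; rewrite dotNr (dotC w); lra.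
pose mu' := (enorm q)^-1 *: q.
have mu'1 : enorm mu' = 1 by apply: normalize_unit; rewrite gt_eqF.
exists mu'; split.
  have orth' w : dot w mu = 0 -> dot w mu' = 0.
    by move=> /orth wq; rewrite /mu' dotZr wq mulr0.
  have [->|->] := parallel_unit Hmu.1 mu'1 orth'; first exact: Hmu.
  exact: unit_normalN.
apply: le_trans (normalize_dist u1 _) _; first by rewrite gt_eqF.
rewrite qu; lra.
Qed.

(** A shortest segment between two disjoint pieces of a hypersurface is normal to
    both at its ends. The penalty keeps the segment inside the ball of radius [r]
    around [p], and tilts each normal by at most [4 * k * r]. *)
Lemma close_sheets_normals (B : bool -> set 'rV[R]_n.+1) p r h k :
  0 < k -> h <= r -> 2 * h + 2 * k * h ^+ 2 < k * r ^+ 2 -> 4 * k * r < 1 ->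
  (forall x, A x -> enorm (x - p) <= r -> C1_submanifold_at n A x) ->
  (forall b, compact [set x | (A x /\ enorm (x - p) <= r) /\ B b x]) ->
  (forall b x, A x -> enorm (x - p) <= r -> B b x ->
     exists2 d, 0 < d & forall y, A y -> enorm (y - x) < d -> B b y) ->
  (forall x, B true x -> B false x -> False) ->
  (forall b, exists x, [/\ A x, B b x & enorm (x - p) <= h]) ->
  exists x y mu nu, [/\ B true x, B false y, unit_normal A x mu,
    unit_normal A y nu & enorm (mu + nu) <= 8 * k * r].
Proof.
move=> k0 hr hsmall kr CA cK oB disjB exB.
have [x0 [Ax0 Bx0 dx0]] := exB true; have [y0 [Ay0 By0 dy0]] := exB false.
have r0 : 0 <= r by apply: le_trans hr; apply: le_trans dx0; apply: enorm_ge0.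
pose K b := [set x | (A x /\ enorm (x - p) <= r) /\ B b x].
have Kx0 : K true x0 by split=> //; split=> //; apply: le_trans hr.
have Ky0 : K false y0 by split=> //; split=> //; apply: le_trans hr.
pose F (z : 'rV[R]_n.+1 * 'rV[R]_n.+1) :=
  enorm (z.1 - z.2) + k * (enorm (z.1 - p) ^+ 2 + enorm (z.2 - p) ^+ 2).
have KK0 : (K true `*` K false) !=set0 by exists (x0, y0).
have [|[x y]] := compact_EVT_min (f := F) KK0 (compact_setX (cK true) (cK false)).
  by apply: continuous_subspaceT; apply: penalty_continuous.
move=> /set_mem[/= [[Ax xr] Bx] [[Ay yr] By]] Hmin0.
have Hmin x' y' : K true x' -> K false y' -> F (x, y) <= F (x', y').
  by move=> Kx Ky; apply: Hmin0; apply: mem_set.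
(* The starting points beat the penalty on the boundary, so the minimum is inside. *)
have F0 : F (x, y) < k * r ^+ 2.
  apply: le_lt_trans (Hmin x0 y0 Kx0 Ky0) _; apply: le_lt_trans hsmall.
  have h0 : 0 <= h by apply: le_trans dx0; apply: enorm_ge0.
  have sqx : enorm (x0 - p) ^+ 2 <= h ^+ 2 by rewrite ler_pXn2r ?nnegrE ?enorm_ge0.
  have sqy : enorm (y0 - p) ^+ 2 <= h ^+ 2 by rewrite ler_pXn2r ?nnegrE ?enorm_ge0.
  rewrite /F /= -mulrA mulrCA; apply: lerD.
    by rewrite mulr_natl mulr2n; apply: le_trans (ler_enorm_dist _ p _) _;
      apply: lerD => //; rewrite enormB.
  by rewrite ler_pM2l// mulr_natl mulr2n; apply: lerD.
have inside z : k * enorm (z - p) ^+ 2 <= F (x, y) -> enorm (z - p) < r.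
  move=> Fz; have := le_lt_trans Fz F0.
  by rewrite ltr_pM2l// ltr_pXn2r ?nnegrE ?enorm_ge0.
have sq0 z : 0 <= k * enorm (z - p) ^+ 2 by rewrite mulr_ge0 ?sqr_ge0// ltW.
have {}xr : enorm (x - p) < r.
  apply: inside; rewrite /F /= mulrDr addrCA lerDl.
  by rewrite addr_ge0 ?enorm_ge0.
have {}yr : enorm (y - p) < r.
  apply: inside; rewrite /F /= mulrDr addrA lerDr.
  by rewrite addr_ge0 ?enorm_ge0.
have xy0 : 0 < enorm (x - y).
  apply: enorm_gt0; apply/negP; rewrite subr_eq0 => /eqP E.
  by apply: (disjB x) => //; rewrite E.
have yx0 : 0 < enorm (y - x) by rewrite enormB.
have tilt z : enorm (z - p) < r -> 4 * k * enorm (z - p) <= 4 * k * r.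
  by move=> zr; apply: ler_wpM2l; [apply: ltW; rewrite mulr_gt0|exact: ltW].
have inK b z : A z -> enorm (z - p) < r -> B b z ->
    exists2 d, 0 < d & forall w, A w -> enorm (w - z) < d -> K b w.
  move=> Az zr Bz; have [d d0 Hd] := oB b z Az (ltW zr) Bz.
  exists (Num.min d (r - enorm (z - p))); first by rewrite lt_min d0 subr_gt0.
  move=> w Aw; rewrite lt_min => /andP[wd]; rewrite ltrBrDr => wr.
  split; last exact: Hd.
  by split=> //; apply: ltW; apply: le_lt_trans wr; apply: ler_enorm_dist.
have [rx rx0 Hrx] := inK true x Ax xr Bx.
have [ry ry0 Hry] := inK false y Ay yr By.
have Kx : K true x by split=> //; split=> //; apply: ltW.
have Ky : K false y by split=> //; split=> //; apply: ltW.
have [mu [Hmu dmu]] : exists mu, unit_normal A x mu /\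
    enorm (mu - (enorm (x - y))^-1 *: (x - y)) <= 4 * k * enorm (x - p).
  apply: (penalized_min_normal (CA x Ax (ltW xr)) xy0 k0 rx0).
    exact: le_lt_trans (tilt x xr) kr.
  move=> z Az zr; have := Hmin z y (Hrx z Az zr) Ky.
  by rewrite /F /= !mulrDr !enorm_sqr !addrA lerD2r.
have [nu [Hnu dnu]] : exists mu, unit_normal A y mu /\
    enorm (mu - (enorm (y - x))^-1 *: (y - x)) <= 4 * k * enorm (y - p).
  apply: (penalized_min_normal (CA y Ay (ltW yr)) yx0 k0 ry0).
    exact: le_lt_trans (tilt y yr) kr.
  move=> z Az zr; have := Hmin x z Kx (Hry z Az zr).
  by rewrite /F /= !mulrDr !enorm_sqr (enormB x y) (enormB x z); lra.
exists x, y, mu, nu; split=> //.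
set u := (enorm (x - y))^-1 *: (x - y) in dmu.
have uE : (enorm (y - x))^-1 *: (y - x) = - u by rewrite /u enormB -scalerN opprB.
rewrite uE opprK in dnu.
have -> : mu + nu = (mu - u) + (nu + u) by rewrite addrACA addNr addr0.
apply: le_trans (ler_enormD _ _) _.
have -> : 8 * k * r = 4 * k * r + 4 * k * r by ring.
by apply: lerD; [apply: le_trans dmu _|apply: le_trans dnu _]; apply: tilt.
Qed.

End PenalizedDistance.

(** * The limit normals do not split *)

Lemma dset_closure (R : realType) (S : omin_structure R) n (A : set 'rV[R]_n) :
  dset S A -> dset S (closure A).
Proof.
move=> dA; apply: (@dset_ext _ S _ (fun x => forall e, 0 < e -> exists y, A y /\ enorm (y - x) < e)).
  move=> x; apply: iff_trans (iff_sym (closure_enormP A x)).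
  by split=> H e /H[y]; [case=> ? ?; exists y|move=> ? ?; exists y].
by definability.
Qed.

Section Unsplit.
Variables (R : realType) (S : omin_structure R) (n : nat).
Variables (X : set 'rV[R]_n.+1) (v : 'rV[R]_n.+1).
Hypotheses (n_gt0 : (0 < n)%N) (dX : dset S X) (pureX : pure_dim_at X n 0).
Hypotheses (v0 : v != 0) (v_reg : ~ tangent_cone (sing (closure X)) 0 v).

Let e := (enorm v)^-1 *: v.
Let e1 : enorm e = 1.
Proof. by apply: normalize_unit; rewrite gt_eqF// enorm_gt0. Qed.
Let A := closure X.

(** Normals at points tending to 0 along the ray that kept away from all limit
    normals would accumulate at one, the unit sphere being compact. *)
Lemma normals_near_limits d : 0 < d -> exists2 eps, 0 < eps &
  forall x mu, A x -> near_ray e eps x -> enorm mu = 1 -> secant_normal A x mu ->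
    exists2 nu, nash_normals X v nu & enorm (mu - nu) < d.
Proof.
move=> d0.
have ex kappa : exists r, enorm kappa = 1 -> 0 < r /\
    ((nash_normals X v kappa /\ r = d) \/
     forall x mu, A x -> near_ray e r x -> enorm mu = 1 -> secant_normal A x mu ->
       ~ enorm (mu - kappa) < r).
  have [k1|k1] := pselect (enorm kappa = 1); last by exists 0.
  have [Hk|Hk] := pselect (nash_normals X v kappa); first by exists d; split=> //; left.
  have [r [r0 Hr]] : exists r, 0 < r /\ ~ exists x, (A x /\ near_ray e r x) /\
      exists mu, (enorm mu = 1 /\ enorm (mu - kappa) < r) /\ secant_normal A x mu.
    apply: contrapT => H; apply: Hk; split=> // r r0.
    by apply: contrapT => H'; apply: H; exists r.
  exists r => _; split=> //; right=> x mu Ax nx mu1 sn dk; apply: Hr.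
  by exists x; split=> //; exists mu.
have [r Hr] := choice ex.
have [|s [sK sc]] := finite_net (@compact_sphere R n.+1) (r := r).
  by move=> k /Hr[].
have [|m m0 Hm] := @seq_lower_bound _ _ s r; first by move=> k /sK/Hr[].
exists m => // x mu Ax nx mu1 sn; have [k ks dk] := sc mu mu1.
have [_ [[Hk E]|H]] := Hr k (sK k ks); first by exists k => //; rewrite -E.
by case: (H x mu) => //; apply: near_ray_le nx; apply: Hm.
Qed.

Variable L : bool -> set 'rV[R]_n.+1.
Hypotheses (closedL : forall b, closed (L b)) (L0 : forall b, L b !=set0).
Hypothesis LN : forall b nu, L b nu -> L b (- nu).
Hypothesis unionL : forall nu, nash_normals X v nu <-> exists b, L b nu.
Hypothesis disjL : forall nu, L true nu -> ~ L false nu.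

Let compactL b : compact (L b).
Proof.
have sub : L b `<=` nash_normals X v by move=> nu Ln; apply/unionL; exists b.
have cN : compact (nash_normals X v) by apply: compact_nash_normals.
exact: (subclosed_compact (@closedL b) cN sub).
Qed.

Let separationL : exists2 m, 0 < m & forall b x y, L b x -> L (~~ b) y -> m <= enorm (x - y).
Proof.
have [m m0 Hm] := compact_separation (@compactL true) (@closedL false) disjL.
exists m => // -[] x y Lx Ly; first exact: Hm.
by rewrite enormB; apply: Hm.
Qed.

(** Suppose that the limit normals split into closed symmetric parts [L true]
    and [L false], at distance [m]. Near the ray every normal is within [d] of one
    part, so the closure of [X] splits there into two relatively closed pieces.
    By o-minimality each piece comes close to the ray at every small scale [t],
    so at a common scale both pieces meet a small ball around [t *: e], and
    [close_sheets_normals] produces normals from the two parts that almost agree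
    up to sign. *)
Lemma nash_normals_unsplit : False.
Proof.
have [eps0 /andP[eps00 eps01] CX] := hypersurface_cone n_gt0 dX pureX v0 v_reg.
have [m m0 sepL] := separationL.
(* Errors of at most [5 * d] add up below, which [m] has to exceed. *)
pose d := Num.min (m / 16) (1 / 2).
have d0 : 0 < d by rewrite lt_min; apply/andP; split; lra.
have dm : d <= m / 16 by rewrite ge_min lexx.
have d1 : d <= 1 / 2 by rewrite ge_min lexx orbT.
have [eps' eps'0 Heps'] := normals_near_limits d0.
pose eps1 := Num.min eps0 eps'.
have eps10 : 0 < eps1 by rewrite lt_min eps00.
have eps1le : eps1 <= eps0 by rewrite ge_min lexx.
have eps1le' : eps1 <= eps' by rewrite ge_min lexx orbT.
have hyp x : A x -> near_ray e eps1 x -> C1_submanifold_at n A x.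
  by move=> Ax nx; apply: CX => //; apply: near_ray_le nx.
have netE b : exists s : seq 'rV[R]_n.+1, (forall k, k \in s -> L b k) /\
    forall x, L b x -> exists2 k, k \in s & enorm (x - k) < d.
  by apply: (finite_net (@compactL b)).
have [s Hs] := choice netE.
pose W b mu := exists2 k, k \in s b & enorm (mu - k) < 2 * d.
have WL b mu : W b mu -> exists2 al, L b al & enorm (mu - al) < 2 * d.
  by move=> [k ks kd]; exists k => //; apply: (Hs b).1.
have LW b al mu : L b al -> enorm (mu - al) < d -> W b mu.
  move=> /((Hs b).2)[k ks kd] md; exists k => //.
  have := ler_enorm_dist mu al k; lra.
pose B b x := exists mu, unit_normal A x mu /\ W b mu.
have BL b x mu : B b x -> unit_normal A x mu -> exists2 al, L b al & enorm (mu - al) < 2 * d.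
  move=> [mu' [Hmu' /WL[al Lal dal]]] Hmu.
  have [->|->] := unit_normal_unique Hmu' Hmu; first by exists al.
  by exists (- al); [apply: LN|rewrite -opprD enormN].
have Btotal x : A x -> near_ray e eps1 x -> exists b, B b x.
  move=> Ax nx; have Cx := hyp x Ax nx; have [mu Hmu] := unit_normal_exists Cx.
  have [||nu /unionL[b Lnu] dnu] := Heps' x mu Ax _ Hmu.1.
  - exact: near_ray_le nx.
  - by apply/(secant_normalP Cx Hmu.1).
  by exists b, mu; split=> //; apply: LW dnu.
have Bexcl b x : B b x -> B (~~ b) x -> False.
  move=> Bx Bx'; have [mu [Hmu _]] := Bx.
  have [al Lal dal] := BL _ _ _ Bx Hmu; have [be Lbe dbe] := BL _ _ _ Bx' Hmu.
  have := sepL b al be Lal Lbe; have := ler_enorm_dist al mu be.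
  rewrite (enormB al mu); lra.
have Bopen b x : A x -> near_ray e eps1 x -> B b x ->
    exists2 r, 0 < r & forall y, A y -> enorm (y - x) < r -> B b y.
  move=> Ax nx Bx; have Cx := hyp x Ax nx; have [mu [Hmu _]] := Bx.
  have [al Lal dal] := BL _ _ _ Bx Hmu.
  have [r r0 Hr] := unit_normal_continuous Cx Hmu d0.
  have /nbhs_enormP[r' r'0 Hr'] : nbhs x [set x | near_ray e eps1 x].
    by apply: open_nbhs_nbhs; split=> //; apply: open_near_ray.
  exists (Num.min r r'); first by rewrite lt_min r0.
  move=> y Ay; rewrite lt_min => /andP[yr yr'].
  have [Cy [mu' [Hmu' dmu']]] := Hr y Ay yr.
  have [b' By] := Btotal y Ay (Hr' y yr').
  have [be Lbe dbe] := BL _ _ _ By Hmu'.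
  have [E|nE] := eqVneq b' b; first by rewrite -E.
  have {}nE : b' = ~~ b by clear -nE; move: b' b nE => [] [].
  rewrite nE in Lbe; have := sepL b al be Lal Lbe.
  have := ler_enorm_dist al mu be; have := ler_enorm_dist mu mu' be.
  rewrite (enormB al mu) (enormB mu mu'); lra.
(* Each piece is met at all small scales, not only along a sequence: the set of
   such scales is definable and accumulates at 0. *)
have scale b eta : 0 < eta -> eta <= eps1 -> exists2 tau, 0 < tau & forall t, 0 < t -> t < tau ->
    exists x, [/\ A x, enorm (x - t *: e) < eta * t & B b x].
  move=> eta0 etae; pose Q t := exists x : 'rV[R]_n.+1, (A x /\ enorm (x - t *: e) < eta * t) /\
     exists mu, (enorm mu = 1 /\ secant_normal A x mu) /\ W b mu.
  have dA : dset S A by apply: dset_closure.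
  have dQ : dset S (fun z : 'rV[R]_1 => Q (z 0 0)).
    by rewrite /Q /W /secant_normal; definability.
  have QB t : 0 < t -> t < eps1 -> Q t ->
      exists x, [/\ A x, enorm (x - t *: e) < eta * t & B b x].
    move=> t0 te [x [[Ax xt] [mu [[mu1 sn] Wmu]]]]; exists x; split=> //.
    exists mu; split=> //; apply/(secant_normalP _ mu1) => //; apply: hyp => //.
    exists t; split=> //; apply: lt_le_trans xt _; by rewrite ler_pM2r.
  have [tau tau0 [H|H]] := definable_right_decided 0 dQ.
    exists (Num.min tau eps1); first by rewrite lt_min tau0.
    move=> t t0; rewrite lt_min => /andP[tt te]; apply: QB => //.
    by apply: H; rewrite add0r t0.
  have [al Lal] := L0 b; have [_ Hal] := (unionL al).2 (ex_intro _ b Lal).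
  pose eps := Num.min d (Num.min tau eta).
  have eps_gt0 : 0 < eps by rewrite lt_min d0 lt_min tau0.
  have epsd : eps <= d by rewrite ge_min lexx.
  have epstau : eps <= tau by rewrite !ge_min lexx orbT.
  have epseta : eps <= eta by rewrite !ge_min lexx !orbT.
  have [x [[Ax [t [[t0 te] xt]]] [mu [[mu1 dmu] sn]]]] := Hal _ eps_gt0.
  case: (H t); first by rewrite add0r t0 (lt_le_trans te).
  exists x; split; first by split=> //; apply: lt_le_trans xt _; rewrite ler_pM2r.
  exists mu; split=> //; apply: (LW b al) => //; exact: lt_le_trans dmu epsd.
(* [rho] is the radius of the ball relative to the scale, [c] the weight of the
   penalty: it tilts the two normals by at most [8 * c * rho <= d] in all, while
   points at relative distance [eta] from the ray beat the penalty
   [c * rho ^+ 2] on the boundary. *)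
pose rho := eps1 / 2; have rho0 : 0 < rho by rewrite /rho; lra.
have rho1 : rho <= 1 / 2.
  have : eps1 <= 1 by apply: le_trans eps1le eps01.
  by rewrite /rho; lra.
have rhoe : rho < eps1 by rewrite /rho; lra.
pose c := d / 4; have c0 : 0 < c by rewrite /c; lra.
have c8 : c <= 1 / 8 by rewrite /c; lra.
pose eta := c * rho ^+ 2 / 8.
have rr0 : 0 < rho ^+ 2 by rewrite exprn_gt0.
have eta0 : 0 < eta by rewrite /eta divr_gt0// mulr_gt0.
have eta_rho : eta <= rho / 8.
  have : c * rho ^+ 2 <= 1 * rho.
    rewrite expr2 mulrA ler_pM2r//.
    have : c * rho <= (1 / 8) * (1 / 2) by apply: ler_pM => //; exact: ltW.
    lra.
  rewrite /eta; lra.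
have eta_small : 2 * eta + 2 * c * eta ^+ 2 < c * rho ^+ 2.
  have : c * eta ^+ 2 <= c * (rho / 8) ^+ 2.
    by rewrite ler_pM2l// ler_pXn2r ?nnegrE// ltW// divr_gt0.
  have -> : c * (rho / 8) ^+ 2 = c * rho ^+ 2 / 64 by field.
  have : 0 < c * rho ^+ 2 by rewrite mulr_gt0.
  rewrite {2}/eta; lra.
have ee : eta <= eps1 by rewrite /rho in eta_rho; lra.
have [tau1 tau10 H1] := scale true _ eta0 ee.
have [tau2 tau20 H2] := scale false _ eta0 ee.
pose t := Num.min eps1 (Num.min tau1 tau2) / 2.
have mt0 : 0 < Num.min eps1 (Num.min tau1 tau2) by rewrite lt_min eps10 lt_min tau10.
have t0 : 0 < t by rewrite /t; lra.
have tmin : t < Num.min eps1 (Num.min tau1 tau2) by rewrite /t; lra.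
have te1 : t < eps1 by apply: lt_le_trans tmin _; rewrite ge_min lexx.
have tt1 : t < tau1 by apply: lt_le_trans tmin _; rewrite !ge_min lexx orbT.
have tt2 : t < tau2 by apply: lt_le_trans tmin _; rewrite !ge_min lexx !orbT.
have [x0 [Ax0 dx0 Bx0]] := H1 t t0 tt1; have [y0 [Ay0 dy0 By0]] := H2 t t0 tt2.
have near x : enorm (x - t *: e) <= rho * t -> near_ray e eps1 x.
  move=> xt; exists t; split=> //; apply: le_lt_trans xt _; by rewrite ltr_pM2r.
pose K b := [set x | (A x /\ enorm (x - t *: e) <= rho * t) /\ B b x].
have cK b : compact (K b).
  apply: (@compact_eball _ _ (t *: e) (rho * t)); last by move=> y [[]].
  move=> x /closure_enormP Hx.
  have Ax : A x.
    apply: closed_closure; apply/closure_enormP => r /Hx[y [[Ay _] _] yx]; by exists y.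
  have xt : enorm (x - t *: e) <= rho * t.
    apply/ler_addgt0Pr => r /Hx[y [[_ yt] _] yx].
    have := ler_enorm_dist x y (t *: e); rewrite (enormB x y); lra.
  split=> //; have [b' Bx] := Btotal x Ax (near x xt).
  have [r r0 Hr] := Bopen b' x Ax (near x xt) Bx.
  have [y [[Ay _] By] yx] := Hx r r0; have By' := Hr y Ay yx.
  have [<-//|nE] := eqVneq b' b.
  have {}nE : b' = ~~ b by clear -nE; move: b' b nE => [] [].
  by rewrite nE in By'; case: (Bexcl b y).
have cKK := compact_setX (cK true) (cK false).
have k0 : 0 < c / t by rewrite divr_gt0.
have er : eta * t <= rho * t by rewrite ler_pM2r//; apply: le_trans eta_rho _; rewrite ler_pdivrMr// ler_peMr ?ler1n// ltW.
have small : 2 * (eta * t) + 2 * (c / t) * (eta * t) ^+ 2 < c / t * (rho * t) ^+ 2.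
  have -> : 2 * (eta * t) + 2 * (c / t) * (eta * t) ^+ 2 = t * (2 * eta + 2 * c * eta ^+ 2).
    by field; rewrite gt_eqF.
  have -> : c / t * (rho * t) ^+ 2 = t * (c * rho ^+ 2) by field; rewrite gt_eqF.
  by rewrite ltr_pM2l.
have crd : 8 * (c / t) * (rho * t) <= d.
  have -> : 8 * (c / t) * (rho * t) = d * (2 * rho) by rewrite /c; field; rewrite gt_eqF.
  rewrite -[leRHS]mulr1 ler_pM2l// mulrC -ler_pdivlMr//.
have kr1 : 4 * (c / t) * (rho * t) < 1.
  have -> : 4 * (c / t) * (rho * t) = (8 * (c / t) * (rho * t)) / 2 by field; rewrite gt_eqF.
  rewrite ltr_pdivrMr// mul1r; apply: le_lt_trans crd _; apply: le_lt_trans d1 _.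
  by rewrite ltr_pdivrMr// -natrM ltr1n.
have exK b : exists x, [/\ A x, B b x & enorm (x - t *: e) <= eta * t].
  by case: b; [exists x0|exists y0]; split=> //; apply: ltW.
have [x [y [mu [nu [Bx By Hmu Hnu dmn]]]]] :=
  close_sheets_normals k0 er small kr1 (fun x Ax xt => hyp x Ax (near x xt)) cK
    (fun b x Ax xt => Bopen b x Ax (near x xt)) (Bexcl true) exK.
have [al Lal dal] := BL _ _ _ Bx Hmu.
have [be Lbe dbe] := BL _ _ _ By Hnu.
have far := sepL true al (- be) Lal (LN Lbe); rewrite opprK in far.
have E : al + be = (al - mu) + (mu + nu) + (be - nu) by apply/rowP => i; rewrite !mxE; ring.
have near_al : enorm (al + be) <= 2 * d + d + 2 * d.
  rewrite E; apply: le_trans (ler_enormD _ _) _; apply: lerD.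
    apply: le_trans (ler_enormD _ _) _; apply: lerD; first by rewrite enormB ltW.
    exact: le_trans dmn crd.
  by rewrite enormB ltW.
lra.
Qed.

End Unsplit.

(** * Topology, definability and dimension of the Nash fiber *)

Section NashFiberProperties.
Variables (R : realType) (S : omin_structure R) (n : nat).
Variables (X : set 'rV[R]_n.+1) (v : 'rV[R]_n.+1).
Hypotheses (n_gt0 : (0 < n)%N) (dX : dset S X) (pureX : pure_dim_at X n 0).
Hypotheses (v0 : v != 0) (v_reg : ~ tangent_cone (sing (closure X)) 0 v).

Notation grass := (grassmannian R n n.+1).
Let N : set grass := nash_fiber X v.

Let NP (P : grass) nu : is_normal (val P) nu -> (N P <-> nash_normals X v nu).
Proof. exact: nash_fiberP n_gt0 dX pureX v0 v_reg P nu. Qed.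

Let normal (P : grass) := @grass_normal_exists R n.+1 (ltn0Sn n) P.

Let grass_coord_nash : @grass_coord R n n.+1 @` N = @perp_coord R n.+1 @` nash_normals X v.
Proof.
apply/seteqP; split=> [_ [P NPP <-]|_ [nu Hnu <-]].
  have [nu HP] := normal P; exists nu; first exact/(NP HP).
  by rewrite (@grass_coord_normal _ n.+1 P nu HP).
have [P HP] := @hyperplane_exists _ n.+1 nu Hnu.1; exists P; first exact/(NP HP).
exact: (@grass_coord_normal _ n.+1 P nu HP).
Qed.

Lemma nash_fiber_closed : closed N.
Proof.
move=> P clP; have [nu HP] := normal P.
apply/(NP HP); apply: closed_nash_normals; apply/closure_enormP => eps eps0.
have [|Q [NQ [mu [HQ d]]]] := clP [set Q | exists mu, is_normal (val Q) mu /\ enorm (mu - nu) < eps].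
  by apply/(grass_nbhs (ltn0Sn n) _ HP); exists eps => // Q mu ? ?; exists mu.
by exists mu => //; apply/(NP HQ).
Qed.

Lemma nash_fiber_connected : connected N.
Proof.
apply: contrapT => /connectedPn[E [E0 NE [sep1 sep2]]].
have sep b P : closure (E b) P -> E (~~ b) P -> False.
  case: b => /= c1 c2.
    by have : (E false `&` closure (E true)) P by []; rewrite sep2.
  by have : (closure (E false) `&` E true) P by []; rewrite sep1.
have EN b : E b `<=` N by move=> P EP; rewrite NE; case: b EP; [right|left].
pose L b := [set nu | exists P, E b P /\ is_normal (val P) nu].
apply: (nash_normals_unsplit n_gt0 dX pureX v0 v_reg (L := L)).
- move=> b nu /closure_enormP H.
  have Hnu : nash_normals X v nu.
    apply: closed_nash_normals; apply/closure_enormP => eps /H[mu [P [EP HP]] d].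
    by exists mu => //; apply/(NP HP)/(EN b).
  have [P HP] := @hyperplane_exists _ n.+1 nu Hnu.1; exists P; split=> //.
  have clP : closure (E b) P.
    move=> B /(grass_nbhs (ltn0Sn n) _ HP)[eps /H[mu [Q [EQ HQ]] d] HB].
    by exists Q; split=> //; apply: HB d.
  have : N P by apply/(NP HP).
  rewrite NE; have [|nEP] := pselect (E b P) => //.
  by case: b clP nEP {H} => clP nEP [EP|EP] //; case: (sep _ _ clP EP).
- by move=> b; have [P EP] := E0 b; have [nu HP] := normal P; exists nu, P.
- by move=> b nu [P [EP HP]]; exists P; split=> //; apply: is_normalN.
- move=> nu; split=> [Hnu|[b [P [EP HP]]]]; last by apply/(NP HP)/(EN b).
  have [P HP] := @hyperplane_exists _ n.+1 nu Hnu.1.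
  have : N P by apply/(NP HP).
  by rewrite NE => -[EP|EP]; [exists false, P|exists true, P].
- move=> nu [P [EP HP]] [Q [EQ HQ]].
  have PQ : P = Q by apply: (@grass_normal_inj R n.+1) HP HQ.
  by apply: (sep true P); [apply: subset_closure|rewrite PQ].
Qed.

Lemma nash_normals_definable : dset S (nash_normals X v).
Proof.
have dA : dset S (closure X) by apply: dset_closure.
by rewrite /nash_normals /near_ray /secant_normal /mkset; definability.
Qed.

Lemma nash_fiber_definable : grass_definable S N.
Proof.
have dN := nash_normals_definable.
rewrite /grass_definable; rewrite [X in definable S X]grass_coord_nash.
have d' : dset S (fun z : 'rV[R]_(n.+1 * n.+1) => exists nu, nash_normals X v nu /\
    forall i j : 'I_n.+1, (i == j)%:R - nu 0 i * nu 0 j = z 0 (mxvec_index i j)).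
  by definability.
apply: dset_ext d' => z; split=> [[nu [Hnu H]]|[nu Hnu <-]]; exists nu => //.
  by apply/rowP => k; case/mxvec_indexP: k => i j; rewrite perp_coordE H.
by split=> // i j; rewrite perp_coordE.
Qed.

(** A connected set with two points has an interval among its coordinate
    projections. *)
Lemma nash_fiber_dim_gt0 : (exists P Q, [/\ N P, N Q & P <> Q]) -> (0 < grass_dim N)%N.
Proof.
move=> [P [Q [NPP NQ PQ]]].
have [k Pk] : exists k, grass_coord P 0 k != grass_coord Q 0 k.
  apply: contrapT => /forallNP H; apply: PQ; apply: (grass_coord_inj (ltn0Sn n)).
  by apply/rowP => k; apply/eqP; have /negP := H k; rewrite negbK.
pose f (T : grass) : R := grass_coord T 0 k.
have cf : continuous f.
  move=> T; apply: (@continuous_comp _ _ _ (@grass_coord R n n.+1) (fun z => z 0 k)).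
    exact: initial_continuous.
  exact: coord_continuous.
have itv : is_interval (f @` N).
  apply/connected_intervalP/connected_continuous_connected; first exact: nash_fiber_connected.
  exact: continuous_subspaceT.
have cK : compact (@grass_coord R n n.+1 @` N).
  rewrite grass_coord_nash; apply: continuous_compact; last exact: compact_nash_normals.
  by apply: continuous_subspaceT; apply: continuous_perp_coord.
have main P' Q' : N P' -> N Q' -> f P' < f Q' -> (0 < grass_dim N)%N.
  move=> NP' NQ' PQ'; apply: (definable_dim_gt0 (i := k) nash_fiber_definable cK PQ').
  move=> t /andP[t1 t2].
  have tPQ : f P' <= t <= f Q' by rewrite !ltW.
  have [T NT Tt] := itv _ _ (imageP f NP') (imageP f NQ') t tPQ.
  by exists (grass_coord T) => //; exists T.
have [PQ'|PQ'|PQ'] := ltgtP (f P) (f Q); [exact: main PQ'|exact: main PQ'|].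
by move: Pk; rewrite -/(f P) -/(f Q) PQ' eqxx.
Qed.

End NashFiberProperties.

Theorem theorem1p2 (R : realType) (S : omin_structure R) (n : nat)
    (hn : (2 <= n)%N) (X : set 'rV[R]_n) (hX : definable S X)
    (hdim : pure_dim_at X n.-1 0) (v : 'rV[R]_n) (hv : v != 0)
    (hray : ray v `<=` exceptional_rays X) :
  let N : set (grassmannian R n.-1 n) := nash_fiber X v in
  [/\ closed N, connected N, grass_definable S N & (0 < grass_dim N)%N].
Proof.
have /hray[_ cone big] : ray v v by exists 1; [exact: ltr01|rewrite scale1r].
have {cone} [_ v_reg] : (tangent_cone X 0 `\` tangent_cone (sing (closure X)) 0) v.
  by apply: cone; exists 1; [exact: ltr01|rewrite scale1r].
case: n hn X hX hdim v hv hray big v_reg => [//|n] n_gt0 X dX pureX v v0 _ big v_reg N.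
split.
- exact: nash_fiber_closed n_gt0 dX pureX v0 v_reg.
- exact: nash_fiber_connected n_gt0 dX pureX v0 v_reg.
- exact: nash_fiber_definable n_gt0 dX pureX v0 v_reg.
- exact: nash_fiber_dim_gt0 n_gt0 dX pureX v0 v_reg big.
Qed.
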